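(* Let $N\ge1$, $0<s<1$, $1<p<\infty$ with $s\,p>N$, and let $x_0,y_0\in\mathbb{R}^N$ be two distinct points. For $u:\mathbb{R}^N\to\mathbb{R}$ the following are equivalent: (i) $u\in\mathcal{W}^{s,p}(\mathbb{R}^N)$ is an extremal for $\mathfrak{m}_{s,p}(\mathbb{R}^N)$ and $[u]_{C^{0,\alpha_{s,p}}(\mathbb{R}^N)}=\frac{|u(x_0)-u(y_0)|}{|x_0-y_0|^{\alpha_{s,p}}}$; (ii) $u\in \mathcal{W}^{s,p}(\mathbb{R}^N)$ weakly solves $(-\Delta_p)^s u=c\,(\delta_{x_0}-\delta_{y_0})$ in $\mathbb{R}^N$ for some constant $c\neq0$, i.e. \[ \iint_{\mathbb{R}^N\times\mathbb{R}^N} \frac{J_p(u(x)-u(y))\,(\varphi(x)-\varphi(y))}{|x-y|^{N+s\,p}}\,dx\,dy=c\,(\varphi(x_0)-\varphi(y_0))\quad\text{for every }\varphi\in\mathcal{W}^{s,p}(\mathbb{R}^N); \] (iii) $u\in\mathcal{W}^{s,p}(\mathbb{R}^N)$ is non-constant and is the unique minimizer of \[ \inf_{\varphi\in \mathcal{W}^{s,p}(\mathbb{R}^N)}\Big\{[\varphi]^p_{W^{s,p}(\mathbb{R}^N)}\, :\, \varphi(x_0)=u(x_0)\, \mbox{ and } \varphi(y_0)=u(y_0)\Big\}. \]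
   Context: $J_p(t)=|t|^{p-2}t$. $[\varphi]_{W^{s,p}(\mathbb{R}^N)}=\left(\iint_{\mathbb{R}^N\times\mathbb{R}^N}\frac{|\varphi(x)-\varphi(y)|^p}{|x-y|^{N+s\,p}}dx\,dy\right)^{1/p}$; $[\varphi]_{C^{0,\alpha}(\mathbb{R}^N)}=\sup_{x\ne y}\frac{|\varphi(x)-\varphi(y)|}{|x-y|^\alpha}$; $\alpha_{s,p}=s-N/p$. $\mathcal{W}^{s,p}(\mathbb{R}^N)$ is the set of continuous functions with finite $[\cdot]_{C^{0,\alpha_{s,p}}(\mathbb{R}^N)}$ and finite $[\cdot]_{W^{s,p}(\mathbb{R}^N)}$. $\mathfrak{m}_{s,p}(\mathbb{R}^N)=\inf\{[\varphi]^p_{W^{s,p}(\mathbb{R}^N)}:\varphi\in C^\infty_0(\mathbb{R}^N),\ [\varphi]_{C^{0,\alpha_{s,p}}(\mathbb{R}^N)}=1\}$. An extremal is a non-constant $u\in\mathcal{W}^{s,p}(\mathbb{R}^N)$ with $[u]^p_{W^{s,p}(\mathbb{R}^N)}=\mathfrak{m}_{s,p}(\mathbb{R}^N)[u]^p_{C^{0,\alpha_{s,p}}(\mathbb{R}^N)}$. *)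

(* Defs.v *)
From HB Require Import structures.
From mathcomp Require Import all_boot all_order all_algebra.
From mathcomp Require Import all_classical all_reals all_analysis.
Unset Printing Implicit Defensive.
Import Order.TTheory GRing.Theory Num.Theory.
Import numFieldNormedType.Exports.
Local Open Scope classical_set_scope.
Local Open Scope ring_scope.

Definition enorm {R : realType} {N : nat} (x : 'rV[R]_N) : R :=
  Num.sqrt (\sum_(i < N) x 0 i ^+ 2).

(* Integral over R^n (w.r.t. n-dimensional Lebesgue measure) of an
   extended-real valued function, written as the iterated one-dimensional
   Lebesgue integral; for nonnegative measurable functions this coincides
   with the integral w.r.t. the n-dimensional Lebesgue measure (Tonelli). *)
Fixpoint iint {R : realType} (n : nat) : ('rV[R]_n -> \bar R) -> \bar R :=
  match n return ('rV[R]_n -> \bar R) -> \bar R with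
  | 0 => fun f => f 0
  | n'.+1 => fun f =>
      (\int[@lebesgue_measure R]_x
         iint n' (fun t : 'rV[R]_n' => f (row_mx (\row_(j < 1) x) t)))%E
  end.
Arguments iint {R} {n}.

Definition iint2_nonneg {R : realType} {N : nat} (F : 'rV[R]_N -> 'rV[R]_N -> R)
  : \bar R := iint (fun x => iint (fun y => (F x y)%:E)).

(* Lebesgue integral over R^N x R^N of a real function:
   integral of the positive part minus integral of the negative part
   (the same convention as MathComp-Analysis' integral). *)
Definition iint2 {R : realType} {N : nat} (F : 'rV[R]_N -> 'rV[R]_N -> R)
  : \bar R :=
  (iint2_nonneg (fun x y => (Num.max (F x y) 0)%R)
   - iint2_nonneg (fun x y => (Num.max (- F x y) 0)%R))%E.

Definition Jp {R : realType} (p t : R) : R := (`|t| `^ (p - 2)) * t.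

Definition alpha_sp {R : realType} (N : nat) (s p : R) : R := s - N%:R / p.

Definition gagliardo_p {R : realType} {N : nat} (s p : R)
  (phi : 'rV[R]_N -> R) : \bar R :=
  iint2_nonneg (fun x y =>
    `|phi x - phi y| `^ p / (enorm (x - y)) `^ (N%:R + s * p)).

Definition holder_semi {R : realType} {N : nat} (alpha : R)
  (phi : 'rV[R]_N -> R) : \bar R :=
  ereal_sup [set r | exists x y : 'rV[R]_N, x != y /\
               r = ((`|phi x - phi y| / (enorm (x - y)) `^ alpha)%:E)].

Definition Wsp {R : realType} {N : nat} (s p : R) (phi : 'rV[R]_N -> R) : Prop :=
  continuous phi /\
  (holder_semi (alpha_sp N s p) phi < +oo)%E /\
  (gagliardo_p s p phi < +oo)%E.

Fixpoint Ck {R : realType} {N : nat} (k : nat) (f : 'rV[R]_N -> R) : Prop :=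
  match k with
  | 0 => continuous f
  | k'.+1 => (forall x, differentiable f x) /\
             forall i : 'I_N, Ck k' (fun x => derive f x (delta_mx 0 i))
  end.

Definition Cinf0 {R : realType} {N : nat} (f : 'rV[R]_N -> R) : Prop :=
  (forall k, Ck k f) /\ compact (closure [set x | f x != 0]).

Definition msp {R : realType} (N : nat) (s p : R) : \bar R :=
  ereal_inf [set gagliardo_p s p phi | phi in
     [set phi : 'rV[R]_N -> R | Cinf0 phi /\ holder_semi (alpha_sp N s p) phi = 1%E]].

Definition nonconstant {R : realType} {N : nat} (u : 'rV[R]_N -> R) : Prop :=
  exists x y, u x != u y.

Definition extremal {R : realType} {N : nat} (s p : R) (u : 'rV[R]_N -> R) : Prop :=
  Wsp s p u /\ nonconstant u /\
  gagliardo_p s p u =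
    (msp N s p * ((fine (holder_semi (alpha_sp N s p) u)) `^ p)%:E)%E.

Definition weak_lhs {R : realType} {N : nat} (s p : R)
  (u phi : 'rV[R]_N -> R) : \bar R :=
  iint2 (fun x y => Jp p (u x - u y) * (phi x - phi y)
                    / (enorm (x - y)) `^ (N%:R + s * p)).

(* Main.v *)
(* [phi |-> [phi]^p] is a strictly convex energy of the increments of [phi].
   Hence a non-constant [u] solves the equation with the two Dirac masses exactly
   when it minimizes the energy among functions with the same values at [x0] and
   [y0], and such a minimizer is unique.

   A similarity [T] of R^n maps [(x0, y0)] to any other pair of distinct points
   [(x1, y1)].  The energy of [phi \o T] and the p-th power of its Hoelder
   quotient at [(x0, y0)] differ from those of [phi] and of its quotient at
   [(x1, y1)] by the same power of the ratio of [T].  So a minimizer for the pair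
   [(x0, y0)] minimizes the ratio of the energy to the p-th power of a Hoelder
   quotient over all functions and all pairs: taking [phi := u], its Hoelder
   seminorm is attained at [(x0, y0)]; taking test functions, it is extremal.

   Conversely an extremal whose seminorm is attained at [(x0, y0)] is minimal for
   that pair once the inequality defining the best constant is extended from test
   functions to the whole space.  For this, [phi] is clamped between [- psi] and
   [psi], where [psi] is a wide cutoff, above [|phi|] at [x0] and [y0], of small
   energy (possible since [s p > n]), and then mollified, which does not increase
   the energy by Jensen's inequality. *)
Require Import Defs.
From HB Require Import structures.
From mathcomp Require Import all_boot all_order all_algebra.
From mathcomp Require Import all_classical all_reals all_analysis.
From mathcomp Require Import measurable_realfun ring lra.
Import Order.TTheory GRing.Theory Num.Theory.
Import numFieldNormedType.Exports.
Local Open Scope classical_set_scope.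
Local Open Scope ring_scope.

(** * Lebesgue measure on row vectors *)

(** The integrals of the statement are iterated one-dimensional ones. They are represented by a
    sigma-finite measure [lam], so that Tonelli, dominated convergence and null sets become
    available. Its invariance under a Euclidean reflection is invisible in an iterated integral and
    is deduced from translation invariance alone, as in the uniqueness of Haar measure; a single
    reflection then suffices to build the similarity between two pairs of points.

    A function of [Wsp] may be unbounded, and multiplying it by a cutoff would bring its size into
    the energy. Clamping does not: an increment of the clamped function is at most the larger of the
    increments of the function and of the cutoff. The approximants need only be close to the
    function at the two points and have an energy that is not much larger; no convergence in norm
    enters.

    The constant of the equation is [u]^p / (u(x0) - u(y0)), found by testing with u itself.
    Uniqueness comes from the strictness of the tangent inequality for |t|^p. *)

Definition coord_sets (R : realType) (n : nat) : set (set 'rV[R]_n) :=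
  [set A | exists (i : 'I_n) (B : set R), measurable B /\
     A = (fun x : 'rV[R]_n => x 0 i) @^-1` B].

Notation RV R n := (g_sigma_algebraType (coord_sets R n)).

Lemma measurable_coord (R : realType) (n : nat) (i : 'I_n) :
  measurable_fun setT (fun x : RV R n => (x : 'rV[R]_n) 0 i).
Proof.
move=> _ B mB; rewrite setTI; apply: sub_sigma_algebra.
by exists i, B.
Qed.

Lemma measurable_rvP (R : realType) (n : nat) d (T : measurableType d)
    (f : T -> RV R n) :
  (forall i, measurable_fun setT (fun x => (f x : 'rV[R]_n) 0 i)) ->
  measurable_fun setT f.
Proof.
move=> mf; refine (@measurability _ _ _ _ setT f (coord_sets R n) erefl _).
by move=> _ [_ [i [B [mB ->]]] <-]; exact: mf.
Qed.

Lemma measurable_row_mx (R : realType) (n : nat) :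
  measurable_fun setT
   (fun z : (measurableTypeR R * RV R n)%type =>
     row_mx (\row_(j < 1) z.1) (z.2 : 'rV[R]_n) : RV R n.+1).
Proof.
apply: measurable_rvP => i.
have [k ->|k ->] := @split_ordP 1 n i.
  rewrite (_ : (fun x => _) = fst); first exact: measurable_fst.
  by apply/funext => z; rewrite (@row_mxEl R 1 1 n) mxE.
rewrite (_ : (fun x => _) = (fun x : RV R n => (x : 'rV[R]_n) 0 k) \o snd).
  by apply: measurableT_comp; [exact: measurable_coord|exact: measurable_snd].
by apply/funext => z; rewrite (@row_mxEr R 1 1 n).
Qed.

(** Balls of the sup norm are coordinate boxes; those with rational centre and radius 1 / (k + 1)
    that lie in [U] form a countable cover of [U]. *)
Lemma open_measurable_rv (R : realType) (n : nat) (U : set 'rV[R]_n) :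
  open U -> measurable (U : set (RV R n)).
Proof.
move=> oU.
pose box (q : 'rV[rat]_n) (k : nat) : set 'rV[R]_n :=
  [set x | forall i, ball (ratr (q 0 i) : R) (k.+1%:R^-1) (x 0 i)].
have mbox q k : measurable (box q k : set (RV R n)).
  rewrite (_ : box q k = \bigcap_(i in setT)
      (fun x : 'rV[R]_n => x 0 i) @^-1` ball (ratr (q 0 i) : R) (k.+1%:R^-1)).
    apply: fin_bigcap_measurable => [|i _]; first exact: finite_finset.
    have := measurable_coord R n i measurableT _ (measurable_ball (ratr (q 0 i)) k.+1%:R^-1).
    by rewrite setTI.
  by apply/seteqP; split => x /= bx i; [move=> _; exact: bx|exact: bx].
pose F (z : 'rV[rat]_n * nat) : set (RV R n) :=
  if pselect (box z.1 z.2 `<=` U) then box z.1 z.2 else set0.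
rewrite (_ : U = \bigcup_z F z).
  apply: countable_bigcupT_measurable => // z.
  rewrite /F; case: (pselect _) => [bU|nbU]; last exact: measurable0.
  exact: mbox.
apply/seteqP; split=> [x Ux|x [z _]]; last first.
  by rewrite /F; case: (pselect _) => [bU|nbU] //= bx; exact: bU.
have /nbhs_ballP[e /= e0 eU] := open_nbhs_nbhs (conj oU Ux).
have [k ke] : exists k : nat, k.+1%:R^-1 < e / 2.
  have e2 : 0 < e / 2 by rewrite divr_gt0.
  have [k _ /(_ k (leqnn k)) kP] := near_infty_natSinv_lt (PosNum e2).
  by exists k.
have k0 : 0 < (k.+1%:R^-1 : R) by rewrite invr_gt0.
have exq i : exists q : rat, ratr q \in `](x 0 i : R), (x 0 i + k.+1%:R^-1)[.
  by apply: rat_in_itvoo; rewrite ltrDl.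
pose q : 'rV[rat]_n := \row_i sval (cid (exq i)).
have qP i : `|ratr (q 0 i) - x 0 i| < k.+1%:R^-1.
  rewrite mxE; have := svalP (cid (exq i)); rewrite in_itv /= => /andP[a b].
  by rewrite ger0_norm ?subr_ge0 ?(ltW a)// ltrBlDl.
exists (q, k) => //; rewrite /F; case: (pselect _) => [bU|nbU] /=.
  by move=> i; exact: qP.
apply: nbU => y yb; apply: eU; split => // i j; rewrite (ord1 i).
rewrite /ball /=.
have := qP j; have := yb j; rewrite /ball/= => yj xj.
rewrite distrC; rewrite -(subrKA (ratr (q 0 j))).
apply: le_lt_trans (ler_normD _ _) _.
rewrite [e]splitr ltrD// ?(lt_trans xj)//.
by rewrite distrC (lt_trans yj).
Qed.

Lemma continuous_measurable_rv (R : realType) (n : nat) (f : 'rV[R]_n -> R) :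
  continuous f -> measurable_fun setT (f : RV R n -> R).
Proof.
move=> /continuousP cf; apply: (measurability _ (RGenOpens.measurableE R)).
move=> _ [_ [a [b ->] <-]]; rewrite setTI; apply: open_measurable_rv.
exact/cf/interval_open.
Qed.

Lemma iint_ge0 (R : realType) (n : nat) (f : 'rV[R]_n -> \bar R) :
  (forall x, 0 <= f x)%E -> (0 <= iint f)%E.
Proof.
elim: n f => [|n IH] f f0 /=; first exact: f0.
by apply: integral_ge0 => x _; exact: IH.
Qed.

(** The left inverse [g] pulls an exhaustion of [T1] by sets of finite measure back to one of
    [T2]. *)
Lemma sigma_finite_pushforward (R : realType) d1 d2 (T1 : measurableType d1)
    (T2 : measurableType d2) (mu : {measure set T1 -> \bar R})
    (f : T1 -> T2) (g : T2 -> T1) : sigma_finite setT mu ->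
  measurable_fun setT f -> measurable_fun setT g -> cancel f g ->
  {nu : {sigma_finite_measure set T2 -> \bar R} |
    forall h : T2 -> \bar R, measurable_fun setT h -> (forall x, 0 <= h x)%E ->
      (\int[nu]_x h x = \int[mu]_x h (f x))%E}.
Proof.
move=> sf mf mg fK.
pose nu : {measure set T2 -> \bar R} :=
  measure_function_pushforward__canonical__measure_function_Measure mu mf.
have nusf : sigma_finite setT nu.
  have [F TF FP] := sf.
  exists (fun k => g @^-1` F k) => [|k].
    apply/seteqP; split => // x _.
    have : setT (g x) by [].
    by rewrite TF => -[k _ Fk]; exists k.
  have [mF Foo] := FP k; split.
    by rewrite -[X in measurable X]setTI; exact: mg.
  rewrite /nu /= /pushforward -comp_preimage (_ : g \o f = id) ?preimage_id//.
  exact/funext.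
pose H := Measure_isSigmaFinite.Build _ _ _ nu nusf.
pose nu' : {sigma_finite_measure set T2 -> \bar R} := HB.pack (Measure.sort nu) H.
exists nu' => h mh h0.
by rewrite [LHS](ge0_integral_pushforward mf mu).
Qed.

(** Serves twice: to pass from dimension n to n + 1 and, with identity maps, to regard a product
    measure as a sigma-finite measure again, as Tonelli in three variables requires. *)
Lemma sigma_finite_pushforward_prod (R : realType) d1 d2 d3 (T1 : measurableType d1)
    (T2 : measurableType d2) (T3 : measurableType d3)
    (m1 : {sigma_finite_measure set T1 -> \bar R})
    (m2 : {sigma_finite_measure set T2 -> \bar R})
    (f : T1 * T2 -> T3) (g : T3 -> T1 * T2) :
  measurable_fun setT f -> measurable_fun setT g -> cancel f g ->
  {nu : {sigma_finite_measure set T3 -> \bar R} |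
    forall h : T3 -> \bar R, measurable_fun setT h -> (forall x, 0 <= h x)%E ->
      (\int[nu]_x h x = \int[m1]_x \int[m2]_y h (f (x, y)))%E}.
Proof.
move=> mf mg fK.
pose m12 : {measure set (T1 * T2)%type -> \bar R} := (m1 \x m2)%E.
have sf12 : sigma_finite setT m12.
  have /sigma_finiteP[F [TF ndF Foo]] := sigma_finiteT m1.
  have /sigma_finiteP[G [TG ndG Goo]] := sigma_finiteT m2.
  exists (fun n => F n `*` G n) => [|n]; last first.
    have [mF Fn] := Foo n; have [mG Gn] := Goo n.
    split; first exact: measurableX.
    by rewrite /m12 [X in (X < _)%E]product_measure1E// lte_mul_pinfty// ge0_fin_numE.
  apply/seteqP; split => // -[x y] _.
  have : setT x by []. have : setT y by [].
  rewrite {1}TF {1}TG => -[j _ Gy] [i _ Fx]; exists (maxn i j) => //; split => /=.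
    by have /subsetPset/(_ _ Fx) := ndF _ _ (leq_maxl i j).
  by have /subsetPset/(_ _ Gy) := ndG _ _ (leq_maxr i j).
have [nu nuE] := sigma_finite_pushforward R _ _ _ _ m12 _ _ sf12 mf mg fK.
exists nu => h mh h0; rewrite nuE// (fubini_tonelli1 (h \o f))//=.
exact: measurableT_comp.
Qed.

(** The induction follows the recursion of [iint]: a Dirac mass in dimension 0, where there is a
    single row vector, then the image under concatenation of the product with one-dimensional
    Lebesgue measure. *)
Lemma lebesgue_rv_exists (R : realType) (n : nat) :
  {mu : {sigma_finite_measure set (RV R n) -> \bar R} |
    forall f : RV R n -> \bar R, measurable_fun setT f ->
      (forall x, 0 <= f x)%E -> (\int[mu]_x f x = iint f)%E}.
Proof.
elim: n => [|n [mu muE]].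
  pose mu : {sigma_finite_measure set (RV R 0) -> \bar R} := \d_(0 : RV R 0).
  exists mu => f mf f0 /=.
  by rewrite integral_dirac// diracT mul1e.
pose phi (z : (measurableTypeR R * RV R n)%type) : RV R n.+1 :=
  row_mx (\row_(j < 1) z.1) (z.2 : 'rV[R]_n).
pose psi (x : RV R n.+1) : (measurableTypeR R * RV R n)%type :=
  ((x : 'rV[R]_n.+1) 0 (lshift n (0 : 'I_1)), rsubmx (x : 'rV[R]_(1 + n))).
have mphi : measurable_fun setT phi := measurable_row_mx R n.
have mpsi : measurable_fun setT psi.
  apply: measurable_fun_pair; first exact: measurable_coord.
  apply: measurable_rvP => i.
  rewrite (_ : (fun x => _) = (fun x : RV R n.+1 => (x : 'rV[R]_n.+1) 0 (rshift 1 i))).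
    exact: measurable_coord.
  by apply/funext => x; rewrite mxE.
have phiK : cancel phi psi.
  move=> [x t]; rewrite /phi /psi /=; congr pair.
    by rewrite (@row_mxEl R 1 1 n) mxE.
  by rewrite row_mxKr.
have [nu nuE] := sigma_finite_pushforward_prod R _ _ _ _ _ _
  (@lebesgue_measure R) mu _ _ mphi mpsi phiK.
exists nu => f mf f0; rewrite nuE//.
apply: eq_integral => x _.
rewrite muE//.
have mfphi : measurable_fun setT (f \o phi) by exact: measurableT_comp.
exact: (measurableT_comp mfphi (pair1_measurable x)).
Qed.

Definition lam (R : realType) (n : nat) :
  {sigma_finite_measure set (RV R n) -> \bar R} := sval (lebesgue_rv_exists R n).

Lemma integral_lam (R : realType) (n : nat) (f : RV R n -> \bar R) :
  measurable_fun setT f -> (forall x, 0 <= f x)%E ->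
  (\int[lam R n]_x f x = iint f)%E.
Proof. exact: (svalP (lebesgue_rv_exists R n)). Qed.

Lemma integral_lebesgue_shift (R : realType) (c : R) (f : R -> \bar R) :
  measurable_fun setT f -> (forall x, 0 <= f x)%E ->
  (\int[@lebesgue_measure R]_x f (x + c)%R = \int[@lebesgue_measure R]_x f x)%E.
Proof.
move=> mf f0.
pose h (x : measurableTypeR R) : measurableTypeR R := x + c.
have mh : measurable_fun setT h by exact: measurable_funD.
transitivity (\int[pushforward lebesgue_measure h]_x f x)%E.
  by rewrite (ge0_integral_pushforward mh lebesgue_measure).
pose m := measure_function_pushforward__canonical__measure_function_Measure lebesgue_measure mh.
apply: (@eq_measure_integral _ _ _ _ lebesgue_measure m) => A mA _.
apply/esym/(@lebesgue_measure_unique R m) => // _ [[a b]] _ <- /=.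
rewrite /pushforward (_ : h @^-1` _ = `]a - c, b - c]%classic); last first.
  by apply/seteqP; split => x; rewrite /h /= !in_itv /= ltrBlDr lerBrDr.
rewrite !lebesgue_measure_itv /= !lte_fin ltrD2r.
by case: ifP => // _; rewrite -!EFinB opprB addrA subrK.
Qed.

Lemma measurable_iint (R : realType) (n : nat) (f : RV R n.+1 -> \bar R) :
  measurable_fun setT f -> (forall x, 0 <= f x)%E ->
  measurable_fun setT (fun x : measurableTypeR R =>
    iint (fun t : 'rV[R]_n => f (row_mx (\row_(j < 1) x) t))).
Proof.
move=> mf f0.
have mfr := measurableT_comp mf (measurable_row_mx R n).
have := measurable_fun_fubini_tonelli_F (m2 := lam R n) _ mfr (fun z => f0 _).
congr (measurable_fun _ _); apply/funext => x; rewrite /fubini_F /=.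
rewrite integral_lam//; exact: (measurableT_comp mfr (pair1_measurable x)).
Qed.

Lemma iint_shift (R : realType) (n : nat) (c : 'rV[R]_n) (f : RV R n -> \bar R) :
  measurable_fun setT f -> (forall x, 0 <= f x)%E ->
  iint (fun x : 'rV[R]_n => f (x + c)%R) = iint f.
Proof.
elim: n c f => [|n IH] c f mf f0 /=; first by rewrite thinmx0.
rewrite -[RHS](integral_lebesgue_shift _ (c 0 (lshift n (0 : 'I_1))))//; last 2 first.
- exact: measurable_iint.
- by move=> x; exact: iint_ge0.
apply: eq_integral => x _.
have mfr : measurable_fun setT (fun t : RV R n =>
    f (row_mx (\row_(j < 1) (x + c 0 (lshift n (0 : 'I_1)))) (t : 'rV[R]_n))).
  have mfr := measurableT_comp mf (measurable_row_mx R n).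
  exact: (measurableT_comp mfr (pair1_measurable _)).
rewrite -[RHS](IH (rsubmx (c : 'rV[R]_(1 + n))))//.
congr iint; apply/funext => t; congr f.
apply/rowP => i; have [k ->|k ->] := @split_ordP 1 n i.
  by rewrite mxE !(@row_mxEl R 1 1 n) !mxE (ord1 k).
by rewrite mxE !(@row_mxEr R 1 1 n) !mxE.
Qed.

Lemma measurable_shift_rv (R : realType) (n : nat) (c : 'rV[R]_n) :
  measurable_fun setT (fun x : RV R n => (x : 'rV[R]_n) + c : RV R n).
Proof.
apply: measurable_rvP => i; rewrite (_ : (fun x => _) =
  (fun x : RV R n => (x : 'rV[R]_n) 0 i + c 0 i)).
  by apply: measurable_funD => //; exact: measurable_coord.
by apply/funext => x; rewrite mxE.
Qed.

Lemma integral_lam_shift (R : realType) (n : nat) (c : 'rV[R]_n)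
    (f : RV R n -> \bar R) :
  measurable_fun setT f -> (forall x, 0 <= f x)%E ->
  (\int[lam R n]_x f ((x : 'rV[R]_n) + c)%R = \int[lam R n]_x f x)%E.
Proof.
move=> mf f0; rewrite !integral_lam//; first exact: iint_shift.
exact: measurableT_comp (measurable_shift_rv R n c).
Qed.

(** The factor [c] is there for the induction: the indicator of the first coordinate is absorbed
    into it. *)
Lemma iint_box (R : realType) (n : nat) (r c : R) : 0 <= r -> 0 <= c ->
  iint (fun x : 'rV[R]_n =>
    (c * \prod_(i < n) \1_(`[(- r), r]%classic : set R) (x 0 i))%:E) =
  (c * (r *+ 2) ^+ n)%:E.
Proof.
move=> r0; elim: n c => [|n IH] c c0 /=; first by rewrite big_ord0 expr0.
under eq_integral => x _.
  rewrite (_ : (fun t : 'rV[R]_n => _) = (fun t : 'rV[R]_n => 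
    ((c * \1_(`[(- r), r]%classic : set R) x) *
     \prod_(i < n) \1_(`[(- r), r]%classic : set R) (t 0 i))%:E)); last first.
    apply/funext => t; rewrite (@big_split_ord R _ _ 1 n) /= big_ord1 mulrA.
    rewrite (@row_mxEl R 1 1 n) mxE; congr (_ * _)%:E.
    by apply: eq_bigr => i _; rewrite (@row_mxEr R 1 1 n).
  rewrite IH ?mulr_ge0// -mulrA mulrC -mulrA EFinM mulrC.
  over.
rewrite ge0_integralZr//=; last by rewrite lee_fin mulr_ge0// exprn_ge0// mulrn_wge0.
  rewrite integral_indic//= setIT lebesgue_measure_itv /= lte_fin.
  have -> : ((if (- r < r)%R then (r%:E - (- r)%R%:E)%E else 0%E) = (r *+ 2)%:E).
    case: ltP => // rr; first by rewrite -EFinB opprK mulr2n.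
    have -> : r = 0 by apply/eqP; rewrite eq_le r0 andbT; lra.
    by rewrite mul0rn.
  by rewrite -EFinM; congr EFin; rewrite exprS; ring.
by apply/measurable_EFinP; exact: measurable_indic.
Qed.

(* Uniqueness of Haar measure: both sides are computed from the double integral
   of [f (T x) * g (T x - y)], translating [x] by a preimage of [y]. *)
Lemma integral_lam_linear (R : realType) (n : nat) (T S : 'rV[R]_n -> 'rV[R]_n)
    (f g : RV R n -> \bar R) :
  (forall x y, T (x + y) = T x + T y) -> cancel S T ->
  measurable_fun setT (T : RV R n -> RV R n) ->
  measurable_fun setT f -> (forall x, 0 <= f x)%E ->
  measurable_fun setT g -> (forall x, 0 <= g x)%E ->
  (forall x : 'rV[R]_n, g (- x) = g x) ->
  (\int[lam R n]_x f (T x) * \int[lam R n]_x g x =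
   \int[lam R n]_x f x * \int[lam R n]_x g (T x))%E.
Proof.
move=> TD ST mT mf f0 mg g0 gN.
have mfT : measurable_fun setT (f \o (T : RV R n -> RV R n)).
  exact: measurableT_comp mf mT.
have mgT : measurable_fun setT (g \o (T : RV R n -> RV R n)).
  exact: measurableT_comp mg mT.
have mTB : measurable_fun setT (fun z : RV R n * RV R n =>
    T z.1 - (z.2 : 'rV[R]_n) : RV R n).
  apply: measurable_rvP => i; rewrite (_ : (fun x => _) = (fun z : RV R n * RV R n =>
    (T z.1 : 'rV[R]_n) 0 i - (z.2 : 'rV[R]_n) 0 i)); last first.
    by apply/funext => z; rewrite !mxE.
  apply: measurable_funB.
    exact: measurableT_comp (measurable_coord R n i) (measurableT_comp mT measurable_fst).
  exact: measurableT_comp (measurable_coord R n i) measurable_snd.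
have mTD : measurable_fun setT (fun z : RV R n * RV R n =>
    T z.1 + (z.2 : 'rV[R]_n) : RV R n).
  apply: measurable_rvP => i; rewrite (_ : (fun x => _) = (fun z : RV R n * RV R n =>
    (T z.1 : 'rV[R]_n) 0 i + (z.2 : 'rV[R]_n) 0 i)); last first.
    by apply/funext => z; rewrite !mxE.
  apply: measurable_funD.
    exact: measurableT_comp (measurable_coord R n i) (measurableT_comp mT measurable_fst).
  exact: measurableT_comp (measurable_coord R n i) measurable_snd.
transitivity (\int[lam R n]_x \int[lam R n]_y
    (f (T x) * g (T x - (y : 'rV[R]_n))%R))%E.
  rewrite -ge0_integralZr//; last exact: integral_ge0.
  apply: eq_integral => x _.
  rewrite -(integral_lam_shift R n (- T x))// -ge0_integralZl//.
  - by apply: eq_integral => y _; rewrite -gN opprB.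
  - exact: measurableT_comp mg (measurable_shift_rv R n _).
rewrite (fubini_tonelli (fun z : RV R n * RV R n => 
    f (T z.1) * g (T z.1 - (z.2 : 'rV[R]_n))%R))%E; last 2 first.
- apply: emeasurable_funM; last exact: measurableT_comp mg mTB.
  exact: measurableT_comp mfT measurable_fst.
- by move=> z; exact: mule_ge0.
transitivity (\int[lam R n]_y \int[lam R n]_x
    (f (T x + (y : 'rV[R]_n))%R * g (T x)))%E.
  apply: eq_integral => y _ /=.
  rewrite -(integral_lam_shift R n (S y)).
  - by apply: eq_integral => x _; rewrite TD ST addrK.
  - apply: emeasurable_funM => //.
    exact: (measurableT_comp mg (measurableT_comp mTB (pair2_measurable y))).
  - by move=> x; exact: mule_ge0.
rewrite (fubini_tonelli (fun z : RV R n * RV R n => 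
    f (T z.2 + (z.1 : 'rV[R]_n))%R * g (T z.2)))%E; last 2 first.
- apply: emeasurable_funM; last exact: measurableT_comp mgT measurable_snd.
  have := measurableT_comp mf (measurableT_comp mTD (@measurable_swap _ _ (RV R n) (RV R n))).
  exact.
- by move=> z; exact: mule_ge0.
rewrite -ge0_integralZl//; last exact: integral_ge0.
apply: eq_integral => x _ /=.
rewrite -(integral_lam_shift R n (T x) f)// -ge0_integralZr//.
- by apply: eq_integral => y _; rewrite addrC.
- exact: measurableT_comp mf (measurable_shift_rv R n _).
Qed.

(** * Similarities *)

Section euclidean_norm.
Context {R : realType} {n : nat}.
Implicit Types x y v w : 'rV[R]_n.

Lemma enorm_ge0 x : 0 <= enorm x. Proof. exact: sqrtr_ge0. Qed.

Definition dot x y : R := \sum_(i < n) x 0 i * y 0 i.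

Lemma enormE x : enorm x = Num.sqrt (dot x x).
Proof. by rewrite /enorm /dot; under eq_bigr do rewrite expr2. Qed.

Lemma dotDr x y z : dot x (y + z) = dot x y + dot x z.
Proof. by rewrite -big_split; apply: eq_bigr => i _; rewrite mxE mulrDr. Qed.

Lemma dotZr x r y : dot x (r *: y) = r * dot x y.
Proof. by rewrite mulr_sumr; apply: eq_bigr => i _; rewrite mxE mulrCA. Qed.

Lemma dotC x y : dot x y = dot y x.
Proof. by apply: eq_bigr => i _; rewrite mulrC. Qed.

Lemma dotNr x y : dot x (- y) = - dot x y.
Proof. by rewrite -scaleN1r dotZr mulN1r. Qed.

Lemma dot_ge0 x : 0 <= dot x x.
Proof. by apply: sumr_ge0 => i _; rewrite -expr2 sqr_ge0. Qed.

Lemma enormN x : enorm (- x) = enorm x.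
Proof. by rewrite !enormE dotNr dotC dotNr opprK. Qed.

Lemma enormZ r x : enorm (r *: x) = `|r| * enorm x.
Proof.
rewrite !enormE dotZr dotC dotZr mulrA -expr2 sqrtrM ?sqr_ge0//.
by rewrite sqrtr_sqr.
Qed.

Lemma coord_le_enorm x i : `|x 0 i| <= enorm x.
Proof.
rewrite -sqrtr_sqr /enorm ler_sqrt; last by apply: sumr_ge0 => j _; rewrite sqr_ge0.
by rewrite (bigD1 i)//= lerDl; apply: sumr_ge0 => j _; rewrite sqr_ge0.
Qed.

Lemma enorm_eq0 x : enorm x = 0 -> x = 0.
Proof.
move=> x0; apply/rowP => i; rewrite mxE; apply/eqP.
by rewrite -normr_eq0 eq_le normr_ge0 andbT -x0 coord_le_enorm.
Qed.

Lemma enorm_gt0 x : x != 0 -> 0 < enorm x.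
Proof.
by move=> x0; rewrite lt_def enorm_ge0 andbT; apply: contra_neq x0; exact: enorm_eq0.
Qed.

Lemma norm_le_enorm x : `|x| <= enorm x.
Proof.
rewrite (_ : `|x| = mx_norm x)// mx_normrE; apply/bigmax_leP; split; first exact: enorm_ge0.
by move=> [i j] _ /=; rewrite (ord1 i); exact: coord_le_enorm.
Qed.

Lemma enorm_le_norm x : enorm x <= n%:R * `|x|.
Proof.
have xi i : `|x 0 i| <= `|x|.
  rewrite (_ : `|x| = mx_norm x)// mx_normrE; exact: (le_bigmax _ _ (0, i)).
rewrite -(@ger0_norm _ (n%:R * _)) ?mulr_ge0// -sqrtr_sqr ler_sqrt ?sqr_ge0//.
apply: (@le_trans _ _ (\sum_(i < n) `|x| ^+ 2)).
  by apply: ler_sum => i _; rewrite -real_normK ?num_real// ler_pXn2r ?nnegrE.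
rewrite sumr_const card_ord -[leLHS]mulr_natl exprMn ler_wpM2r ?sqr_ge0//.
by rewrite -natrX ler_nat; case: n => // m; rewrite leq_pmull.
Qed.

Lemma measurable_enorm : measurable_fun setT (enorm : RV R n -> R).
Proof.
have ms : measurable_fun setT (@Num.sqrt R).
  by apply: continuous_measurable_fun; exact: sqrt_continuous.
rewrite (_ : enorm = Num.sqrt \o
  (fun x : RV R n => \sum_(i < n) (x : 'rV[R]_n) 0 i ^+ 2))//.
apply: measurableT_comp ms _.
apply: measurable_sum => i; apply: measurable_funX; exact: measurable_coord.
Qed.

(** Reflection in the hyperplane orthogonal to [v]. For [v] equal to 0 it is the identity, which is
    how plain translations and dilations are later obtained as similarities. *)
Definition householder v x : 'rV[R]_n := x - (2 * dot v x / dot v v) *: v.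

Lemma householderD v x y :
  householder v (x + y) = householder v x + householder v y.
Proof.
by rewrite /householder dotDr mulrDr mulrDl scalerDl opprD addrACA.
Qed.

Lemma householderN v x : householder v (- x) = - householder v x.
Proof. by rewrite /householder dotNr mulrN mulNr scaleNr opprB opprK addrC. Qed.

Lemma householderK v : involutive (householder v).
Proof.
move=> x; rewrite /householder; set a := 2 * dot v x / dot v v.
have [v0|v0] := eqVneq (dot v v) 0.
  by rewrite {1}/a v0 invr0 !mulr0 !scale0r !subr0.
rewrite dotDr dotNr dotZr -addrA -opprD -scalerDl.
suff -> : a + 2 * (dot v x - a * dot v v) / dot v v = 0 by rewrite scale0r subr0.
by rewrite /a; field.
Qed.

Lemma enorm_householder v x : enorm (householder v x) = enorm x.
Proof.
rewrite !enormE; congr Num.sqrt; rewrite /householder.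
set a := 2 * dot v x / dot v v.
have [v0|v0] := eqVneq (dot v v) 0.
  by rewrite /a v0 invr0 mulr0 scale0r subr0.
rewrite dotDr dotNr dotZr (dotC (_ - _) x) (dotC (_ - _) v) !dotDr !dotNr !dotZr.
by rewrite (dotC x v) /a; field.
Qed.

(** Two vectors of equal length are exchanged by the reflection in their bisecting hyperplane: equal
    lengths make [dot (v - w) (v - w)] twice [dot (v - w) v]. *)
Lemma householder_swap v w : enorm v = enorm w -> householder (v - w) v = w.
Proof.
move=> vw; have [/eqP|vw0] := eqVneq (v - w) 0.
  by rewrite subr_eq0 => /eqP ->; rewrite /householder subrr scaler0 subr0.
have e0 : 0 < enorm (v - w) by exact: enorm_gt0.
have d0 : dot (v - w) (v - w) != 0.
  by apply: contraTneq e0; rewrite enormE => ->; rewrite sqrtr0 ltxx.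
have vvww : dot v v = dot w w.
  move/(congr1 (fun t => t ^+ 2)): vw.
  by rewrite !enormE !sqr_sqrtr ?dot_ge0.
rewrite /householder.
suff -> : 2 * dot (v - w) v / dot (v - w) (v - w) = 1 by rewrite scale1r subKr.
suff <- : dot (v - w) (v - w) = 2 * dot (v - w) v by rewrite divff.
rewrite dotDr dotNr 2!(dotC (v - w)) !dotDr !dotNr -vvww (dotC w v); ring.
Qed.

Lemma measurable_householder v :
  measurable_fun setT (householder v : RV R n -> RV R n).
Proof.
apply: measurable_rvP => i; rewrite (_ : (fun x => _) = (fun x : RV R n =>
   (x : 'rV[R]_n) 0 i - (2 * dot v x / dot v v) * v 0 i)); last first.
  by apply/funext => x; rewrite !mxE.
apply: measurable_funB; first exact: measurable_coord.
do 2 (apply: measurable_funM => //).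
apply: measurable_funM => //.
apply: measurable_sum => j; apply: measurable_funM => //; exact: measurable_coord.
Qed.

End euclidean_norm.

(** * Action of reflections, dilations and similarities on Lebesgue measure *)

Definition box (R : realType) (n : nat) (r : R) : set (RV R n) :=
  [set x | forall i, (x : 'rV[R]_n) 0 i \in `[(- r), r]].

Lemma measurable_box (R : realType) (n : nat) (r : R) : measurable (box R n r).
Proof.
rewrite (_ : box R n r = \bigcap_(i in setT)
    (fun x : 'rV[R]_n => x 0 i) @^-1` `[(- r), r]%classic); last first.
  by apply/seteqP; split => x /= bx i; [move=> _; exact: bx|exact: bx].
apply: fin_bigcap_measurable => [|i _]; first exact: finite_finset.
have mI : measurable (`[(- r), r]%classic : set R) by exact: measurable_itv.
by have := measurable_coord R n i measurableT _ mI; rewrite setTI.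
Qed.

Lemma lam_box (R : realType) (n : nat) (r : R) : 0 <= r ->
  lam R n (box R n r) = ((r *+ 2) ^+ n)%:E.
Proof.
move=> r0; have mb := measurable_box R n r.
transitivity (\int[lam R n]_x (\1_(box R n r) x)%:E)%E.
  by rewrite integral_indic ?setIT.
rewrite integral_lam//; last by apply/measurable_EFinP; exact: measurable_indic.
rewrite -[X in _ = X%:E]mul1r.
rewrite -(iint_box R n r 1 r0 ler01); congr iint; apply/funext => x.
rewrite mul1r indicE; congr EFin.
have [xb|/negP xb] := boolP (x \in box R n r).
  rewrite big1// => i _; rewrite indicE mem_set//=.
  by move: xb; rewrite inE => /(_ i).
have [i xi] : exists i, ~ (x 0 i \in `[(- r), r]).
  by apply/existsNP => xi; apply: xb; rewrite inE => i; exact: xi.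
rewrite [RHS](bigD1 i)//= [X in _ = X * _]indicE memNset ?mul0r//=.
Qed.

Lemma mule_cancelr (R : realType) (a b c : \bar R) :
  (0 < c)%E -> c \is a fin_num -> (a * c = b * c)%E -> a = b.
Proof.
move=> c0 cf; rewrite -(fineK cf); have r0 : (0 < fine c)%R by rewrite fine_gt0// c0 ltey_eq cf.
move: (fine c) r0 => r r0 /(congr1 (fun t => t * (r^-1)%:E)%E).
rewrite -!muleA -!EFinM divff ?lt0r_neq0// !mule1.
by [].
Qed.

(** In [integral_lam_linear] take for [g] the indicator of the Euclidean unit ball, which the
    reflection preserves: both sides then carry the measure of the ball as a factor. It cancels
    because a cube around the ball makes it finite and a cube inside makes it positive. *)
Lemma integral_lam_householder (R : realType) (n : nat) (v : 'rV[R]_n)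
    (f : RV R n -> \bar R) :
  measurable_fun setT f -> (forall x, 0 <= f x)%E ->
  (\int[lam R n]_x f (householder v x) = \int[lam R n]_x f x)%E.
Proof.
move=> mf f0.
pose B : set (RV R n) := [set x | enorm (x : 'rV[R]_n) <= 1].
have mB : measurable B.
  have mI : measurable (`]-oo, 1]%classic : set R) by exact: measurable_itv.
  have := measurable_enorm (R := R) (n := n) measurableT _ mI.
  rewrite setTI; congr measurable; apply/seteqP; split => x /=;
    by rewrite in_itv.
pose g (x : RV R n) : \bar R := (\1_B x)%:E.
have mg : measurable_fun setT g by apply/measurable_EFinP; exact: measurable_indic.
have g0 x : (0 <= g x)%E by rewrite lee_fin.
have gH x : g (householder v x) = g x.
  rewrite /g !indicE; congr ((_ : bool)%:R)%:E.
  by apply/idP/idP; rewrite !inE /B /= enorm_householder.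
have gN (x : 'rV[R]_n) : g (- x) = g x.
  by rewrite /g !indicE; congr ((_ : bool)%:R)%:E; apply/idP/idP; rewrite !inE /B /= enormN.
have := integral_lam_linear R n _ _ f g (householderD v) (householderK v)
  (measurable_householder v) mf f0 mg g0 gN.
under [X in _ = (_ * X)%E]eq_integral do rewrite gH.
have -> : (\int[lam R n]_x g x)%E = lam R n B by rewrite integral_indic ?setIT.
have Bfin : lam R n B \is a fin_num.
  rewrite ge0_fin_numE//; apply: (@le_lt_trans _ _ (lam R n (box R n 1))).
    apply: le_measure; rewrite ?inE//; first exact: measurable_box.
    move=> x xB i; rewrite in_itv /= -ler_norml.
    exact: le_trans (coord_le_enorm _ _) xB.
  by rewrite lam_box// ltry.
have B0 : (0 < lam R n B)%E.
  (* By [enorm_le_norm] this cube lies in the ball, as n / (n + 1) <= 1; the successor keeps the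
     side positive in dimension 0. *)
  apply: (@lt_le_trans _ _ (lam R n (box R n (n.+1%:R^-1)))).
    by rewrite lam_box ?invr_ge0// lte_fin exprn_gt0// pmulrn_rgt0 ?invr_gt0.
  apply: le_measure; rewrite ?inE//; first exact: measurable_box.
  move=> x xB; rewrite /B /=; apply: le_trans (enorm_le_norm _) _.
  apply: (@le_trans _ _ (n%:R * n.+1%:R^-1)).
    apply: ler_wpM2l => //; rewrite (_ : `|_| = mx_norm x)// mx_normrE.
    apply/bigmax_leP; split; first by rewrite invr_ge0.
    by move=> [i j] _ /=; rewrite (ord1 i) ler_norml; have := xB j; rewrite in_itv.
  by rewrite ler_pdivrMr// mul1r ler_nat.
exact: mule_cancelr.
Qed.

Lemma measurable_scale_rv (R : realType) (n : nat) (r : R) :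
  measurable_fun setT (fun x : RV R n => r *: (x : 'rV[R]_n) : RV R n).
Proof.
apply: measurable_rvP => i; rewrite (_ : (fun x => _) =
  (fun x : RV R n => r * (x : 'rV[R]_n) 0 i)).
  by apply: measurable_funM => //; exact: measurable_coord.
by apply/funext => x; rewrite mxE.
Qed.

(** Here the auxiliary [g] is the indicator of the cube of half-side 1, whose preimage under the
    dilation is the cube of half-side 1 / r; both volumes are explicit. *)
Lemma integral_lam_scale (R : realType) (n : nat) (r : R)
    (f : RV R n -> \bar R) : 0 < r ->
  measurable_fun setT f -> (forall x, 0 <= f x)%E ->
  (\int[lam R n]_x f (r *: (x : 'rV[R]_n))%R = (r ^- n)%:E * \int[lam R n]_x f x)%E.
Proof.
move=> r0 mf f0.
pose g (x : RV R n) : \bar R := (\1_(box R n 1) x)%:E.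
have mg : measurable_fun setT g.
  by apply/measurable_EFinP; apply: measurable_indic; exact: measurable_box.
have g0 x : (0 <= g x)%E by rewrite lee_fin.
have gN (x : 'rV[R]_n) : g (- x) = g x.
  rewrite /g !indicE; congr ((_ : bool)%:R)%:E; apply/idP/idP; rewrite !inE => bx i;
  by have := bx i; rewrite ?mxE !in_itv /= => /andP[? ?]; apply/andP; split; lra.
have rD (x y : 'rV[R]_n) : r *: (x + y) = r *: x + r *: y by rewrite scalerDr.
have rK : cancel (fun x : 'rV[R]_n => r^-1 *: x) (fun x => r *: x).
  by move=> x; rewrite scalerA divff ?lt0r_neq0// scale1r.
have := integral_lam_linear R n _ _ f g rD rK
  (measurable_scale_rv R n r) mf f0 mg g0 gN.
have -> : (\int[lam R n]_x g x)%E = (2 ^+ n)%:E.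
  rewrite integral_indic//; last exact: measurable_box.
  by rewrite setIT; exact: lam_box.
have -> : (\int[lam R n]_x g (r *: (x : 'rV[R]_n))%R)%E = (2 ^+ n * r ^- n)%:E.
  transitivity (\int[lam R n]_x (\1_(box R n r^-1) x)%:E)%E; last first.
    rewrite integral_indic//; last exact: measurable_box.
    rewrite setIT [LHS]lam_box ?invr_ge0 ?ltW//.
    by rewrite -exprVn -exprMn; congr ((_ ^+ _)%:E); rewrite mulr_natl.
  apply: eq_integral => x _; rewrite /g !indicE; congr ((_ : bool)%:R)%:E.
  apply/idP/idP; rewrite !inE => bx i; have := bx i; rewrite ?mxE !in_itv /=;
    by rewrite -!ler_norml normrM (gtr0_norm r0) -[r^-1]mul1r ler_pdivlMr// mulrC.
move=> E; apply: (mule_cancelr R _ _ (2 ^+ n)%:E) => //.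
by rewrite [LHS]E EFinM muleCA muleC (muleC (\int[_]_x _)%E).
Qed.

Lemma integral_lam_similarity (R : realType) (n : nat) (r : R) (v a b : 'rV[R]_n)
    (f : RV R n -> \bar R) : 0 < r ->
  measurable_fun setT f -> (forall x, 0 <= f x)%E ->
  (\int[lam R n]_x f (r *: householder v ((x : 'rV[R]_n) - a) + b)%R =
   (r ^- n)%:E * \int[lam R n]_x f x)%E.
Proof.
move=> r0 mf f0.
have mf3 := measurableT_comp mf (measurable_shift_rv R n b).
have mf2 := measurableT_comp mf3 (measurable_scale_rv R n r).
have mf1 := measurableT_comp mf2 (measurable_householder v).
rewrite (integral_lam_shift R n (- a) _ mf1)//=.
rewrite (integral_lam_householder R n v _ mf2)//=.
by rewrite (integral_lam_scale R n r _ r0 mf3)//= integral_lam_shift.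
Qed.

(** * The Gagliardo energy as an integral for the product measure *)

Notation lam2 R n := (lam R n \x lam R n)%E.

Lemma iint2_nonneg_iter (R : realType) (n : nat) (F : 'rV[R]_n -> 'rV[R]_n -> R) :
  measurable_fun setT (fun z : RV R n * RV R n => F z.1 z.2) ->
  (forall x y, 0 <= F x y) ->
  iint2_nonneg F = (\int[lam R n]_x \int[lam R n]_y (F x y)%:E)%E.
Proof.
move=> mF F0.
have mF' : measurable_fun setT (fun z : RV R n * RV R n => (F z.1 z.2)%:E).
  exact/measurable_EFinP.
rewrite integral_lam.
- rewrite /iint2_nonneg; congr iint; apply/funext => x.
  apply/esym/integral_lam => [|y]; last by rewrite lee_fin.
  exact: (measurableT_comp mF' (pair1_measurable (x : RV R n))).
- apply: (measurable_fun_fubini_tonelli_F (m2 := lam R n) _ mF') => z.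
  by rewrite lee_fin.
- by move=> x; apply: integral_ge0 => y _; rewrite lee_fin.
Qed.

Lemma iint2_nonnegE (R : realType) (n : nat) (F : 'rV[R]_n -> 'rV[R]_n -> R) :
  measurable_fun setT (fun z : RV R n * RV R n => F z.1 z.2) ->
  (forall x y, 0 <= F x y) ->
  iint2_nonneg F = (\int[lam2 R n]_z (F z.1 z.2)%:E)%E.
Proof.
move=> mF F0; rewrite iint2_nonneg_iter// fubini_tonelli1//.
  exact/measurable_EFinP.
by move=> z; rewrite lee_fin.
Qed.

Lemma measurable_subr_rv (R : realType) (n : nat) :
  measurable_fun setT (fun z : RV R n * RV R n =>
    (z.1 : 'rV[R]_n) - (z.2 : 'rV[R]_n) : RV R n).
Proof.
apply: measurable_rvP => i; rewrite (_ : (fun x => _) = (fun z : RV R n * RV R n =>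
    (z.1 : 'rV[R]_n) 0 i - (z.2 : 'rV[R]_n) 0 i)); last first.
  by apply/funext => z; rewrite !mxE.
apply: measurable_funB.
  exact: measurableT_comp (measurable_coord R n i) measurable_fst.
exact: measurableT_comp (measurable_coord R n i) measurable_snd.
Qed.

Lemma measurable_kernel (R : realType) (n : nat) (q : R) :
  measurable_fun setT (fun z : RV R n * RV R n =>
    ((enorm ((z.1 : 'rV[R]_n) - (z.2 : 'rV[R]_n)) `^ q)^-1)).
Proof.
rewrite (_ : (fun z => _) = (fun t => powR t (- q)) \o
   (enorm : RV R n -> R) \o (fun z : RV R n * RV R n =>
    (z.1 : 'rV[R]_n) - (z.2 : 'rV[R]_n) : RV R n)); last first.
  by apply/funext => z /=; rewrite powRN.
apply: measurableT_comp; last exact: measurable_subr_rv.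
by apply: measurableT_comp; [exact: measurable_powR|exact: measurable_enorm].
Qed.

Lemma measurable_diff (R : realType) (n : nat) (phi : RV R n -> R) :
  measurable_fun setT phi ->
  measurable_fun setT (fun z : RV R n * RV R n => phi z.1 - phi z.2).
Proof.
by move=> mphi; apply: measurable_funB; apply: measurableT_comp => //.
Qed.

Lemma measurable_gagliardo (R : realType) (n : nat) (p q : R) (phi : RV R n -> R) :
  measurable_fun setT phi ->
  measurable_fun setT (fun z : RV R n * RV R n =>
    `|phi z.1 - phi z.2| `^ p / enorm ((z.1 : 'rV[R]_n) - (z.2 : 'rV[R]_n)) `^ q).
Proof.
move=> mphi; apply: measurable_funM; last exact: measurable_kernel.
have := measurable_diff R n _ mphi => md.
have := measurableT_comp (@measurable_powR R p) (measurableT_comp (@normr_measurable R setT) md).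
exact.
Qed.

(** The kernel contributes r^(n + s p), and the changes of variables in x and in y contribute r^(-
    n) each; hence the exponent s p - n. *)
Lemma gagliardo_similarity (R : realType) (n : nat) (s p r : R) (v a b : 'rV[R]_n)
    (phi : RV R n -> R) : 0 < r -> measurable_fun setT phi ->
  gagliardo_p s p (fun x : 'rV[R]_n => phi (r *: householder v (x - a) + b)) =
  ((r `^ (s * p - n%:R))%:E * gagliardo_p s p (phi : 'rV[R]_n -> R))%E.
Proof.
move=> r0 mphi.
set T := fun x : 'rV[R]_n => r *: householder v (x - a) + b.
pose K (x y : 'rV[R]_n) := `|phi x - phi y| `^ p / enorm (x - y) `^ (n%:R + s * p).
have K0 x y : 0 <= K x y by rewrite divr_ge0 ?powR_ge0.
have mK : measurable_fun setT (fun z : RV R n * RV R n => (K z.1 z.2)%:E).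
  by apply/measurable_EFinP; exact: measurable_gagliardo.
have mT : measurable_fun setT (T : RV R n -> RV R n).
  have := measurableT_comp (measurable_shift_rv R n b) (measurableT_comp 
    (measurable_scale_rv R n r) (measurableT_comp (measurable_householder v)
    (measurable_shift_rv R n (- a)))).
  exact.
have rK x y : enorm (T x - T y) = r * enorm (x - y).
  rewrite /T opprD addrACA subrr addr0 -scalerBr -householderN -householderD.
  by rewrite enormZ enorm_householder gtr0_norm// opprB addrA subrK.
have simT (f : RV R n -> \bar R) : measurable_fun setT f -> (forall x, 0 <= f x)%E ->
    (\int[lam R n]_x f (T x) = (r ^- n)%:E * \int[lam R n]_x f x)%E.
  by move=> mf f0; exact: integral_lam_similarity.
rewrite (_ : (fun x => phi _) = phi \o T)//; clearbody T.
rewrite [LHS]iint2_nonneg_iter; last 2 first.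
- exact: (measurable_gagliardo R n p _ _ (measurableT_comp mphi mT)).
- by move=> x y; rewrite divr_ge0 ?powR_ge0.
rewrite [X in (_ * X)%E]iint2_nonneg_iter; [|exact: (measurable_gagliardo R n p _ _ mphi)|exact: K0].
set c := r `^ (n%:R + s * p).
pose g (x : RV R n) := (\int[lam R n]_y (K x y)%:E)%E.
rewrite -[X in (_ * X)%E]/(\int[lam R n]_x g x)%E.
transitivity (\int[lam R n]_x ((c * r ^- n)%:E * g (T x)))%E.
  apply: eq_integral => x _.
  have mKx : measurable_fun setT (fun y : RV R n => (K (T x) y)%:E).
    exact: (measurableT_comp mK (pair1_measurable (T x : RV R n))).
  rewrite EFinM -muleA -(simT (fun y => (K (T x) y)%:E)) => [|//|y]; last by rewrite lee_fin.
  rewrite -ge0_integralZl.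
  - apply: eq_integral => y _; rewrite -EFinM; congr EFin.
    rewrite /K rK powRM ?enorm_ge0 ?ltW// -/c invfM mulrCA; congr (_ * _).
    by rewrite mulrA divff ?mul1r// gt_eqF// powR_gt0.
  - exact: measurableT.
  - exact: (measurableT_comp mKx mT).
  - by move=> y _; rewrite lee_fin.
  - by rewrite lee_fin powR_ge0.
have mg : measurable_fun setT g.
  apply: (measurable_fun_fubini_tonelli_F (m2 := lam R n) _ mK) => z.
  by rewrite lee_fin.
have g0 x : (0 <= g x)%E by apply: integral_ge0 => y _; rewrite lee_fin.
clearbody g.
rewrite ge0_integralZl//; last 2 first.
- exact: (measurableT_comp mg mT).
- by rewrite lee_fin mulr_ge0 ?powR_ge0// invr_ge0 exprn_ge0// ltW.
rewrite (simT g)//.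
rewrite muleA -EFinM; congr ((_%:E) * _)%E.
rewrite -mulrA -invfM -exprD -powR_mulrn ?ltW// /c -powRN -powRD; last first.
  by rewrite (gt_eqF r0) implybT.
congr (_ `^ _); rewrite natrD; ring.
Qed.

(** * Convexity of the energy *)

Section power_convexity.
Context {R : realType} (p : R) (p1 : 1 < p).
Implicit Types a b r : R.

Let p0 : 0 < p. Proof. exact: lt_trans p1. Qed.
Let pN0 : p != 0. Proof. exact: lt0r_neq0. Qed.

(* From the tangent of [expR] at [t = ln r], evaluated at [p * t] and at [0]. *)
Lemma powR_bernoulli r : r != 1 -> 1 + p * (r - 1) < `|r| `^ p.
Proof.
move=> r1; have [r0|r0] := leP r 0.
  apply: (@lt_le_trans _ _ 0); last exact: powR_ge0.
  have : p * r <= 0 by rewrite pmulr_rle0.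
  by move=> pr; have := p1; lra.
rewrite gtr0_norm// /powR gt_eqF//.
set t := ln r; have rE : r = expR t by rewrite lnK ?posrE.
have t0 : t != 0.
  by apply: contra_neq r1 => t0; rewrite rE t0 expR0.
have e0 : 0 < expR t := expR_gt0 t.
have h1 : expR t * (1 + (p - 1) * t) < expR (p * t).
  rewrite (_ : p * t = t + (p - 1) * t); last by ring.
  rewrite expRD ltr_pM2l// expR_gt1Dx// mulf_neq0// subr_eq0 gt_eqF//.
have h2 : expR t * (1 - t) <= 1.
  rewrite -[leRHS](expRxMexpNx_1 t) ler_pM2l//; exact: expR_ge1Dx.
have h3 : (p - 1) * (expR t * (1 - t)) <= p - 1.
  by rewrite -[leRHS]mulr1 ler_wpM2l// subr_ge0 ltW.
rewrite rE; move: (expR t) (expR (p * t)) h1 h3 => x y; nra.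
Qed.

Lemma Jp_mulr a : Jp p a * a = `|a| `^ p.
Proof.
have [->|a0] := eqVneq a 0; first by rewrite mulr0 normr0 powR0.
rewrite /Jp -mulrA -expr2 -real_normK ?num_real// -powR_mulrn//.
rewrite -powRD ?subrK//.
by rewrite normr_eq0 a0 implybT.
Qed.

Lemma normr_Jp a : `|Jp p a| = `|a| `^ (p - 1).
Proof.
have [->|a0] := eqVneq a 0.
  by rewrite /Jp mulr0 normr0 powR0// subr_eq0 gt_eqF.
rewrite /Jp normrM ger0_norm ?powR_ge0// -{2}[`|a|]powRr1//.
rewrite -powRD; last by rewrite normr_eq0 a0 implybT.
by congr (_ `^ _); ring.
Qed.

(** By homogeneity the case of nonzero [a] is the Bernoulli inequality at r = b / a. The strictness
    is what makes minimizers unique. *)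
Lemma powR_tangent_lt a b : a != b ->
  `|a| `^ p + p * (Jp p a * (b - a)) < `|b| `^ p.
Proof.
have [->|a0] := eqVneq a 0.
  move=> b0; rewrite normr0 powR0// add0r /Jp mulr0 mul0r mulr0 powR_gt0//.
  by rewrite normr_gt0 eq_sym.
move=> ab; pose r := b / a.
have bE : b = r * a by rewrite /r divfK.
have r1 : r != 1 by apply: contra_neq ab => r1; rewrite bE r1 mul1r.
have -> : Jp p a * (b - a) = `|a| `^ p * (r - 1) by rewrite -Jp_mulr bE; ring.
rewrite {1}bE normrM powRM//.
have := powR_bernoulli _ r1.
have : 0 < `|a| `^ p by rewrite powR_gt0// normr_gt0.
by move: (`|a| `^ p) (`|r| `^ p) => x y; nra.
Qed.

Lemma powR_tangent a b : `|a| `^ p + p * (Jp p a * (b - a)) <= `|b| `^ p.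
Proof.
have [->|/powR_tangent_lt/ltW//] := eqVneq a b.
by rewrite subrr !mulr0 addr0.
Qed.

Lemma powR_normD a b : `|a + b| `^ p <= 2 `^ p * (`|a| `^ p + `|b| `^ p).
Proof.
wlog ab : a b / `|a| <= `|b|.
  move=> W; have [|/ltW] := leP `|a| `|b|; first exact: W.
  by rewrite addrC [X in _ <= _ * X]addrC; exact: W.
apply: (@le_trans _ _ ((2 * `|b|) `^ p)).
  apply: ge0_ler_powR (ltW p0) _ _ _ _ _; rewrite ?nnegrE ?mulr_ge0//.
  by rewrite (le_trans (ler_normD _ _))//; lra.
by rewrite powRM// ler_wpM2l ?powR_ge0// lerDr powR_ge0.
Qed.

Lemma Jp_young a b : `|Jp p a * b| <= `|a| `^ p + `|b| `^ p.
Proof.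
have p10 : 0 <= p - 1 by rewrite subr_ge0 ltW.
rewrite normrM normr_Jp; have [ab|/ltW ab] := leP `|a| `|b|.
  apply: (@le_trans _ _ (`|b| `^ (p - 1) * `|b|)).
    by rewrite ler_wpM2r// ge0_ler_powR.
  by rewrite mulrC mulr_powRB1// lerDr powR_ge0.
apply: (@le_trans _ _ (`|a| `^ (p - 1) * `|a|)).
  by rewrite ler_wpM2l// powR_ge0.
by rewrite mulrC mulr_powRB1// lerDl powR_ge0.
Qed.

(** At 0 the exponent p - 2 may be negative, so continuity there is read off from |J_p(t)| = |t|^(p
    - 1). *)
Lemma Jp_continuous : continuous (Jp p).
Proof.
move=> x; have [->|x0] := eqVneq x 0.
  apply/cvgrPdist_lt => e e0; rewrite /Jp mulr0.
  have d0 : 0 < e `^ (p - 1)^-1 by exact: powR_gt0.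
  apply/nbhs_ballP; exists (e `^ (p - 1)^-1) => //= t.
  rewrite /ball /= !sub0r !normrN -/(Jp p t) normr_Jp => td.
  rewrite [ltRHS](_ : e = (e `^ (p - 1)^-1) `^ (p - 1)); last first.
    by rewrite -powRrM mulVf ?powRr1 ?ltW// subr_eq0 gt_eqF.
  by rewrite gt0_ltr_powR ?subr_gt0 ?nnegrE ?powR_ge0.
have nx0 : 0 < `|x| by rewrite normr_gt0.
apply: (@cvgM _ R (nbhs x) _ (fun t : R => `|t| `^ (p - 2)) id); last exact: cvg_id.
have : {for x, continuous ((fun t : R => t `^ (p - 2)) \o (fun t : R => `|t|))}.
  apply: continuous_comp; first exact: norm_continuous.
  apply: differentiable_continuous; apply/derivable1_diffP; apply: derivable_powR.
  by rewrite in_itv /= nx0.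
exact.
Qed.

End power_convexity.

(** * Weighted p-energies on a measure space and their first variation *)

Section energy.
Context {d} {T : measurableType d} {R : realType}.
Variables (mu : {measure set T -> \bar R}) (w : T -> R) (p : R).
Hypotheses (mw : measurable_fun setT w) (w0 : forall z, 0 <= w z) (p1 : 1 < p).
Implicit Types a b : T -> R.

Definition energy a : \bar R := (\int[mu]_z (`|a z| `^ p * w z)%:E)%E.

Let p0 : 0 < p. Proof. exact: lt_trans p1. Qed.

Lemma measurable_powR_norm a : measurable_fun setT a ->
  measurable_fun setT (fun z => `|a z| `^ p).
Proof.
move=> ma; have := measurableT_comp (@measurable_powR R p)
  (measurableT_comp (@normr_measurable R setT) ma).
exact.
Qed.

Lemma measurable_Jp_comp a : measurable_fun setT a ->
  measurable_fun setT (fun z => Jp p (a z)).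
Proof.
move=> ma; have := measurableT_comp (continuous_measurable_fun (Jp_continuous p p1)) ma.
exact.
Qed.

Lemma energy_ge0 a : (0 <= energy a)%E.
Proof. by apply: integral_ge0 => z _; rewrite lee_fin mulr_ge0 ?powR_ge0. Qed.

Lemma energy_fin_num a : (energy a < +oo)%E -> energy a \is a fin_num.
Proof. by move=> Ea; rewrite ge0_fin_numE//; exact: energy_ge0. Qed.

Lemma energy_integrable a : measurable_fun setT a -> (energy a < +oo)%E ->
  mu.-integrable setT (fun z => (`|a z| `^ p * w z)%:E).
Proof.
move=> ma Ea; apply/integrableP; split.
  by apply/measurable_EFinP; apply: measurable_funM => //; exact: measurable_powR_norm.
under eq_integral do rewrite gee0_abs ?lee_fin ?mulr_ge0 ?powR_ge0//.
exact: Ea.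
Qed.

Lemma integrable_le_energy (F : T -> R) a b (c : R) :
  measurable_fun setT F ->
  measurable_fun setT a -> (energy a < +oo)%E ->
  measurable_fun setT b -> (energy b < +oo)%E ->
  (forall z, `|F z| <= c * (`|a z| `^ p + `|b z| `^ p) * w z) ->
  mu.-integrable setT (fun z => (F z)%:E).
Proof.
move=> mF ma Ea mb Eb Fab.
have iab := integrableZl measurableT c (integrableD measurableT
  (energy_integrable _ ma Ea) (energy_integrable _ mb Eb)).
apply: (le_integrable measurableT _ _ iab); first exact/measurable_EFinP.
move=> z _; rewrite lee_fin /= (le_trans (Fab z))// -mulrDl mulrA.
exact: ler_norm.
Qed.

Lemma energyD a b : measurable_fun setT a -> (energy a < +oo)%E ->
  measurable_fun setT b -> (energy b < +oo)%E ->
  (energy (fun z => a z + b z)%R < +oo)%E.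
Proof.
move=> ma Ea mb Eb.
have mab : measurable_fun setT (fun z => `|a z + b z| `^ p * w z).
  apply: measurable_funM => //; apply: measurable_powR_norm.
  exact: measurable_funD.
have : mu.-integrable setT (fun z => (`|a z + b z| `^ p * w z)%:E).
  apply: (integrable_le_energy _ _ _ (2 `^ p) mab ma Ea mb Eb) => z.
  rewrite ger0_norm ?mulr_ge0 ?powR_ge0// ler_wpM2r//.
  exact: powR_normD.
move=> /integrableP[_]; apply: le_lt_trans.
by rewrite le_eqVlt; apply/orP; left; apply/eqP; apply: eq_integral => z _;
  rewrite gee0_abs// lee_fin mulr_ge0 ?powR_ge0.
Qed.

Lemma energyZ (c : R) a : measurable_fun setT a ->
  energy (fun z => c * a z) = ((`|c| `^ p)%:E * energy a)%E.
Proof.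
move=> ma; rewrite /energy -ge0_integralZl//.
- by apply: eq_integral => z _; rewrite normrM powRM// -EFinM mulrA.
- by apply/measurable_EFinP; apply: measurable_funM => //; exact: measurable_powR_norm.
- by move=> z _; rewrite lee_fin mulr_ge0 ?powR_ge0.
Qed.

Lemma energyN a : energy (fun z => - a z) = energy a.
Proof. by apply: eq_integral => z _; rewrite normrN. Qed.

Lemma measurable_pairing a b : measurable_fun setT a -> measurable_fun setT b ->
  measurable_fun setT (fun z => Jp p (a z) * b z * w z).
Proof.
move=> ma mb; apply: measurable_funM => //; apply: measurable_funM => //.
exact: measurable_Jp_comp.
Qed.

Lemma pairing_integrable a b : measurable_fun setT a -> (energy a < +oo)%E ->
  measurable_fun setT b -> (energy b < +oo)%E ->
  mu.-integrable setT (fun z => (Jp p (a z) * b z * w z)%:E).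
Proof.
move=> ma Ea mb Eb.
apply: (integrable_le_energy _ _ _ 1 _ ma Ea mb Eb); first exact: measurable_pairing.
move=> z; rewrite mul1r normrM (ger0_norm (w0 z)) ler_wpM2r//.
exact: Jp_young.
Qed.

Definition pairing a b : \bar R := (\int[mu]_z (Jp p (a z) * b z * w z)%:E)%E.

Lemma pairing_diag a : pairing a a = energy a.
Proof. by apply: eq_integral => z _; rewrite Jp_mulr. Qed.

(** The weighted Bregman divergence of |t|^p: the gap between the function at [b z] and its tangent
    at [a z]. *)
Definition convexity_defect a b z : R :=
  (`|b z| `^ p - `|a z| `^ p - p * (Jp p (a z) * (b z - a z))) * w z.

Lemma convexity_defect_ge0 a b z : 0 <= convexity_defect a b z.
Proof. by rewrite mulr_ge0//; have := powR_tangent p p1 (a z) (b z); lra. Qed.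

Lemma measurable_convexity_defect a b : measurable_fun setT a ->
  measurable_fun setT b -> measurable_fun setT (convexity_defect a b).
Proof.
move=> ma mb; apply: measurable_funM => //; apply: measurable_funB.
  by apply: measurable_funB; exact: measurable_powR_norm.
apply: measurable_funM => //; apply: measurable_funM; first exact: measurable_Jp_comp.
exact: measurable_funB.
Qed.

(** An identity rather than the convexity inequality, so that the case of equality can be analysed
    through the integral of the defect. *)
Lemma energy_defect a b : measurable_fun setT a -> (energy a < +oo)%E ->
  measurable_fun setT b -> (energy b < +oo)%E ->
  energy b = (energy a + p%:E * pairing a (fun z => b z - a z)%R +
    \int[mu]_z (convexity_defect a b z)%:E)%E.
Proof.
move=> ma Ea mb Eb.
have mba : measurable_fun setT (fun z => b z - a z) by exact: measurable_funB.
have Eba : (energy (fun z => b z - a z)%R < +oo)%E.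
  have mNa : measurable_fun setT (fun z => - a z) by exact: measurableT_comp.
  have ENa : (energy (fun z => - a z)%R < +oo)%E by rewrite energyN; exact: Ea.
  exact: (energyD _ _ mb Eb mNa ENa).
have iP := pairing_integrable _ _ ma Ea mba Eba.
have ia := energy_integrable _ ma Ea.
have ib := energy_integrable _ mb Eb.
have ipP := integrableZl measurableT p iP.
have iaP := integrableD measurableT ia ipP.
have iD : mu.-integrable setT (fun z => (convexity_defect a b z)%:E).
  have := integrableB measurableT ib iaP; congr (mu.-integrable _ _).
  by apply/funext => z /=; rewrite -EFinB; congr EFin; rewrite /convexity_defect; ring.
rewrite /pairing -(integralZl measurableT iP) -(integralD measurableT ia ipP).
rewrite -(integralD measurableT iaP iD); apply: eq_integral => z _.
by rewrite /= -!EFinD; congr EFin; rewrite /convexity_defect; ring.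
Qed.

Lemma energy_tangent a b : measurable_fun setT a -> (energy a < +oo)%E ->
  measurable_fun setT b -> (energy b < +oo)%E ->
  (energy a + p%:E * pairing a (fun z => b z - a z)%R <= energy b)%E.
Proof.
move=> ma Ea mb Eb; rewrite (energy_defect a b ma Ea mb Eb); apply: leeDl.
by apply: integral_ge0 => z _; rewrite lee_fin convexity_defect_ge0.
Qed.

(* Convexity at [a + t * b] turns minimality of [a] into nonnegativity of the
   pairing of [a + t * b] with [b]; then [t] tends to [0]. *)
Lemma pairing_ge0 a b : measurable_fun setT a -> (energy a < +oo)%E ->
  measurable_fun setT b -> (energy b < +oo)%E ->
  (forall t : R, 0 < t -> (energy a <= energy (fun z => a z + t * b z)%R)%E) ->
  (0 <= pairing a b)%E.
Proof.
move=> ma Ea mb Eb amin.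
pose t (n : nat) : R := n.+1%:R^-1.
have t0 n : 0 < t n by rewrite invr_gt0.
pose a_ n z := a z + t n * b z.
have mtb n : measurable_fun setT (fun z => t n * b z) by exact: measurable_funM.
have ma_ n : measurable_fun setT (a_ n) by exact: measurable_funD.
have Ea_ n : (energy (a_ n) < +oo)%E.
  have Etb : (energy (fun z => t n * b z)%R < +oo)%E.
    rewrite (energyZ _ _ mb); apply: lte_mul_pinfty => //; exact: Eb.
  exact: (energyD _ _ ma Ea (mtb n) Etb).
have P0 n : (0 <= pairing (a_ n) b)%E.
  have := energy_tangent _ _ (ma_ n) (Ea_ n) ma Ea.
  have -> : pairing (a_ n) (fun z => a z - a_ n z) = ((- t n)%:E * pairing (a_ n) b)%E.
    rewrite /pairing -(integralZl measurableT (pairing_integrable _ _ (ma_ n) (Ea_ n) mb Eb)).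
    by apply: eq_integral => z _; rewrite -EFinM; congr EFin; rewrite /a_; ring.
  have := amin _ (t0 n); rewrite -/(a_ n).
  have Pf : pairing (a_ n) b \is a fin_num.
    exact: (integrable_fin_num measurableT (pairing_integrable _ _ (ma_ n) (Ea_ n) mb Eb)).
  have Ef : energy (a_ n) \is a fin_num := energy_fin_num _ (Ea_ n).
  have Ef' : energy a \is a fin_num := energy_fin_num _ Ea.
  rewrite -(fineK Pf) -(fineK Ef) -(fineK Ef') -!EFinM -EFinD !lee_fin.
  have key (x y z u : R) : 0 < u -> z <= y -> y + p * (- u * x) <= z -> 0 <= x.
    move=> u0 h1 h2; have : 0 <= p * u * x by nra.
    by rewrite pmulr_rge0// mulr_gt0.
  exact: key (t0 n).
(* A majorant of |J_p(a + t b) b| w for t <= 1: [Jp_young] gives |a + t b|^p + |b|^p, [powR_normD]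
   bounds the first term by 2^p (|a|^p + |b|^p), and the remaining |b|^p is absorbed because 2^p >=
   1. *)
pose g z : \bar R := (2 * 2 `^ p * (`|a z| `^ p + `|b z| `^ p) * w z)%:E.
have ig : mu.-integrable setT g.
  have mg : measurable_fun setT (fun z => 2 * 2 `^ p * (`|a z| `^ p + `|b z| `^ p) * w z).
    apply: measurable_funM => //; apply: measurable_funM => //.
    by apply: measurable_funD; exact: measurable_powR_norm.
  apply: (integrable_le_energy _ _ _ (2 * 2 `^ p) mg ma Ea mb Eb) => z.
  by rewrite ger0_norm// !mulr_ge0// ?addr_ge0 ?powR_ge0.
pose f_ n z : \bar R := (Jp p (a_ n z) * b z * w z)%:E.
pose f z : \bar R := (Jp p (a z) * b z * w z)%:E.
have mf_ n : measurable_fun setT (f_ n).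
  by apply/measurable_EFinP; exact: measurable_pairing.
have mf : measurable_fun setT f.
  by apply/measurable_EFinP; exact: measurable_pairing.
have f_f : {ae mu, forall z, setT z -> f_ ^~ z @ \oo --> f z}.
  apply/aeW => z _; apply: cvg_EFin; first exact: nearW.
  apply: cvgMl; apply: cvgMl.
  apply: continuous_cvg; first exact: Jp_continuous.
  have : a z + t n * b z @[n --> \oo] --> a z + 0 * b z.
    by apply: cvgD; [exact: cvg_cst|apply: cvgMl; exact: cvg_harmonic].
  by rewrite mul0r addr0.
have f_g : {ae mu, forall z n, setT z -> (`|f_ n z| <= g z)%E}.
  apply/aeW => z n _; rewrite lee_fin normrM (ger0_norm (w0 z)) ler_wpM2r//.
  apply: le_trans (Jp_young _ p1 _ _) _.
  have h1 := powR_normD p p1 (a z) (t n * b z).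
  have h2 : `|t n * b z| `^ p <= `|b z| `^ p.
    rewrite ge0_ler_powR ?nnegrE ?(ltW p0)// normrM ger0_norm ?(ltW (t0 n))//.
    by rewrite ler_piMl// /t invf_le1// ler1n.
  have h3 : 1 <= 2 `^ p.
    rewrite -[leLHS](powRr0 (2 : R)); apply: ler_powR; last exact: ltW.
    by rewrite ler1n.
  rewrite -/(a_ n z) in h1.
  move: (powR_ge0 `|a z| p) (powR_ge0 `|b z| p) h1 h2 h3.
  by move: (`|a_ n z| `^ p) (2 `^ p) (`|a z| `^ p) (`|b z| `^ p) (`|t n * b z| `^ p) => A C X Y Z; nra.
have [_ _ cvI] := dominated_convergence measurableT mf_ mf f_f ig f_g.
apply: (closed_cvg (fun x => 0 <= x)%E _ _ _ cvI).
- exact: closed_ereal_le_ereal.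
- by apply: nearW => n; exact: P0.
Qed.

End energy.

(** * Minimizers and weak solutions *)

Definition kernel_weight {R : realType} {n : nat} (s p : R)
    (z : RV R n * RV R n) : R :=
  (enorm ((z.1 : 'rV[R]_n) - (z.2 : 'rV[R]_n)) `^ (n%:R + s * p))^-1.

Definition increment {R : realType} {n : nat} (phi : 'rV[R]_n -> R)
    (z : RV R n * RV R n) : R := phi z.1 - phi z.2.

Section gagliardo_energy.
Context {R : realType} {n : nat} (s p : R).
Hypothesis (p1 : 1 < p).
Implicit Types u phi : 'rV[R]_n -> R.

Local Notation mu := (lam2 R n).
Local Notation w := (kernel_weight s p).

Lemma kernel_weight_ge0 (z : RV R n * RV R n) : 0 <= w z.
Proof. by rewrite invr_ge0 powR_ge0. Qed.

Lemma kernel_weight_gt0 (x y : 'rV[R]_n) : x != y -> 0 < w (x, y).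
Proof. by move=> xy; rewrite invr_gt0 powR_gt0// enorm_gt0// subr_eq0. Qed.

Lemma measurable_kernel_weight : measurable_fun setT (w : RV R n * RV R n -> R).
Proof. exact: measurable_kernel. Qed.

Lemma measurable_increment phi : continuous phi ->
  measurable_fun setT (increment phi : RV R n * RV R n -> R).
Proof. by move=> cphi; apply: measurable_diff; exact: continuous_measurable_rv. Qed.

Lemma gagliardo_energy phi : measurable_fun setT (phi : RV R n -> R) ->
  gagliardo_p s p phi = energy mu w p (increment phi).
Proof.
move=> mphi; rewrite /gagliardo_p iint2_nonnegE//.
  exact: (measurable_gagliardo R n p _ _ mphi).
by move=> x y; rewrite divr_ge0 ?powR_ge0.
Qed.

Lemma weak_lhs_pairing u phi : continuous u -> continuous phi ->
  weak_lhs s p u phi = pairing mu w p (increment u) (increment phi).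
Proof.
move=> cu cphi.
pose F (z : RV R n * RV R n) := Jp p (increment u z) * increment phi z * w z.
have mF : measurable_fun setT F.
  by apply: measurable_pairing => //; [exact: measurable_kernel_weight|
    exact: measurable_increment|exact: measurable_increment].
rewrite /weak_lhs /iint2 !iint2_nonnegE.
- rewrite /pairing [RHS]integralE; congr (_ - _)%E; apply: eq_integral => z _.
    by rewrite funeposE -EFin_max.
  by rewrite funenegE -EFinN -EFin_max.
- by apply: measurable_maxr => //; exact: measurableT_comp.
- by move=> x y; rewrite le_max lexx orbT.
- exact: measurable_maxr.
- by move=> x y; rewrite le_max lexx orbT.
Qed.

Lemma lam_box_center (x : 'rV[R]_n) (r : R) : 0 <= r ->
  exists2 A : set (RV R n), measurable A /\ lam R n A = ((r *+ 2) ^+ n)%:E &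
    A = [set y | (y : 'rV[R]_n) - x \in box R n r].
Proof.
move=> r0; exists [set y | (y : 'rV[R]_n) - x \in box R n r] => //.
have mA : measurable [set y : RV R n | (y : 'rV[R]_n) - x \in box R n r].
  have := measurable_shift_rv R n (- x) measurableT _ (measurable_box R n r).
  rewrite setTI; congr measurable; apply/seteqP; split => y /=; rewrite inE//.
split => //; rewrite -(lam_box R n r r0).
have mb := measurable_box R n r.
transitivity (\int[lam R n]_y (\1_[set y : RV R n | (y : 'rV[R]_n) - x \in box R n r] y)%:E)%E.
  by rewrite integral_indic ?setIT.
transitivity (\int[lam R n]_y (\1_(box R n r) y)%:E)%E; last first.
  by rewrite integral_indic ?setIT.
rewrite -[RHS](integral_lam_shift R n (- x)); last 2 first.
- by apply/measurable_EFinP; exact: measurable_indic.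
- by move=> y; rewrite lee_fin.
apply: eq_integral => y _; rewrite !indicE; congr ((_ : bool)%:R)%:E.
by apply/idP/idP => [/set_mem|h]; [|apply/mem_set].
Qed.

(** If [phi] took two values, continuity would give two cubes of positive measure with [phi] below a
    level on one and above it on the other; [F] would be positive on their product. Applied to the
    energy density it gives positivity of the energy, applied to the convexity defect it gives
    uniqueness. *)
Lemma constant_integral0 phi (F : RV R n * RV R n -> R) : continuous phi ->
  measurable_fun setT F -> (forall z, 0 <= F z) ->
  (forall x y, phi x != phi y -> 0 < F (x, y)) ->
  (\int[mu]_z (F z)%:E = 0)%E -> forall x y, phi x = phi y.
Proof.
move=> cphi mF F0 Fpos IF0 x y; apply/eqP; apply: contraT => xy.
wlog : x y xy / phi x < phi y.
  by move=> W; move: (xy); rewrite neq_lt => /orP[|] h; apply: (W _ _ _ h); rewrite // eq_sym.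
move=> {xy} xy; pose c := (phi x + phi y) / 2.
have xc : phi x < c by rewrite /c; lra.
have cy : c < phi y by rewrite /c; lra.
have [e1 /= e10 xe1] : exists2 e : R, 0 < e & ball x e `<=` [set z | phi z < c].
  apply/nbhs_ballP; apply: (cphi x [set t | t < c]); exact: lt_nbhsl.
have [e2 /= e20 ye2] : exists2 e : R, 0 < e & ball y e `<=` [set z | c < phi z].
  apply/nbhs_ballP; apply: (cphi y [set t | c < t]); exact: lt_nbhsr.
pose r := Num.min e1 e2 / 2.
have m0 : 0 < Num.min e1 e2 by rewrite lt_min e10.
have r0 : 0 < r by rewrite divr_gt0.
have re1 : r < e1.
  by have := ge_min e1 e1 e2; rewrite lexx/= => ?; rewrite /r; lra.
have re2 : r < e2.
  by have := ge_min e2 e1 e2; rewrite lexx orbT/= => ?; rewrite /r; lra.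
have in_ball (a z : 'rV[R]_n) e : r < e -> z - a \in box R n r -> ball a e z.
  rewrite inE => rb zb; split; first exact: lt_trans rb.
  move=> i j; rewrite (ord1 i) /ball /= distrC; have := zb j.
  by rewrite !mxE in_itv /= -ler_norml => /le_lt_trans; apply.
have [A [mA lA] AE] := lam_box_center x r (ltW r0).
have [B [mB lB] BE] := lam_box_center y r (ltW r0).
have mAB : measurable (A `*` B) by exact: measurableX.
have AB0 : (mu (A `*` B) = 0)%E.
  have mFE : measurable_fun setT (EFin \o F) by exact/measurable_EFinP.
  have : ae_eq mu setT (EFin \o F) (cst 0%E).
    apply/(ae_eq_integral_abs mu measurableT mFE); rewrite -IF0.
    by apply: eq_integral => z _; rewrite gee0_abs// lee_fin.
  move=> [N [mN N0 FN]]; apply/eqP; rewrite eq_le measure_ge0 andbT -N0.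
  apply: le_measure; rewrite ?inE// => -[a b] [/= Aa Bb]; apply: FN => /= /(_ I).
  move=> [Fab]; suff /Fpos : phi a != phi b by rewrite Fab ltxx.
  rewrite lt_eqF//; apply: (@lt_trans _ _ c).
    by apply: xe1; apply: (in_ball _ _ _ re1); move: Aa; rewrite AE.
  by apply: ye2; apply: (in_ball _ _ _ re2); move: Bb; rewrite BE.
move: AB0; rewrite [LHS]product_measure1E// [X in (X * _)%E]lA [X in (_ * X)%E]lB -EFinM => -[].
by move/eqP; rewrite gt_eqF// mulr_gt0// exprn_gt0// mulrn_wgt0.
Qed.

End gagliardo_energy.

Lemma holder_semi_ltyP {R : realType} {n : nat} (a : R) (phi : 'rV[R]_n -> R) :
  (holder_semi a phi < +oo)%E <->
  exists M, forall x y, x != y -> `|phi x - phi y| <= M * enorm (x - y) `^ a.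
Proof.
split=> [hoo|[M HM]].
  exists (fine (holder_semi a phi)) => x y xy.
  have e0 : 0 < enorm (x - y) `^ a by rewrite powR_gt0// enorm_gt0// subr_eq0.
  have : ((`|phi x - phi y| / enorm (x - y) `^ a)%:E <= holder_semi a phi)%E.
    by apply: ereal_sup_ubound; exists x, y.
  case: (holder_semi a phi) hoo => [r| |]//= _.
  by rewrite lee_fin ler_pdivrMr.
apply: (@le_lt_trans _ _ M%:E); last exact: ltry.
apply: ge_ereal_sup => _ [x [y [xy ->]]].
rewrite lee_fin ler_pdivrMr; first exact: HM.
by rewrite powR_gt0// enorm_gt0// subr_eq0.
Qed.

Section variational.
Context {R : realType} {n : nat} (s p : R).
Hypothesis (p1 : 1 < p).
Implicit Types u phi : 'rV[R]_n -> R.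

Local Notation mu := (lam2 R n).
Local Notation w := (kernel_weight s p).
Local Notation E phi := (energy mu w p (increment phi)).

Lemma Wsp_measurable phi : Wsp s p phi -> measurable_fun setT (phi : RV R n -> R).
Proof. by move=> [? _]; exact: continuous_measurable_rv. Qed.

Lemma Wsp_measurable_increment phi : Wsp s p phi ->
  measurable_fun setT (increment phi : RV R n * RV R n -> R).
Proof. by move=> [? _]; exact: measurable_increment. Qed.

Lemma Wsp_gagliardo_energy phi : Wsp s p phi -> gagliardo_p s p phi = E phi.
Proof. by move=> /Wsp_measurable; exact: gagliardo_energy. Qed.

Lemma Wsp_energy_lty phi : Wsp s p phi -> (E phi < +oo)%E.
Proof. by move=> W; rewrite -Wsp_gagliardo_energy//; case: W => _ []. Qed.

Lemma energy_cst (k : R) : E (fun=> k) = 0%E.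
Proof.
rewrite /energy integral0_eq// => z _; rewrite /increment subrr normr0 powR0 ?mul0r//.
by rewrite gt_eqF// (lt_trans _ p1).
Qed.

Lemma Wsp_cst (k : R) : Wsp s p (fun _ : 'rV[R]_n => k).
Proof.
split; first exact: cst_continuous.
split.
  apply/holder_semi_ltyP; exists 0 => x y _.
  by rewrite subrr normr0 mul0r.
rewrite gagliardo_energy; last exact: measurable_cst.
by rewrite energy_cst.
Qed.

Lemma Wsp_lin u phi (c : R) : Wsp s p u -> Wsp s p phi ->
  Wsp s p (fun x => u x + c * phi x).
Proof.
move=> Wu Wphi; have [cu [hu gu]] := Wu; have [cphi [hphi gphi]] := Wphi.
have cc : continuous (fun x => u x + c * phi x).
  move=> x; apply: (@continuousD _ R^o _ u (fun x => c * phi x)); first exact: cu.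
  by apply: continuousM; [exact: cst_continuous|exact: cphi].
split => //; split.
  move/holder_semi_ltyP : hu => [M1 HM1]; move/holder_semi_ltyP : hphi => [M2 HM2].
  apply/holder_semi_ltyP; exists (M1 + `|c| * M2) => x y xy.
  rewrite opprD addrACA -mulrBr (le_trans (ler_normD _ _))//.
  rewrite mulrDl lerD//; first exact: HM1.
  by rewrite normrM -mulrA ler_wpM2l//; exact: HM2.
rewrite gagliardo_energy//; last exact: continuous_measurable_rv.
have mu_ := Wsp_measurable_increment _ Wu.
have mphi := Wsp_measurable_increment _ Wphi.
have Eu := Wsp_energy_lty _ Wu; have Ephi := Wsp_energy_lty _ Wphi.
have mcphi : measurable_fun setT (fun z => c * increment phi z : R).
  exact: measurable_funM.
have Ecphi : (energy mu w p (fun z => c * increment phi z)%R < +oo)%E.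
  rewrite (energyZ _ _ _ (measurable_kernel_weight s p) (kernel_weight_ge0 s p) c)//.
  apply: lte_mul_pinfty => //; exact: Ephi.
have := energyD mu w p (measurable_kernel_weight s p) (kernel_weight_ge0 s p) p1
  _ _ mu_ Eu mcphi Ecphi.
rewrite (_ : (fun z => _) = increment (fun x => u x + c * phi x))//.
by apply/funext => z; rewrite /increment; ring.
Qed.

Lemma energy_gt0 u : Wsp s p u -> nonconstant u -> (0 < E u)%E.
Proof.
move=> Wu [x [y uxy]]; rewrite lt_neqAle energy_ge0 ?andbT; last exact: kernel_weight_ge0.
apply: contraNneq uxy => E0; apply/eqP.
have mu_ := Wsp_measurable_increment _ Wu.
apply: (constant_integral0 u (fun z => `|increment u z| `^ p * w z)) => //.
- by case: Wu.
- by apply: measurable_funM; [exact: measurable_powR_norm|exact: measurable_kernel_weight].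
- by move=> z; rewrite mulr_ge0 ?powR_ge0//; exact: kernel_weight_ge0.
- move=> a b ab; rewrite mulr_gt0//.
    by rewrite powR_gt0// normr_gt0 /increment subr_eq0.
  by apply: kernel_weight_gt0; apply: contra_neq ab => ->.
Qed.

Definition minimal_between (x0 y0 : 'rV[R]_n) u :=
  forall phi, Wsp s p phi -> phi x0 = u x0 -> phi y0 = u y0 ->
    (gagliardo_p s p u <= gagliardo_p s p phi)%E.

(** The competitor u + t (phi - phi(x0)) agrees with u at both points, and the subtracted constant
    does not affect increments. *)
Lemma minimal_pairing_ge0 x0 y0 u phi : Wsp s p u -> minimal_between x0 y0 u ->
  Wsp s p phi -> phi x0 = phi y0 ->
  (0 <= pairing mu w p (increment u) (increment phi))%E.
Proof.
move=> Wu umin Wphi phi0.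
apply: (pairing_ge0 _ _ _ (measurable_kernel_weight s p) (kernel_weight_ge0 s p) p1
  _ _ (Wsp_measurable_increment _ Wu) (Wsp_energy_lty _ Wu)
  (Wsp_measurable_increment _ Wphi) (Wsp_energy_lty _ Wphi)) => t t0.
pose psi x := u x + t * (phi x + (- phi x0) * 1).
have Wpsi : Wsp s p psi by apply: Wsp_lin => //; apply: Wsp_lin => //; exact: Wsp_cst.
have := umin _ Wpsi; rewrite (Wsp_gagliardo_energy _ Wu) (Wsp_gagliardo_energy _ Wpsi).
rewrite (_ : increment psi = (fun z => increment u z + t * increment phi z)); last first.
  by apply/funext => z; rewrite /increment /psi; ring.
by apply; rewrite /psi -?phi0; ring.
Qed.

Lemma pairingZ a b (c : R) :
  measurable_fun setT a -> (energy mu w p a < +oo)%E ->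
  measurable_fun setT b -> (energy mu w p b < +oo)%E ->
  pairing mu w p a (fun z => c * b z) = (c%:E * pairing mu w p a b)%E.
Proof.
move=> ma Ea mb Eb; rewrite /pairing -(integralZl measurableT
  (pairing_integrable _ _ _ (measurable_kernel_weight s p) (kernel_weight_ge0 s p) p1
   _ _ ma Ea mb Eb)).
by apply: eq_integral => z _; rewrite -EFinM; congr EFin; ring.
Qed.

(** The pairing of u with [phi] is linear in [phi] and vanishes when phi(x0) = phi(y0), so it is a
    multiple of phi(x0) - phi(y0); taking [phi] to be [u] identifies the multiple. *)
Lemma minimal_weak x0 y0 u : Wsp s p u -> nonconstant u ->
  minimal_between x0 y0 u ->
  exists c : R, c != 0 /\ forall phi, Wsp s p phi ->
    weak_lhs s p u phi = (c * (phi x0 - phi y0))%:E.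
Proof.
move=> Wu ncu umin.
have E0 := energy_gt0 _ Wu ncu.
have mdu := Wsp_measurable_increment _ Wu; have Eu := Wsp_energy_lty _ Wu.
(* Otherwise the constant u(x0) would be a competitor of zero energy. *)
have uxy : u x0 - u y0 != 0.
  apply/eqP => /eqP; rewrite subr_eq0 => /eqP uxy.
  have := umin _ (Wsp_cst (u x0)) erefl uxy.
  rewrite !Wsp_gagliardo_energy//; last exact: Wsp_cst.
  by rewrite energy_cst leNgt E0.
have Ef := energy_fin_num _ _ _ (kernel_weight_ge0 s p) _ Eu.
exists (fine (E u) / (u x0 - u y0)); split.
  rewrite mulf_neq0 ?invr_eq0// gt_eqF//.
  by apply: fine_gt0; rewrite E0 Eu.
move=> phi Wphi.
pose k := (phi x0 - phi y0) / (u x0 - u y0).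
have pair0 psi : Wsp s p psi -> psi x0 = psi y0 ->
    pairing mu w p (increment u) (increment psi) = 0%E.
  move=> Wpsi psi0; apply/eqP; rewrite eq_le (minimal_pairing_ge0 x0 y0)// andbT.
  have WNpsi : Wsp s p (fun x => 0 + (-1) * psi x).
    by apply: Wsp_lin => //; exact: Wsp_cst.
  have := minimal_pairing_ge0 x0 y0 _ _ Wu umin WNpsi.
  rewrite psi0 => /(_ erefl).
  rewrite (_ : increment (fun x => 0 + -1 * psi x) = (fun z => (-1) * increment psi z)); last first.
    by apply/funext => z; rewrite /increment; ring.
  rewrite (pairingZ _ _ _ mdu Eu (Wsp_measurable_increment _ Wpsi) (Wsp_energy_lty _ Wpsi)).
  by rewrite mulN1e oppe_ge0.
pose psi x := phi x + (- k) * u x.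
have Wpsi : Wsp s p psi by exact: Wsp_lin.
have psixy : psi x0 = psi y0.
  apply/eqP; rewrite -subr_eq0; apply/eqP; rewrite /psi /k.
  by move: uxy; set a := u x0; set b := u y0 => ab; field.
rewrite weak_lhs_pairing; [|exact: p1|by case: Wu|by case: Wphi].
transitivity (pairing mu w p (increment u) (increment psi) +
    pairing mu w p (increment u) (fun z => k * increment u z)%R)%E.
  have mku : measurable_fun setT (fun z => k * increment u z : R) by exact: measurable_funM.
  have Eku : (energy mu w p (fun z => k * increment u z)%R < +oo)%E.
    rewrite (energyZ _ _ _ (measurable_kernel_weight s p) (kernel_weight_ge0 s p) k _ mdu).
    apply: lte_mul_pinfty => //; exact: Eu.
  rewrite /pairing -(integralD measurableT
   (pairing_integrable _ _ _ (measurable_kernel_weight s p) (kernel_weight_ge0 s p) p1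
   _ _ mdu Eu (Wsp_measurable_increment _ Wpsi) (Wsp_energy_lty _ Wpsi))
   (pairing_integrable _ _ _ (measurable_kernel_weight s p) (kernel_weight_ge0 s p) p1
   _ _ mdu Eu mku Eku)).
  apply: eq_integral => z _; rewrite -EFinD; congr EFin.
  by rewrite /psi /increment; ring.
rewrite (pair0 _ Wpsi psixy) add0e (pairingZ _ _ _ mdu Eu mdu Eu) pairing_diag//.
rewrite -(fineK Ef) -EFinM; congr EFin; rewrite /k /=; ring.
Qed.

(** For a competitor [phi] the equation tested with phi - u has right-hand side 0, so the energy of
    [phi] is that of [u] plus the integral of the convexity defect. Equal energies make this
    integral 0, hence phi - u constant, and the constant is 0 by the value at [x0]. *)
Lemma weak_minimal x0 y0 u (c : R) : Wsp s p u ->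
  (forall phi, Wsp s p phi -> weak_lhs s p u phi = (c * (phi x0 - phi y0))%:E) ->
  minimal_between x0 y0 u /\
  (forall phi, Wsp s p phi -> phi x0 = u x0 -> phi y0 = u y0 ->
     gagliardo_p s p phi = gagliardo_p s p u -> phi = u).
Proof.
move=> Wu uweak.
have mdu := Wsp_measurable_increment _ Wu; have Eu := Wsp_energy_lty _ Wu.
have pair0 phi : Wsp s p phi -> phi x0 = u x0 -> phi y0 = u y0 ->
    pairing mu w p (increment u) (fun z => increment phi z - increment u z) = 0%E.
  move=> Wphi phix phiy.
  have Wd : Wsp s p (fun x => phi x + (-1) * u x) by exact: Wsp_lin.
  have := uweak _ Wd.
  rewrite weak_lhs_pairing; [|exact: p1|by case: Wu|by case: Wd].
  rewrite (_ : increment (fun x => phi x + -1 * u x) = (fun z => increment phi z - increment u z)).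
    by move=> ->; rewrite phix phiy; congr EFin; ring.
  by apply/funext => z; rewrite /increment; ring.
have key phi (Wphi : Wsp s p phi) (phix : phi x0 = u x0) (phiy : phi y0 = u y0) :
    E phi = (E u + \int[mu]_z (convexity_defect w p (increment u) (increment phi) z)%:E)%E.
  rewrite (energy_defect _ _ _ (measurable_kernel_weight s p) (kernel_weight_ge0 s p) p1
    _ _ mdu Eu (Wsp_measurable_increment _ Wphi) (Wsp_energy_lty _ Wphi)).
  by rewrite pair0// mule0 adde0.
split=> phi Wphi phix phiy.
  rewrite (Wsp_gagliardo_energy _ Wu) (Wsp_gagliardo_energy _ Wphi) (key _ Wphi phix phiy).
  apply: leeDl.
  by apply: integral_ge0 => z _; rewrite lee_fin; apply: convexity_defect_ge0 => //;
    exact: kernel_weight_ge0.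
rewrite (Wsp_gagliardo_energy _ Wu) (Wsp_gagliardo_energy _ Wphi) (key _ Wphi phix phiy) => E0.
have Ef := energy_fin_num _ _ _ (kernel_weight_ge0 s p) _ Eu.
have D0 : (\int[mu]_z (convexity_defect w p (increment u) (increment phi) z)%:E = 0)%E.
  move: E0; rewrite -(fineK Ef); case: (integral _ _ _) => [r| |]//=.
  by rewrite -EFinD => -[/eqP]; rewrite -subr_eq0 addrAC subrr add0r => /eqP ->.
have dcst : forall x y, phi x - u x = phi y - u y.
  apply: (constant_integral0 (fun x => phi x - u x)
    (convexity_defect w p (increment u) (increment phi)) _ _ _ _ D0).
  - move=> x; apply: (@continuousB _ R^o _ phi u); first by case: Wphi => + _; exact.
    by case: Wu => + _; exact.
  - apply: measurable_convexity_defect => //; [exact: measurable_kernel_weight|].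
    exact: Wsp_measurable_increment.
  - by move=> z; apply: convexity_defect_ge0 => //; exact: kernel_weight_ge0.
  - move=> x y xy; rewrite /convexity_defect mulr_gt0//; last first.
      by apply: kernel_weight_gt0; apply: contra_neq xy => ->.
    have /(powR_tangent_lt p p1) : increment u (x, y) != increment phi (x, y).
      apply: contra_neq xy; rewrite /increment /= => h.
      by apply/eqP; rewrite -subr_eq0; apply/eqP; lra.
    lra.
apply/funext => x; have := dcst x x0; rewrite phix; lra.
Qed.

End variational.

(** * Lipschitz functions with bounded support *)

(** On [D] the function [H] is at most the sum over k of c k times the indicator of the cube of
    half-side r k, and the k-th term has integral at most K x^k. *)
Lemma integral_dyadic_lty (R : realType) (n : nat) (D : set (RV R n))
    (H : RV R n -> R) (r c : nat -> R) (K x : R) :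
  measurable D -> measurable_fun setT H -> (forall z, 0 <= H z) ->
  (forall k, 0 <= r k) -> (forall k, 0 <= c k) -> 0 <= K -> 0 < x -> x < 1 ->
  (forall k, c k * (r k *+ 2) ^+ n = K * x ^+ k) ->
  (forall z, D z -> exists k, box R n (r k) z /\ H z <= c k) ->
  (\int[lam R n]_(z in D) (H z)%:E < +oo)%E.
Proof.
move=> mD mH H0 r0 c0 K0 x0 x1 rcE DH.
pose f k z : \bar R := (c k * \1_(box R n (r k)) z)%:E.
have f0 k z : (0 <= f k z)%E by rewrite lee_fin mulr_ge0.
have mbox := measurable_box R n.
have mf k : measurable_fun D (f k).
  apply/measurable_EFinP; apply: measurable_funM => //; exact: measurable_indic.
apply: (@le_lt_trans _ _ (\int[lam R n]_(z in D) \sum_(0 <= k <oo) f k z)%E).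
  apply: ge0_le_integral => //.
  - by move=> z _; rewrite lee_fin.
  - by apply/measurable_EFinP; exact: measurable_funTS.
  - by apply: ge0_emeasurable_sum => [k z _ _|k _]; [exact: f0|exact: mf].
  - move=> z /DH[k [zk Hk]].
    apply: (@le_trans _ _ (\sum_(0 <= i < k.+1) f i z)%E); last exact: nneseries_lim_ge.
    rewrite big_nat_recr//=; apply: (@le_trans _ _ (f k z)); last first.
      by rewrite leeDr// sume_ge0.
    by rewrite /f indicE mem_set// mulr1 lee_fin.
rewrite integral_nneseries//.
apply: (@le_lt_trans _ _ (K / (1 - x))%:E); last exact: ltry.
apply: lime_le; first by apply: is_cvg_nneseries => k _ _; exact: integral_ge0.
apply: nearW => m.
apply: (@le_trans _ _ (\sum_(0 <= k < m) (K * x ^+ k)%:E)%E).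
  apply: lee_sum => k _; rewrite -rcE EFinM.
  under eq_integral do rewrite /f EFinM.
  rewrite ge0_integralZl//; last 2 first.
  - by apply/measurable_EFinP; exact: measurable_indic.
  - by rewrite lee_fin.
  rewrite integral_indic// -(lam_box R n _ (r0 k)) lee_wpmul2l ?lee_fin//.
  by apply: le_measure; rewrite ?inE//; exact: measurableI.
rewrite sumEFin lee_fin; apply: geometric_le_lim => //.
by rewrite gtr0_norm.
Qed.

Lemma dyadic_exists (R : realType) (t : R) : 1 <= t ->
  exists k, 2 ^+ k <= t /\ t < 2 ^+ k.+1.
Proof.
move=> t1; have ex : exists k, t < 2 ^+ k.+1.
  exists (Num.Def.archi_bound t); apply: upper_nthrootP; exact: leqnSn.
exists (ex_minn ex); case: ex_minnP => -[|k] tk kmin; first by rewrite expr0.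
by split => //; rewrite leNgt; apply/negP => /kmin; rewrite ltnn.
Qed.

Lemma mem_box (R : realType) (n : nat) (z : 'rV[R]_n) (r : R) : `|z| <= r -> box R n r z.
Proof.
move=> zr i; rewrite in_itv /= -ler_norml; apply: le_trans zr.
rewrite (_ : `|z| = mx_norm z)// mx_normrE; exact: (le_bigmax _ _ (0, i)).
Qed.

Lemma measurable_norm_rv (R : realType) (n : nat) :
  measurable_fun setT (fun z : RV R n => `|z : 'rV[R]_n|).
Proof. by apply: continuous_measurable_rv; exact: norm_continuous. Qed.

Lemma powR_exprn (R : realType) (a q : R) (k : nat) : 0 <= a ->
  (a ^+ k) `^ q = (a `^ q) ^+ k.
Proof.
by move=> a0; rewrite -powR_mulrn// powRAC powR_mulrn// powR_ge0.
Qed.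

Lemma powR2_lt1 (R : realType) (a : R) : a < 0 -> (2 : R) `^ a < 1.
Proof.
move=> a0; rewrite /powR pnatr_eq0 /= expR_lt1 nmulr_rlt0//.
by rewrite ln_gt0// ltr1n.
Qed.

Lemma integral_far_lty (R : realType) (n : nat) (q A : R) : n%:R < q -> 0 <= A ->
  (\int[lam R n]_(z in [set z : RV R n | 1 <= `|z : 'rV[R]_n|]%R)
     (A * `|z : 'rV[R]_n| `^ (- q))%:E < +oo)%E.
Proof.
move=> nq A0; have mN := measurable_norm_rv R n.
have m1 : measurable [set z : RV R n | 1 <= `|z : 'rV[R]_n|].
  have mI : measurable (`[1, +oo[%classic : set R) by exact: measurable_itv.
  have := mN measurableT _ mI; rewrite setTI; congr measurable.
  by apply/seteqP; split => z /=; rewrite in_itv /= andbT.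
(* The shell 2^k <= |z| < 2^(k + 1) lies in a cube of side 4 * 2^k, whence the factor 4^n, and
   |z|^(- q) is at most u^k there. The ratio of the series is 2^(n - q). *)
pose u : R := 2 `^ (- q).
apply: (integral_dyadic_lty R n _ _ (fun k => 2 ^+ k.+1) (fun k => A * u ^+ k)
  (A * 4 ^+ n) (u * 2 ^+ n)) => //.
- by apply: measurable_funM => //; exact: (measurableT_comp (@measurable_powR R _) mN).
- by move=> z; rewrite mulr_ge0 ?powR_ge0.
- by move=> k; rewrite mulr_ge0// exprn_ge0// powR_ge0.
- by rewrite mulr_ge0.
- by rewrite mulr_gt0 ?powR_gt0.
- rewrite /u -powR_mulrn// -powRD; last by rewrite pnatr_eq0 implybT.
  by apply: powR2_lt1; lra.
- move=> k; rewrite (_ : 2 ^+ k.+1 *+ 2 = 2 ^+ k * 4); last by rewrite -mulr_natr exprS; ring.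
  by rewrite !exprMn -!exprM (mulnC k n); ring.
move=> z /= z1; have [k [kz zk]] := dyadic_exists R _ z1.
exists k; split; first by apply: mem_box; exact: ltW.
rewrite ler_wpM2l// /u -powR_exprn// !powRN lef_pV2 ?posrE ?powR_gt0//;
  last exact: (lt_le_trans ltr01 z1).
apply: ge0_ler_powR => //; rewrite ?nnegrE ?exprn_ge0//.
by apply: ltW; apply: le_lt_trans nq.
Qed.

Lemma integral_near_lty (R : realType) (n : nat) (q A : R) : q < n%:R -> 0 <= A ->
  (\int[lam R n]_(z in [set z : RV R n | `|z : 'rV[R]_n| < 1]%R)
     (A * `|z : 'rV[R]_n| `^ (- q))%:E < +oo)%E.
Proof.
move=> qn A0; have mN := measurable_norm_rv R n.
have m1 : measurable [set z : RV R n | `|z : 'rV[R]_n| < 1].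
  have mI : measurable (`]-oo, 1[%classic : set R) by exact: measurable_itv.
  rewrite (_ : [set z | _] = (fun z : RV R n => `|z : 'rV[R]_n|) @^-1` `]-oo, 1[%classic).
    by have := mN measurableT _ mI; rewrite setTI.
  by apply/seteqP; split => z /=; rewrite in_itv.
(* [q] may have either sign. On the shell 2^(- k - 1) < |z| <= 2^(- k) the power |z|^(- q) is at
   most v^(k + 1) if q >= 0 and at most v^k if q < 0; [C] covers both cases, and also the value 0 or
   1 that [powR] takes at z = 0. *)
pose v : R := 2 `^ q; pose C : R := Num.max 1 v.
have v0 : 0 < v by rewrite powR_gt0.
have C1 : 1 <= C by rewrite le_max lexx.
have Cv : v <= C by rewrite le_max lexx orbT.
have C0 : 0 <= C by exact: le_trans C1.
apply: (integral_dyadic_lty R n _ _ (fun k => 2 ^- k) (fun k => A * (C * v ^+ k))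
  (A * C * 2 ^+ n) (v * 2 ^- n)) => //.
- by apply: measurable_funM => //; exact: (measurableT_comp (@measurable_powR R _) mN).
- by move=> z; rewrite mulr_ge0 ?powR_ge0.
- by move=> k; rewrite !mulr_ge0// exprn_ge0// ltW.
- by rewrite !mulr_ge0// exprn_ge0.
- by rewrite mulr_gt0// invr_gt0 exprn_gt0.
- rewrite /v -powR_mulrn// -powRN -powRD; last by rewrite pnatr_eq0 implybT.
  by apply: powR2_lt1; lra.
- move=> k; rewrite (_ : 2 ^- k *+ 2 = 2 ^- k * 2); last by rewrite mulr_natr.
  by rewrite !exprMn !exprVn -!exprM (mulnC k n); ring.
move=> z /= z1; have [->|z0] := eqVneq (z : 'rV[R]_n) 0.
  exists 0%N; split; first by apply: mem_box; rewrite normr0.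
  rewrite ler_wpM2l// normr0 expr0 mulr1 (le_trans _ C1)//.
  by rewrite /powR eqxx; case: (_ == _).
have nz0 : 0 < `|z : 'rV[R]_n| by rewrite normr_gt0.
have [k [kz zk]] : exists k, 2 ^+ k <= `|z : 'rV[R]_n|^-1 /\ `|z : 'rV[R]_n|^-1 < 2 ^+ k.+1.
  by apply: dyadic_exists; rewrite invf_ge1// ltW.
have k0 : 0 < (2 ^+ k : R) by rewrite exprn_gt0.
exists k; split.
  by apply: mem_box; rewrite -[leLHS]invrK lef_pV2 ?posrE ?invr_gt0.
rewrite ler_wpM2l// -[(- q)]mulN1r powRrM powR_inv1//.
set y := (`|z : 'rV[R]_n|)^-1 in kz zk *.
have y0 : 0 < y by rewrite invr_gt0.
have [q0|q0] := leP 0 q.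
  apply: (@le_trans _ _ ((2 ^+ k.+1) `^ q)).
    by apply: ge0_ler_powR => //; rewrite ?nnegrE ?exprn_ge0 ?ltW.
  by rewrite powR_exprn// -/v exprS ler_wpM2r// exprn_ge0// ltW.
apply: (@le_trans _ _ ((2 ^+ k) `^ q)).
  rewrite -[q]opprK !(powRN _ (- q)) lef_pV2 ?posrE ?powR_gt0//.
  by apply: ge0_ler_powR => //; rewrite ?nnegrE ?oppr_ge0; exact: ltW.
by rewrite powR_exprn// -/v -[leLHS]mul1r ler_wpM2r// exprn_ge0// ltW.
Qed.

Section lipschitz_gagliardo.
Context {R : realType} {n : nat} (s p : R).
Hypotheses (s0 : 0 < s) (s1 : s < 1) (p1 : 1 < p).

Let p0 : 0 < p. Proof. exact: lt_trans p1. Qed.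

Local Notation q := (n%:R + s * p).

Let near0 : set (RV R n) := [set z | `|z : 'rV[R]_n| < 1].
Let far : set (RV R n) := [set z | 1 <= `|z : 'rV[R]_n|].

Let mnear : measurable near0.
Proof.
have mI : measurable (`]-oo, 1[%classic : set R) by exact: measurable_itv.
rewrite (_ : near0 = (fun z : RV R n => `|z : 'rV[R]_n|) @^-1` `]-oo, 1[%classic).
  by have := measurable_norm_rv R n measurableT _ mI; rewrite setTI.
by apply/seteqP; split => z /=; rewrite in_itv.
Qed.

Let farE : far = ~` near0.
Proof. by apply/seteqP; split => z /=; rewrite /far /near0 /= ?leNgt => /negP. Qed.

Let mfar : measurable far.
Proof. by rewrite farE; exact: measurableC. Qed.

(** A majorant of the difference quotient as a function of z = x - y: a Lipschitz bound gives |z|^(p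
    - q) near 0 and boundedness gives |z|^(- q) far away. The first is integrable because s < 1, the
    second because s > 0. *)
Let H (A B : R) (z : RV R n) : R :=
  A * `|z : 'rV[R]_n| `^ (- (q - p)) * \1_near0 z +
  B * `|z : 'rV[R]_n| `^ (- q) * \1_far z.

Let mH A B : measurable_fun setT (H A B).
Proof.
have mN := measurable_norm_rv R n.
apply: measurable_funD; apply: measurable_funM; (try exact: measurable_indic);
  apply: measurable_funM => //; exact: (measurableT_comp (@measurable_powR R _) mN).
Qed.

Let H_ge0 A B z : 0 <= A -> 0 <= B -> 0 <= H A B z.
Proof. by move=> A0 B0; rewrite addr_ge0// !mulr_ge0// powR_ge0. Qed.

Let HN A B (z : 'rV[R]_n) : H A B (- z) = H A B z.
Proof.
rewrite /H normrN !indicE.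
have -> : (- z \in near0) = (z \in near0).
  by apply/idP/idP => /set_mem h; apply/mem_set; move: h; rewrite /near0 /= normrN.
have -> // : (- z \in far) = (z \in far).
by apply/idP/idP => /set_mem h; apply/mem_set; move: h; rewrite /far /= normrN.
Qed.

Let integral_H_lty A B : 0 <= A -> 0 <= B -> (\int[lam R n]_z (H A B z)%:E < +oo)%E.
Proof.
move=> A0 B0.
have mHE : measurable_fun setT (fun z => (H A B z)%:E) by exact/measurable_EFinP.
rewrite -(setvU near0) ge0_integral_setU//; last 4 first.
- exact: measurableC.
- by rewrite setvU.
- by move=> z _; rewrite lee_fin H_ge0.
- by apply/eqP; rewrite setICl.
rewrite -farE; apply: lte_add_pinfty.
- have -> : (\int[lam R n]_(z in far) (H A B z)%:E =
      \int[lam R n]_(z in far) (B * `|z : 'rV[R]_n| `^ (- q))%:E)%E.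
    apply: eq_integral => z zf; rewrite /H !indicE zf mulr1.
    by move: zf; rewrite farE in_setC => /negbTE ->; rewrite mulr0 add0r.
  apply: integral_far_lty => //; rewrite ltrDl; exact: mulr_gt0.
- have -> : (\int[lam R n]_(z in near0) (H A B z)%:E =
      \int[lam R n]_(z in near0) (A * `|z : 'rV[R]_n| `^ (- (q - p)))%:E)%E.
    apply: eq_integral => z zf; rewrite /H !indicE zf mulr1 farE in_setC zf.
    by rewrite mulr0 addr0.
  apply: integral_near_lty => //; rewrite -addrA gtrDl subr_lt0.
  by rewrite -[ltRHS]mul1r ltr_pM2r.
Qed.

(** The integrand vanishes unless x or y lies in a cube [B] containing the support, so it is at most
    (1_B(x) + 1_B(y)) h(x - y); each of the two terms has integral |B| times that of [h]. *)
Lemma gagliardo_lipschitz_lty (phi : 'rV[R]_n -> R) (M L r : R) :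
  measurable_fun setT (phi : RV R n -> R) -> 0 <= M -> 0 <= L -> 0 <= r ->
  (forall x y, `|phi x - phi y| <= L * `|x - y|) ->
  (forall x, `|phi x| <= M) -> (forall x, phi x != 0 -> `|x| <= r) ->
  (gagliardo_p s p phi < +oo)%E.
Proof.
move=> mphi M0 L0 r0 Lphi Mphi rphi.
pose h := H (L `^ p) ((2 * M) `^ p).
pose B := box R n r.
have mB : measurable B := measurable_box R n r.
have h0 z : 0 <= h z by apply: H_ge0; exact: powR_ge0.
have hN (z : 'rV[R]_n) : h (- z) = h z := HN _ _ z.
have mh : measurable_fun setT h := mH _ _.
have hI : (\int[lam R n]_z (h z)%:E < +oo)%E by apply: integral_H_lty; exact: powR_ge0.
pose K (z : RV R n * RV R n) := h ((z.1 : 'rV[R]_n) - (z.2 : 'rV[R]_n)).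
have K0 z : 0 <= K z := h0 _.
have mK : measurable_fun setT K := measurableT_comp mh (measurable_subr_rv R n).
have mI1 : measurable_fun setT (fun z : RV R n * RV R n => \1_B z.1 : R).
  exact: (measurableT_comp (measurable_indic mB) measurable_fst).
have mI2 : measurable_fun setT (fun z : RV R n * RV R n => \1_B z.2 : R).
  exact: (measurableT_comp (measurable_indic mB) measurable_snd).
have m1 : measurable_fun setT (fun z : RV R n * RV R n => (\1_B z.1 * K z)%:E).
  by apply/measurable_EFinP; exact: measurable_funM.
have m2 : measurable_fun setT (fun z : RV R n * RV R n => (\1_B z.2 * K z)%:E).
  by apply/measurable_EFinP; exact: measurable_funM.
have int0 f : (forall z : RV R n, 0 <= f z) -> forall z, (0 <= (f z)%:E :> \bar R)%E.
  by move=> f0 z; rewrite lee_fin.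
have lamB : (lam R n B < +oo)%E by rewrite lam_box// ltry.
have prod_lty : (\int[lam R n]_x ((\1_B x)%:E * \int[lam R n]_z (h z)%:E) < +oo)%E.
  rewrite ge0_integralZr//; last 2 first.
  - by apply/measurable_EFinP; exact: measurable_indic.
  - by apply: integral_ge0 => z _; rewrite lee_fin.
  rewrite integral_indic// setIT; apply: lte_mul_pinfty => //.
  by rewrite ge0_fin_numE.
have mhx (x : 'rV[R]_n) : measurable_fun setT (fun y : RV R n => (h ((y : 'rV[R]_n) + - x)%R)%:E).
  apply/measurable_EFinP; exact: (measurableT_comp mh (measurable_shift_rv R n _)).
have hx0 (x : 'rV[R]_n) (y : RV R n) : setT y -> (0 <= (h ((y : 'rV[R]_n) + - x)%R)%:E)%E.
  by move=> _; rewrite lee_fin.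
have I1 : (\int[lam2 R n]_z (\1_B z.1 * K z)%:E < +oo)%E.
  rewrite fubini_tonelli1//; last by move=> z; rewrite lee_fin mulr_ge0.
  apply: le_lt_trans prod_lty; rewrite le_eqVlt; apply/orP; left; apply/eqP.
  apply: eq_integral => x _; rewrite /fubini_F /=.
  rewrite -(integral_lam_shift R n (- (x : 'rV[R]_n)) (fun z => (h z)%:E)); last 2 first.
  - exact/measurable_EFinP.
  - by move=> z; rewrite lee_fin.
  rewrite -(ge0_integralZl (lam R n) measurableT (mhx x) (hx0 x)); last by rewrite lee_fin.
  by apply: eq_integral => y _; rewrite -EFinM /K -[in RHS]hN opprB.
have I2 : (\int[lam2 R n]_z (\1_B z.2 * K z)%:E < +oo)%E.
  rewrite fubini_tonelli2//; last by move=> z; rewrite lee_fin mulr_ge0.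
  apply: le_lt_trans prod_lty; rewrite le_eqVlt; apply/orP; left; apply/eqP.
  apply: eq_integral => x _; rewrite /fubini_G /=.
  rewrite -(integral_lam_shift R n (- (x : 'rV[R]_n)) (fun z => (h z)%:E)); last 2 first.
  - exact/measurable_EFinP.
  - by move=> z; rewrite lee_fin.
  rewrite -(ge0_integralZl (lam R n) measurableT (mhx x) (hx0 x)); last by rewrite lee_fin.
  by apply: eq_integral => y _; rewrite -EFinM /K.
rewrite (gagliardo_energy s p phi mphi).
apply: (@le_lt_trans _ _ (\int[lam2 R n]_z ((\1_B z.1 * K z)%:E + (\1_B z.2 * K z)%:E))%E); last first.
  rewrite ge0_integralD//; first exact: lte_add_pinfty.
  - by move=> z _; rewrite lee_fin mulr_ge0.
  - by move=> z _; rewrite lee_fin mulr_ge0.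
apply: ge0_le_integral => //.
- by move=> z _; rewrite lee_fin mulr_ge0 ?powR_ge0// invr_ge0 powR_ge0.
- by apply/measurable_EFinP; exact: measurable_gagliardo.
- by apply: emeasurable_funD.
move=> [x y] _; rewrite -EFinD lee_fin /= -mulrDl.
have [xy|xy] := eqVneq (x : 'rV[R]_n) y.
  rewrite /increment /= xy subrr normr0 powR0 ?mul0r ?gt_eqF//.
  by rewrite mulr_ge0// addr_ge0.
have z0 : 0 < `|(x : 'rV[R]_n) - y| by rewrite normr_gt0 subr_eq0.
have w0 : 0 <= kernel_weight s p (x, y) by exact: kernel_weight_ge0.
have outB (t : 'rV[R]_n) : \1_B (t : RV R n) = 0 :> R -> phi t = 0.
  rewrite indicE; have [tB|tB _] := boolP (_ \in _); first by move/eqP; rewrite oner_eq0.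
  apply/eqP; apply: contraNT tB => /rphi tr; rewrite inE; exact: mem_box.
have Kxy : `|increment phi (x, y)| `^ p * kernel_weight s p (x, y) <= K (x, y).
  have wle : kernel_weight s p (x, y) <= `|(x : 'rV[R]_n) - y| `^ (- q).
    rewrite powRN lef_pV2 ?posrE ?powR_gt0 ?enorm_gt0 ?subr_eq0//.
    apply: ge0_ler_powR; rewrite ?nnegrE ?enorm_ge0 ?norm_le_enorm//.
    by rewrite addr_ge0// mulr_ge0// ltW.
  apply: (@le_trans _ _ (`|increment phi (x, y)| `^ p * `|(x : 'rV[R]_n) - y| `^ (- q))).
    by rewrite ler_wpM2l// powR_ge0.
  rewrite /K /h /H /= !indicE farE in_setC.
  have [zn|zf] := boolP (((x : 'rV[R]_n) - y : RV R n) \in near0).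
    rewrite mulr1 mulr0 addr0.
    have -> : - (q - p) = p + (- q) by ring.
    rewrite powRD; last by rewrite (gt_eqF z0) implybT.
    rewrite mulrA ler_wpM2r ?powR_ge0// -powRM//.
    by apply: ge0_ler_powR; rewrite ?nnegrE ?mulr_ge0 ?(ltW p0)//; exact: Lphi.
  rewrite mulr0 mulr1 add0r ler_wpM2r ?powR_ge0//.
  apply: ge0_ler_powR; rewrite ?nnegrE ?mulr_ge0 ?(ltW p0)//.
  rewrite (le_trans (ler_normB _ _))// mulr_natl mulr2n.
  by apply: lerD; exact: Mphi.
have [xB|xB] := boolP ((x : RV R n) \in B).
  by rewrite (le_trans Kxy)// -[leLHS]mul1r ler_wpM2r// indicE xB lerDl.
have [yB|yB] := boolP ((y : RV R n) \in B).
  by rewrite (le_trans Kxy)// -[leLHS]mul1r ler_wpM2r// !indicE yB lerDr.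
rewrite /increment /= (outB x) ?(outB y) ?indicE ?(negbTE xB) ?(negbTE yB)//.
by rewrite subrr normr0 powR0 ?gt_eqF// addr0 !mul0r.
Qed.

End lipschitz_gagliardo.

Lemma holder_lipschitz_lty (R : realType) (n : nat) (a M L : R)
    (phi : 'rV[R]_n -> R) : 0 <= a -> a <= 1 ->
  (forall x y, `|phi x - phi y| <= L * `|x - y|) -> (forall x, `|phi x| <= M) ->
  (holder_semi a phi < +oo)%E.
Proof.
move=> a0 a1 Lphi Mphi; apply/holder_semi_ltyP.
have M0 : 0 <= M by exact: le_trans (Mphi 0).
exists (`|L| + 2 * M) => x y xy; set e := enorm (x - y).
have e0 : 0 < e by rewrite enorm_gt0// subr_eq0.
have [e1|/ltW e1] := leP e 1.
  apply: (@le_trans _ _ (`|L| * e `^ a)); last first.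
    by rewrite ler_wpM2r ?powR_ge0// lerDl mulr_ge0.
  apply: (le_trans (Lphi _ _)); apply: (@le_trans _ _ (`|L| * `|x - y|)).
    by rewrite ler_wpM2r// ler_norm.
  rewrite ler_wpM2l// (le_trans (norm_le_enorm _))//.
  by apply: ger1_powR; rewrite ?e0.
apply: (@le_trans _ _ (2 * M * e `^ a)); last first.
  by rewrite ler_wpM2r ?powR_ge0// lerDr.
apply: (@le_trans _ _ (2 * M)).
  by rewrite (le_trans (ler_normB _ _))// mulr_natl mulr2n lerD.
rewrite -[leLHS]mulr1 ler_wpM2l ?mulr_ge0// -[leLHS](powRr0 e).
exact: ler_powR.
Qed.

Definition tent {R : realType} {n : nat} (x : 'rV[R]_n) : R := Num.max 0 (1 - `|x|).

Section tent.
Context {R : realType} {n : nat}.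
Implicit Types x y : 'rV[R]_n.

Lemma tent_ge0 x : 0 <= tent x. Proof. by rewrite le_max lexx. Qed.

Lemma tent_le1 x : tent x <= 1.
Proof. by rewrite ge_max ler01 gerBl /=. Qed.

Lemma max_dist (a b c d : R) :
  `|Num.max a b - Num.max c d| <= Num.max `|a - c| `|b - d|.
Proof.
have := ler_norm (a - c); have := ler_norm (c - a); rewrite distrC.
have := ler_norm (b - d); have := ler_norm (d - b); rewrite (distrC d).
rewrite ler_norml; move: `|a - c| `|b - d| => u v h1 h2 h3 h4.
by case: (leP u v) => uv; case: (leP a b) => ab; case: (leP c d) => cd;
  apply/andP; split; lra.
Qed.

Lemma tent_lipschitz x y : `|tent x - tent y| <= 1 * `|x - y|.
Proof.
rewrite mul1r (le_trans (max_dist _ _ _ _))// subrr normr0 ge_max normr_ge0 /=.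
rewrite (_ : 1 - `|x| - (1 - `|y|) = `|y| - `|x|); last by ring.
by rewrite (distrC x); exact: ler_dist_dist.
Qed.

Lemma tent_support x : tent x != 0 -> `|x| <= 1.
Proof.
apply: contraR; rewrite -ltNge => x1; apply/eqP/max_idPl.
by rewrite subr_le0 ltW.
Qed.

Lemma lipschitz_continuous (phi : 'rV[R]_n -> R) (L : R) :
  (forall x y, `|phi x - phi y| <= L * `|x - y|) -> continuous phi.
Proof.
move=> Lphi x; apply/(@cvgrPdist_lt R R^o _ (nbhs x) _ phi) => e e0; apply/nbhs_ballP.
have L1 : 0 < `|L| + 1 by rewrite ltr_wpDl.
exists (e / (`|L| + 1)) => /=; first exact: divr_gt0.
move=> y; rewrite mx_norm_ball /ball_ /= => xy.
apply: le_lt_trans (Lphi x y) _; apply: (@le_lt_trans _ _ ((`|L| + 1) * `|x - y|)).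
  by rewrite ler_wpM2r// (le_trans (ler_norm _))// lerDl.
by rewrite mulrC -ltr_pdivlMr.
Qed.

End tent.

(* Dilating a tent by [r] multiplies its energy by [r ^ (n - s p)], which tends
   to [0]. *)
Lemma cutoff_exists (R : realType) (n : nat) (s p M rho e : R) :
  0 < s -> s < 1 -> 1 < p -> n%:R < s * p -> 0 <= M -> 0 <= rho -> 0 < e ->
  exists psi : 'rV[R]_n -> R, exists L r B : R,
    [/\ forall x, 0 <= psi x <= B,
        forall x y, `|psi x - psi y| <= L * `|x - y|,
        0 <= r /\ (forall x, psi x != 0 -> `|x| <= r),
        forall x, `|x| <= rho -> M <= psi x &
        (gagliardo_p s p psi <= e%:E)%E].
Proof.
move=> s0 s1 p1 nsp M0 rho0 e0.
have p0 : 0 < p by exact: lt_trans p1.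
have ct : continuous (@tent R n) by exact: lipschitz_continuous tent_lipschitz.
have mt := continuous_measurable_rv R n _ ct.
have Gt : (gagliardo_p s p (@tent R n) < +oo)%E.
  apply: (gagliardo_lipschitz_lty s p s0 s1 p1 _ 1 1 1 mt) => //.
  - exact: tent_lipschitz.
  - by move=> x; rewrite ger0_norm ?tent_ge0 ?tent_le1.
  - exact: tent_support.
have G0 : (0 <= gagliardo_p s p (@tent R n))%E.
  by rewrite gagliardo_energy//; apply: energy_ge0; exact: kernel_weight_ge0.
have Gf : gagliardo_p s p (@tent R n) \is a fin_num by rewrite ge0_fin_numE.
pose g := fine (gagliardo_p s p (@tent R n)).
have g0 : 0 <= g by exact: fine_ge0.
pose sig := s * p - n%:R; have sig0 : 0 < sig by rewrite subr_gt0.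
pose C := (2 * M) `^ p * g.
have C0 : 0 <= C by rewrite mulr_ge0 ?powR_ge0.
(* The summand 2 rho + 1 makes |x| / r at most 1/2 on the ball of radius [rho], where the tent is
   then at least 1/2 and [psi] at least [M]. The power makes r^sig at least (C + 1) / e, so that the
   energy C / r^sig is at most [e]. *)
pose r := 2 * rho + 1 + ((C + 1) / e) `^ sig^-1.
have r1 : 2 * rho + 1 <= r by rewrite lerDl powR_ge0.
have r0 : 0 < r by apply: lt_le_trans r1; lra.
(* The dilation by 1 / r, written with the trivial reflection so that [gagliardo_similarity]
   applies. *)
pose T x : 'rV[R]_n := r^-1 *: householder 0 (x - 0) + 0.
have TE x : T x = r^-1 *: x.
  by rewrite /T /householder scaler0 !subr0 addr0.
pose psi x := 2 * M * tent (T x).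
have nT x : `|T x| = r^-1 * `|x| by rewrite TE normrZ gtr0_norm ?invr_gt0.
exists psi, (2 * M * r^-1), r, (2 * M); split.
- move=> x; rewrite !mulr_ge0 ?tent_ge0//= -[leRHS]mulr1 ler_wpM2l ?mulr_ge0//.
  exact: tent_le1.
- move=> x y; rewrite /psi -mulrBr normrM ger0_norm ?mulr_ge0// -[leRHS]mulrA.
  rewrite ler_wpM2l ?mulr_ge0// (le_trans (tent_lipschitz _ _))// mul1r.
  by rewrite !TE -scalerBr normrZ gtr0_norm ?invr_gt0.
- split; first exact: ltW.
  move=> x; rewrite /psi mulf_eq0 negb_or => /andP[_ /tent_support].
  by rewrite nT mulrC ler_pdivrMr// mul1r.
- move=> x xrho; rewrite /psi; apply: (@le_trans _ _ (2 * M * 2^-1)); first lra.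
  rewrite ler_wpM2l ?mulr_ge0// le_max; apply/orP; right.
  rewrite nT mulrC; suff : `|x| / r <= 2^-1 by lra.
  by rewrite ler_pdivrMr//; lra.
have mT : measurable_fun setT (fun x : RV R n => tent (T x) : R).
  apply: continuous_measurable_rv; apply: (lipschitz_continuous _ r^-1) => x y.
  rewrite (le_trans (tent_lipschitz _ _))// mul1r.
  by rewrite !TE -scalerBr normrZ gtr0_norm ?invr_gt0.
have mp : measurable_fun setT (psi : RV R n -> R) by exact: measurable_funM.
rewrite gagliardo_energy//.
rewrite (_ : increment psi = (fun z => 2 * M * increment (fun x => tent (T x)) z)); last first.
  by apply/funext => z; rewrite /increment /psi mulrBr.
rewrite (energyZ _ _ _ (measurable_kernel_weight s p) (kernel_weight_ge0 s p)); last first.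
  exact: measurable_diff.
rewrite -gagliardo_energy// gagliardo_similarity ?invr_gt0//.
rewrite -(fineK Gf) -/g -!EFinM lee_fin ger0_norm ?mulr_ge0// -/sig.
rewrite mulrCA -/C.
have rC : (C + 1) / e <= r `^ sig.
  have -> : (C + 1) / e = (((C + 1) / e) `^ sig^-1) `^ sig.
    by rewrite -powRrM mulVf ?lt0r_neq0// powRr1// divr_ge0 ?addr_ge0 ?(ltW e0).
  apply: (ge0_ler_powR (ltW sig0)); rewrite ?nnegrE ?powR_ge0//; first exact: ltW.
  by rewrite /r lerDr; lra.
have -> : r^-1 `^ sig = (r `^ sig)^-1 by rewrite -powR_inv1 ?ltW// -powRrM mulN1r powRN.
rewrite mulrC ler_pdivrMr ?powR_gt0//.
move: rC; rewrite ler_pdivrMr// mulrC => rC; apply: le_trans rC; lra.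
Qed.

(** * Approximation by test functions *)

Definition clamp {R : realType} {n : nat} (phi psi : 'rV[R]_n -> R) (x : 'rV[R]_n) : R :=
  Num.max (Num.min (phi x) (psi x)) (- psi x).

Section clamp.
Context {R : realType} {n : nat}.
Implicit Types phi psi : 'rV[R]_n -> R.

Lemma min_dist (a b c d : R) :
  `|Num.min a b - Num.min c d| <= Num.max `|a - c| `|b - d|.
Proof.
have := max_dist (- a) (- b) (- c) (- d).
by rewrite -!oppr_min -!opprD !normrN.
Qed.

Lemma clamp_dist phi psi x y :
  `|clamp phi psi x - clamp phi psi y| <=
  Num.max `|phi x - phi y| `|psi x - psi y|.
Proof.
apply: (le_trans (max_dist _ _ _ _)).
rewrite -opprD normrN ge_max min_dist /=.
by rewrite le_max lexx orbT.
Qed.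

Lemma clamp_le phi psi x : 0 <= psi x -> `|clamp phi psi x| <= psi x.
Proof.
move=> psi0; rewrite ler_norml /clamp le_max lexx orbT /= ge_max ge_min lexx orbT /=.
by lra.
Qed.

Lemma clamp_id phi psi x : `|phi x| <= psi x -> clamp phi psi x = phi x.
Proof.
rewrite ler_norml => /andP[h1 h2]; rewrite /clamp.
by rewrite (min_idPl h2); apply/max_idPl.
Qed.

Lemma measurable_clamp phi psi : measurable_fun setT (phi : RV R n -> R) ->
  measurable_fun setT (psi : RV R n -> R) ->
  measurable_fun setT (clamp phi psi : RV R n -> R).
Proof.
move=> mphi mpsi; apply: measurable_maxr; first exact: measurable_minr.
exact: measurableT_comp.
Qed.

(** By [clamp_dist] an increment of the clamp is dominated by one of the two increments, and the
    p-th power of a maximum is at most the sum of the p-th powers. The energy of [phi] keeps the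
    coefficient 1, as a sharp constant demands. *)
Lemma gagliardo_clamp (s p : R) phi psi : 1 < p ->
  measurable_fun setT (phi : RV R n -> R) ->
  measurable_fun setT (psi : RV R n -> R) ->
  (gagliardo_p s p (clamp phi psi) <= gagliardo_p s p phi + gagliardo_p s p psi)%E.
Proof.
move=> p1 mphi mpsi; have mc := measurable_clamp _ _ mphi mpsi.
have p0 : 0 <= p by rewrite ltW// (lt_trans _ p1).
have mE (f : 'rV[R]_n -> R) : measurable_fun setT (f : RV R n -> R) ->
    measurable_fun setT (fun z : RV R n * RV R n =>
      (`|increment f z| `^ p * kernel_weight s p z)%:E).
  by move=> mf; apply/measurable_EFinP; exact: measurable_gagliardo.
have E0 (f : 'rV[R]_n -> R) z : (0 <= (`|increment f z| `^ p * kernel_weight s p z)%:E)%E.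
  by rewrite lee_fin mulr_ge0 ?powR_ge0//; exact: kernel_weight_ge0.
rewrite (gagliardo_energy _ _ _ mc) (gagliardo_energy _ _ _ mphi) (gagliardo_energy _ _ _ mpsi).
rewrite /energy -(ge0_integralD _ measurableT (fun z _ => E0 phi z) (mE _ mphi)
  (fun z _ => E0 psi z) (mE _ mpsi)).
apply: ge0_le_integral => //.
- exact: mE.
- by apply: emeasurable_funD; exact: mE.
move=> z _; rewrite -EFinD lee_fin -mulrDl ler_wpM2r ?kernel_weight_ge0//.
apply: (@le_trans _ _ (Num.max `|increment phi z| `|increment psi z| `^ p)).
  apply: (ge0_ler_powR p0); last exact: clamp_dist.
    by rewrite nnegrE.
  by rewrite nnegrE le_max normr_ge0.
by case: (leP `|increment phi z| `|increment psi z|) => _;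
  rewrite ?lerDl ?lerDr powR_ge0.
Qed.

End clamp.

(* A quantitative form of smoothness: uniform bounds and uniform Taylor estimates
   are stable under products and pass through the convolution integral. *)
Fixpoint smooth_upto {R : realType} {n : nat} (m : nat) (f : 'rV[R]_n -> R) : Prop :=
  [/\ exists C : R, forall x, `|f x| <= C,
      exists C : R, forall x y, `|f x - f y| <= C * `|x - y| &
      if m is m'.+1 then
        exists df : 'I_n -> 'rV[R]_n -> R, (forall i, smooth_upto m' (df i)) /\
        exists C : R, forall x h,
          `|f (x + h) - f x - \sum_i h 0 i * df i x| <= C * `|h| ^+ 2
      else True].

Section smooth_upto.
Context {R : realType} {n : nat}.
Implicit Types f g : 'rV[R]_n -> R.

Lemma smooth_upto_bounded m f : smooth_upto m f -> exists2 C : R, 0 <= C & forall x, `|f x| <= C.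
Proof.
case: m => [|m] [[C Cf] _ _]; (exists C => //; exact: le_trans (Cf 0)).
Qed.

Lemma smooth_upto_lipschitz m f : smooth_upto m f ->
  exists2 C : R, 0 <= C & forall x y, `|f x - f y| <= C * `|x - y|.
Proof.
case: m => [|m] [_ [C Cf] _]; exists `|C| => // x y;
  by rewrite (le_trans (Cf _ _))// ler_wpM2r// ler_norm.
Qed.

Lemma smooth_upto_taylor m f : smooth_upto m.+1 f ->
  exists df : 'I_n -> 'rV[R]_n -> R, (forall i, smooth_upto m (df i)) /\
    exists2 C : R, 0 <= C & forall x h,
      `|f (x + h) - f x - \sum_i h 0 i * df i x| <= C * `|h| ^+ 2.
Proof.
move=> [_ _ [df [Sdf [C Cf]]]]; exists df; split => //; exists `|C| => // x h.
by rewrite (le_trans (Cf _ _))// ler_wpM2r ?sqr_ge0// ler_norm.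
Qed.

Lemma smooth_uptoW m f : smooth_upto m.+1 f -> smooth_upto m f.
Proof.
elim: m f => [|m IH] f /= [fb fl [df [Sdf fT]]]; split => //.
by exists df; split => // i; apply: IH.
Qed.

Lemma smooth_upto_cst m (c : R) : smooth_upto m (fun _ : 'rV[R]_n => c).
Proof.
elim: m c => [|m IH] c; split => //; try (by exists `|c|).
- by exists 0 => x y; rewrite subrr normr0 mul0r.
- by exists 0 => x y; rewrite subrr normr0 mul0r.
- exists (fun _ _ => 0); split; first by move=> i; exact: IH.
  exists 0 => x h; rewrite subrr sub0r normrN big1 ?normr0 ?mul0r// => i _.
  by rewrite mulr0.
Qed.

Lemma smooth_uptoD m f g : smooth_upto m f -> smooth_upto m g ->
  smooth_upto m (fun x => f x + g x).
Proof.
elim: m f g => [|m IH] f g Sf Sg.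
  all: have [Cf Cf0 fb] := smooth_upto_bounded _ _ Sf.
  all: have [Cg Cg0 gb] := smooth_upto_bounded _ _ Sg.
  all: have [Lf Lf0 fl] := smooth_upto_lipschitz _ _ Sf.
  all: have [Lg Lg0 gl] := smooth_upto_lipschitz _ _ Sg.
  all: split => //.
  1,3: by exists (Cf + Cg) => x; rewrite (le_trans (ler_normD _ _))// lerD.
  1,2: exists (Lf + Lg) => x y; rewrite opprD addrACA mulrDl;
    by rewrite (le_trans (ler_normD _ _))// lerD.
have [df [Sdf [Tf Tf0 fT]]] := smooth_upto_taylor _ _ Sf.
have [dg [Sdg [Tg Tg0 gT]]] := smooth_upto_taylor _ _ Sg.
exists (fun i x => df i x + dg i x); split; first by move=> i; exact: IH.
exists (Tf + Tg) => x h.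
under eq_bigr do rewrite mulrDr.
rewrite big_split /=.
set a := \sum_i _; set b := \sum_i _.
rewrite (_ : _ - _ - _ = (f (x + h) - f x - a) + (g (x + h) - g x - b)); last by ring.
by rewrite mulrDl (le_trans (ler_normD _ _))// lerD.
Qed.

Lemma sum_coord_le (v : 'I_n -> R) (h : 'rV[R]_n) :
  `|\sum_i h 0 i * v i| <= (\sum_i `|v i|) * `|h|.
Proof.
rewrite (le_trans (ler_norm_sum _ _ _))// mulr_suml; apply: ler_sum => i _.
rewrite normrM mulrC ler_wpM2l//.
rewrite [leRHS](_ : `|h| = mx_norm h)// mx_normrE; exact: (le_bigmax _ _ (0, i)).
Qed.

(** The Taylor remainder of f g is that of f times g(x + h), plus f(x) times that of g, plus the
    first-order term of f times g(x + h) - g(x); the last is quadratic in h because g is Lipschitz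
    and the derivatives of f are bounded. *)
Lemma smooth_uptoM m f g : smooth_upto m f -> smooth_upto m g ->
  smooth_upto m (fun x => f x * g x).
Proof.
elim: m f g => [|m IH] f g Sf Sg.
  all: have [Cf Cf0 fb] := smooth_upto_bounded _ _ Sf.
  all: have [Cg Cg0 gb] := smooth_upto_bounded _ _ Sg.
  all: have [Lf Lf0 fl] := smooth_upto_lipschitz _ _ Sf.
  all: have [Lg Lg0 gl] := smooth_upto_lipschitz _ _ Sg.
  all: split => //.
  1,3: by exists (Cf * Cg) => x; rewrite normrM ler_pM.
  1,2: exists (Lf * Cg + Cf * Lg) => x y;
    rewrite (_ : _ - _ = (f x - f y) * g x + f y * (g x - g y)); last by ring.
  1,2: rewrite (le_trans (ler_normD _ _))// !normrM mulrDl lerD//.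
  1,3: by rewrite mulrAC ler_pM.
  1,2: by rewrite -mulrA ler_pM.
have [df [Sdf [Tf Tf0 fT]]] := smooth_upto_taylor _ _ Sf.
have [dg [Sdg [Tg Tg0 gT]]] := smooth_upto_taylor _ _ Sg.
exists (fun i x => df i x * g x + f x * dg i x); split.
  by move=> i; apply: smooth_uptoD; apply: IH => //; exact: smooth_uptoW.
have [Df Df0 dfb] : exists2 C : R, 0 <= C & forall x, \sum_i `|df i x| <= C.
  have dfb i := cid2 (smooth_upto_bounded _ _ (Sdf i)).
  exists (\sum_i s2val (dfb i)); first by apply: sumr_ge0 => i _; exact: (s2valP (dfb i)).
  by move=> x; apply: ler_sum => i _; exact: (s2valP' (dfb i)).
exists (Tf * Cg + Cf * Tg + Df * Lg) => x h.
under eq_bigr do rewrite mulrDr.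
rewrite big_split /=.
rewrite (eq_bigr (fun i => (h 0 i * df i x) * g x)); last by move=> i _; rewrite mulrA.
rewrite [X in _ - (_ + X)](eq_bigr (fun i => (h 0 i * dg i x) * f x)); last first.
  by move=> i _; rewrite mulrCA mulrC.
rewrite -!mulr_suml.
have h2 := sum_coord_le (df ^~ x) h.
set a := \sum_i _ in h2 *; set b := \sum_i _.
have h1 := fT x h; have h3 := gT x h; rewrite -/a in h1; rewrite -/b in h3.
rewrite (_ : _ - _ - _ = (f (x + h) - f x - a) * g (x + h) +
  f x * (g (x + h) - g x - b) + a * (g (x + h) - g x)); last by ring.
rewrite [leRHS]mulrDl; apply: (le_trans (ler_normD _ _)); apply: lerD.
  rewrite [leRHS]mulrDl; apply: (le_trans (ler_normD _ _)); apply: lerD; rewrite normrM.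
    by rewrite mulrAC ler_pM.
  by rewrite -mulrA ler_pM.
rewrite normrM expr2 mulrACA ler_pM//.
  by rewrite (le_trans h2)// ler_wpM2r.
by rewrite (le_trans (gl _ _))// addrC addKr.
Qed.

Lemma smooth_upto_prod m (I : Type) (r : seq I) (F : I -> 'rV[R]_n -> R) :
  (forall i, smooth_upto m (F i)) -> smooth_upto m (fun x => \prod_(i <- r) F i x).
Proof.
move=> SF; elim: r => [|i r IH].
  by under eq_fun do rewrite big_nil; exact: smooth_upto_cst.
by under eq_fun do rewrite big_cons; exact: smooth_uptoM.
Qed.

End smooth_upto.

(* The derivatives of [flat 0], that is of [exp (- 1 / t)] extended by [0], are
   linear combinations of the [flat j]. *)
Definition flat {R : realType} (j : nat) (t : R) : R :=
  if 0 < t then t^-1 ^+ j * expR (- t^-1) else 0.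

Section flat.
Context {R : realType}.
Implicit Types t h x y : R.

Lemma flat_ge0 j t : 0 <= flat j t.
Proof.
rewrite /flat; case: ifPn => // t0.
by rewrite mulr_ge0 ?expR_ge0// exprn_ge0// invr_ge0 ltW.
Qed.

Lemma flat_npos j t : t <= 0 -> flat j t = 0.
Proof. by move=> t0; rewrite /flat ltNge t0. Qed.

Lemma flat_bounded j : exists2 C : R, 0 <= C & forall t, `|flat j t| <= C.
Proof.
(* With s = 1 / t, exp(s) = exp(s / j)^j >= (s / j)^j. For j = 0 the constant is 0^0 = 1. *)
exists (j%:R ^+ j) => [|t]; first by rewrite exprn_ge0.
rewrite ger0_norm ?flat_ge0// /flat; case: ifPn => t0; last by rewrite exprn_ge0.
have s0 : 0 < t^-1 by rewrite invr_gt0.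
rewrite expRN ler_pdivrMr ?expR_gt0//; move: (t^-1) s0 => s s0 {t0}.
case: j => [|j]; first by rewrite !expr0 mul1r ltW// -expR0 ltr_expR.
have -> : expR s = expR (s / j.+1%:R) ^+ j.+1.
  by rewrite -expRM_natl mulrC divfK// pnatr_eq0.
rewrite -exprMn; apply: lerXn2r; rewrite ?nnegrE ?(ltW s0)//.
rewrite mulrC -ler_pdivrMr ?ltr0n//.
by apply: le_trans (expR_ge1Dx _); rewrite lerDr.
Qed.

(** Trades a factor t for an index. As every [flat] is bounded, one or two applications give the
    linear and quadratic vanishing at 0 on which the estimates across 0 rest. *)
Lemma flatS j t : flat j t = t * flat j.+1 t.
Proof.
rewrite /flat; case: ifPn => [t0|]; last by rewrite mulr0.
by rewrite exprS !mulrA divff ?mul1r// gt_eqF.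
Qed.

Lemma flat_le_pos j : exists2 C : R, 0 <= C & forall t h, t <= 0 -> `|flat j (t + h)| <= C * `|h|.
Proof.
have [C C0 HC] := flat_bounded j.+1; exists C => // t h t0.
have [th|th] := leP (t + h) 0; first by rewrite flat_npos// normr0 mulr_ge0.
rewrite flatS normrM mulrC ler_pM// (gtr0_norm th).
by rewrite (le_trans _ (ler_norm _))//; lra.
Qed.

Definition dflat j t : R := - (j%:R * flat j.+1 t) + flat j.+2 t.

Lemma dflat_npos j t : t <= 0 -> dflat j t = 0.
Proof. by move=> t0; rewrite /dflat !flat_npos// mulr0 oppr0 addr0. Qed.

Lemma is_derive_flat_pos j x : 0 < x -> is_derive x (1 : R) (flat j) (dflat j x).
Proof.
move=> x0.
have D : is_derive x (1 : R) (fun t : R => t^-1 ^+ j * expR (- t^-1)) (dflat j x).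
  have xN0 : x != 0 by rewrite gt_eqF.
  have dV : is_derive x (1 : R) (fun t : R => t^-1) (- x ^- 2 *: 1) by exact: is_deriveV.
  have dX : is_derive x (1 : R) (fun t : R => t^-1 ^+ j) (j%:R * x^-1 ^+ j.-1 *: (- x ^- 2 *: 1)).
    rewrite (_ : (fun t : R => t^-1 ^+ j) = (fun t : R => t^-1) ^+ j); last by rewrite exprfctE.
    exact: is_deriveX.
  have dN : is_derive x (1 : R) (fun t : R => - t^-1) (- (- x ^- 2 *: 1)) by exact: is_deriveN.
  have dE : is_derive x (1 : R) (fun t : R => expR (- t^-1)) (expR (- x^-1) *: (- (- x ^- 2 *: 1))).
    exact: (@is_derive1_comp _ expR (fun t : R => - t^-1) x _ _ (is_derive_expR _) dN).
  apply: (is_derive_eq (is_deriveM dX dE)).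
  rewrite /dflat /flat x0 /GRing.scale /=.
  case: j {dX} => [|j] /=; rewrite !exprS ?expr0.
    by field.
  by field.
apply: near_eq_is_derive D.
near=> t; rewrite /flat ifT//; near: t; exact: lt_nbhsr.
Unshelve. all: by end_near. Qed.

Lemma dflat_bounded j : exists2 C : R, 0 <= C & forall t, `|dflat j t| <= C.
Proof.
have [C1 C10 H1] := flat_bounded j.+1; have [C2 C20 H2] := flat_bounded j.+2.
exists (j%:R * C1 + C2) => [|t]; first by rewrite addr_ge0// mulr_ge0.
rewrite (le_trans (ler_normD _ _))// lerD// normrN normrM ger0_norm//.
by rewrite ler_wpM2l.
Qed.

Lemma flat_mvt j x y : 0 < x -> 0 < y -> exists2 c, 0 < c /\ `|c - x| <= `|y - x| &
  flat j y - flat j x = dflat j c * (y - x).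
Proof.
move=> x0 y0.
have W a b : 0 < a -> a < b -> exists2 c, a < c < b & flat j b - flat j a = dflat j c * (b - a).
  move=> a0 ab.
  have [||c cab E] := @MVT R (flat j) (dflat j) a b ab.
  - by move=> t; rewrite in_itv /= => /andP[at_ _]; apply: is_derive_flat_pos; exact: lt_trans at_.
  - apply: derivable_within_continuous => t; rewrite in_itv /= => /andP[at_ _].
    by have [] := is_derive_flat_pos j t (lt_le_trans a0 at_).
  by exists c => //; move: cab; rewrite in_itv.
have [xy|yx|->] := ltgtP x y.
- have [c /andP[xc cy] E] := W x y x0 xy; exists c => //; split; first exact: lt_trans xc.
  by rewrite !ger0_norm; lra.
- have [c /andP[yc cx] E] := W y x y0 yx; exists c.
    split; first exact: lt_trans yc.
    by rewrite !ler0_norm; lra.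
  by rewrite -[LHS]opprB E; ring.
- by exists y; [rewrite !subrr|rewrite !subrr mulr0].
Qed.

Lemma flat_lipschitz j :
  exists2 C : R, 0 <= C & forall x y, `|flat j x - flat j y| <= C * `|x - y|.
Proof.
have [C1 C10 H1] := dflat_bounded j; have [C2 C20 H2] := flat_le_pos j.
exists (C1 + C2) => [|x y]; first by rewrite addr_ge0.
have [x0|x0] := leP x 0.
  rewrite (flat_npos _ _ x0) sub0r normrN (_ : y = x + (y - x)); last by ring.
  rewrite (le_trans (H2 _ _ x0))// distrC [in leRHS]opprD addrA subrr sub0r opprB distrC.
  by rewrite ler_wpM2r// lerDr.
have [y0|y0] := leP y 0.
  rewrite (flat_npos _ _ y0) subr0 -[in leLHS](subrKC y x).
  by rewrite (le_trans (H2 _ _ y0))// ler_wpM2r// lerDr.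
have [c _ ->] := flat_mvt j y x y0 x0.
by rewrite normrM ler_wpM2r// (le_trans (H1 c))// lerDl.
Qed.

Lemma dflat_lipschitz j :
  exists2 C : R, 0 <= C & forall x y, `|dflat j x - dflat j y| <= C * `|x - y|.
Proof.
have [C1 C10 H1] := flat_lipschitz j.+1; have [C2 C20 H2] := flat_lipschitz j.+2.
exists (j%:R * C1 + C2) => [|x y]; first by rewrite addr_ge0// mulr_ge0.
rewrite /dflat opprD addrACA -opprD -mulrBr mulrDl (le_trans (ler_normD _ _))//.
by rewrite lerD// normrN normrM ger0_norm// -mulrA ler_wpM2l.
Qed.

(** When t and t + h are both positive, the mean value theorem and the Lipschitz bound on [dflat]
    suffice. When they lie on opposite sides of 0, the positive one is at most |h|, while [flat j]
    is at most a multiple of its square and [dflat j] a multiple of it. *)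
Lemma flat_taylor j : exists2 C : R, 0 <= C & forall t h,
  `|flat j (t + h) - flat j t - h * dflat j t| <= C * h ^+ 2.
Proof.
have [C1 C10 H1] := dflat_lipschitz j.
have [C2 C20 H2] := flat_bounded j.+2.
exists (C1 + C2) => [|t h]; first by rewrite addr_ge0.
have sq (a b : R) : 0 <= a -> a <= `|b| -> a ^+ 2 <= b ^+ 2.
  move=> a0 ab; rewrite -(real_normK (num_real b)); apply: lerXn2r; rewrite ?nnegrE//.
have quad x : 0 <= x -> flat j x <= C2 * x ^+ 2.
  move=> x0; rewrite flatS flatS mulrA -expr2 mulrC ler_wpM2r ?sqr_ge0//.
  exact: le_trans (ler_norm _) (H2 _).
have [t0|t0] := leP t 0.
  rewrite (flat_npos j t t0) (dflat_npos j t t0) mulr0 !subr0.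
  have [th|th] := leP (t + h) 0.
    by rewrite flat_npos// normr0 mulr_ge0 ?sqr_ge0// addr_ge0.
  rewrite ger0_norm ?flat_ge0// (le_trans (quad _ (ltW th)))//.
  rewrite mulrDl; apply: ler_wpDl; first by rewrite mulr_ge0// sqr_ge0.
  rewrite ler_wpM2l//; apply: sq; first exact: ltW.
  by rewrite (le_trans _ (ler_norm _))//; lra.
have [th|th] := leP (t + h) 0.
  have ht : t <= `|h| by rewrite -normrN (le_trans _ (ler_norm _))//; lra.
  rewrite (flat_npos _ _ th) sub0r mulrDl -opprD normrN addrC.
  apply: (le_trans (ler_normD _ _)); apply: lerD.
    have := H1 t 0; rewrite (dflat_npos j 0 (lexx 0)) !subr0 => dt.
    rewrite normrM -(real_normK (num_real h)) expr2 mulrCA ler_wpM2l//.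
    by rewrite (le_trans dt)// ler_wpM2l// (gtr0_norm t0).
  rewrite ger0_norm ?flat_ge0// (le_trans (quad _ (ltW t0)))// ler_wpM2l//.
  by apply: sq => //; exact: ltW.
have [c [c0 ct] ->] := flat_mvt j t (t + h) t0 th.
have th' : t + h - t = h by rewrite addrC addKr.
rewrite th' in ct *; rewrite mulrC -mulrBr normrM -(real_normK (num_real h)) expr2 mulrCA.
rewrite ler_wpM2l// mulrDl; apply: ler_wpDr; first by rewrite mulr_ge0.
by rewrite (le_trans (H1 _ _))// ler_wpM2l.
Qed.

Lemma flat0_gt0 t : 0 < t -> 0 < flat 0 t.
Proof. by move=> t0; rewrite /flat t0 expr0 mul1r expR_gt0. Qed.

Lemma flat0_homo x y : x <= y -> flat 0 x <= flat 0 y.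
Proof.
move=> xy; have [x0|x0] := leP x 0; first by rewrite flat_npos// flat_ge0.
rewrite /flat x0 (lt_le_trans x0 xy) !expr0 !mul1r ler_expR lerN2.
by rewrite lef_pV2 ?posrE// (lt_le_trans x0 xy).
Qed.

End flat.

Lemma smooth_upto_flat (R : realType) (n m j : nat) (c a : R) (i : 'I_n) :
  smooth_upto m (fun x : 'rV[R]_n => flat j (c + a * x 0 i)).
Proof.
have coord_le (h : 'rV[R]_n) : `|h 0 i| <= `|h|.
  rewrite [leRHS](_ : `|h| = mx_norm h)// mx_normrE; exact: (le_bigmax _ _ (0, i)).
elim: m j => [|m IH] j; split => //.
1,3: by have [C _ HC] := flat_bounded (R := R) j; exists C.
1,2: have [C C0 HC] := flat_lipschitz (R := R) j; exists (C * `|a|) => x y.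
1,2: rewrite (le_trans (HC _ _))// opprD addrACA subrr add0r -mulrBr normrM mulrA;
  by rewrite ler_wpM2l ?mulr_ge0//; have := coord_le (x - y); rewrite !mxE.
exists (fun l x => (a * (l == i)%:R) * (- j%:R * flat j.+1 (c + a * x 0 i) + flat j.+2 (c + a * x 0 i))).
split.
  move=> l; apply: smooth_uptoM; first exact: smooth_upto_cst.
  apply: smooth_uptoD; last exact: IH.
  by apply: smooth_uptoM; [exact: smooth_upto_cst|exact: IH].
have [C C0 HC] := flat_taylor (R := R) j; exists (C * a ^+ 2) => x h.
rewrite (bigD1 i)//= big1 ?addr0 => [|l li]; last by rewrite (negbTE li) mulr0 mul0r mulr0.
rewrite eqxx mulr1 mxE mulrDr addrA mulNr -/(dflat j (c + a * x 0 i)).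
rewrite mulrA (mulrC _ a) (le_trans (HC _ _))// exprMn mulrA ler_wpM2l//.
  by rewrite mulr_ge0// sqr_ge0.
by rewrite -(real_normK (num_real (h 0 i))); apply: lerXn2r; rewrite ?nnegrE.
Qed.

Lemma taylor_differentiable (R : realType) (n : nat) (f : 'rV[R]_n -> R)
    (d : 'I_n -> R) (C : R) (x : 'rV[R]_n) : 0 <= C ->
  (forall h, `|f (x + h) - f x - \sum_i h 0 i * d i| <= C * `|h| ^+ 2) ->
  differentiable f x /\ forall i, derive f x (delta_mx 0 i) = d i.
Proof.
move=> C0 fT.
pose dl (h : 'rV[R]_n) : R := \sum_i h 0 i * d i.
have lindl : linear dl.
  move=> a u v; rewrite /dl scaler_sumr -big_split; apply: eq_bigr => i _ /=.
  by rewrite !mxE mulrDl -[a *: _]/(a * _) mulrA.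
pose dlL : {linear 'rV[R]_n -> R} := HB.pack dl (GRing.isLinear.Build _ _ _ _ _ lindl).
have cdl : continuous dlL.
  apply: (lipschitz_continuous _ (\sum_i `|d i|)) => u v.
  rewrite -raddfB; exact: sum_coord_le.
have fE : f \o shift x = cst (f x) + dlL +o_ (0 : 'rV[R]_n) id.
  apply/eqaddoP => e e0; apply/nbhs_ballP.
  exists (e / (C + 1)) => /=; first by rewrite divr_gt0// ltr_wpDl.
  move=> h; rewrite mx_norm_ball /ball_ /= sub0r normrN => he.
  rewrite !fctE /= opprD addrA [h + x]addrC (le_trans (fT h))//.
  rewrite expr2 mulrA ler_wpM2r//.
  rewrite (@le_trans _ _ ((C + 1) * `|h|))//; first by rewrite ler_wpM2r// lerDl.
  by rewrite mulrC -ler_pdivlMr ?ltW// ltr_wpDl.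
have dE := diff_unique cdl fE.
have df : differentiable f x by apply/diff_locallyP; rewrite dE.
split => // i; rewrite deriveE// dE /= /dl (bigD1 i)//= big1 => [|j ji].
  by rewrite mxE !eqxx mul1r addr0.
by rewrite mxE (negbTE ji) andbF mul0r.
Qed.

(** * Convolution of a bounded function of bounded support with a smooth kernel *)

Section convolution.
Context {R : realType} {n : nat}.
Variables (f : 'rV[R]_n -> R) (M r : R).
Hypotheses (mf : measurable_fun setT (f : RV R n -> R)) (r0 : 0 <= r)
  (fM : forall x, `|f x| <= M) (fr : forall x, f x != 0 -> `|x| <= r).
Implicit Types g k : 'rV[R]_n -> R.

Let M0 : 0 <= M. Proof. exact: le_trans (fM 0). Qed.

(** Bounds the L^1 norm of [f], which is at most [M] in absolute value and vanishes outside a cube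
    of half-side [r]. *)
Let V : R := M * (r *+ 2) ^+ n.

Let V0 : 0 <= V. Proof. by rewrite mulr_ge0// exprn_ge0// mulrn_wge0. Qed.

Definition bounded_measurable g :=
  measurable_fun setT (g : RV R n -> R) /\ exists C, forall z, `|g z| <= C.

Let B := box R n r.

Let dominating (C : R) (z : RV R n) : R := M * C * \1_B z.

Let le_dominating g C z : (forall z, `|g z| <= C) -> `|f z * g z| <= dominating C z.
Proof.
move=> gC; rewrite /dominating normrM indicE.
have [_|zB] := boolP (z \in B); first by rewrite mulr1 ler_pM.
have [->|/fr zr] := eqVneq (f z) 0; first by rewrite normr0 mul0r mulr0.
by move/negP : zB => []; rewrite inE; exact: mem_box.
Qed.

Let dominating_integrable C : (lam R n).-integrable setT (EFin \o dominating C).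
Proof.
have mB : measurable B := measurable_box R n r.
have iB : (lam R n).-integrable setT (fun z => (\1_B z)%:E).
  apply/integrableP; split; first by apply/measurable_EFinP; exact: measurable_indic.
  under eq_integral do rewrite gee0_abs ?lee_fin//.
  by rewrite integral_indic// setIT [X in (X < _)%E](lam_box R n r r0) ltry.
exact: (integrableZl measurableT (M * C) iB).
Qed.

Lemma weighted_integrable g : bounded_measurable g ->
  (lam R n).-integrable setT (EFin \o (fun z => f z * g z)).
Proof.
move=> [mg [C gC]]; apply: (le_integrable measurableT _ _ (dominating_integrable C)).
  by apply/measurable_EFinP; exact: measurable_funM.
move=> z _; rewrite lee_fin (le_trans (le_dominating _ _ z gC))//; exact: ler_norm.
Qed.

Definition weighted g : R := \int[lam R n]_z (f z * g z).

Lemma weighted_le g C : bounded_measurable g -> (forall z, `|g z| <= C) ->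
  `|weighted g| <= V * C.
Proof.
move=> bg gC; have ig := weighted_integrable _ bg.
apply: (le_trans (le_normr_Rintegral measurableT ig)).
apply: (@le_trans _ _ (\int[lam R n]_z (dominating C z))).
  apply: le_Rintegral => //.
  - exact: (integrable_norm ig).
  - by move=> z _; exact: le_dominating.
have mB : measurable B := measurable_box R n r.
rewrite /Rintegral (_ : (\int[lam R n]_z (dominating C z)%:E)%E = (V * C)%:E)//.
under eq_integral do rewrite /dominating EFinM.
rewrite ge0_integralZl//; last 2 first.
- by apply/measurable_EFinP; exact: measurable_indic.
- by rewrite lee_fin mulr_ge0// (le_trans _ (gC 0)).
rewrite integral_indic// setIT [X in (_ * X)%E](lam_box R n r r0) -EFinM /V.
by congr EFin; ring.
Qed.

Lemma bounded_measurable_sum (I : Type) (s : seq I) (h : I -> R) (g : I -> 'rV[R]_n -> R) :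
  (forall i, bounded_measurable (g i)) ->
  bounded_measurable (fun z => \sum_(i <- s) h i * g i z).
Proof.
move=> bg; split.
  by apply: measurable_sum => i; apply: measurable_funM => //; have [] := bg i.
elim: s => [|i s [C HC]]; first by exists 0 => z; rewrite big_nil normr0.
have [_ [C' HC']] := bg i; exists (`|h i| * C' + C) => z.
by rewrite big_cons (le_trans (ler_normD _ _))// lerD// normrM ler_wpM2l.
Qed.

Lemma weighted_sum (I : Type) (s : seq I) (h : I -> R) (g : I -> 'rV[R]_n -> R) :
  (forall i, bounded_measurable (g i)) ->
  weighted (fun z => \sum_(i <- s) h i * g i z) = \sum_(i <- s) h i * weighted (g i).
Proof.
move=> bg; elim: s => [|i s IH].
  rewrite big_nil /weighted; under eq_Rintegral do rewrite big_nil mulr0.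
  by rewrite Rintegral_cst// mul0r.
rewrite big_cons -IH -RintegralZl//; last exact: weighted_integrable.
rewrite -RintegralD//; last 2 first.
- have := integrableZl measurableT (h i) (weighted_integrable _ (bg i)); exact.
- by apply: weighted_integrable; exact: bounded_measurable_sum.
by apply: eq_Rintegral => z _; rewrite big_cons; ring.
Qed.

Lemma weightedB g1 g2 : bounded_measurable g1 -> bounded_measurable g2 ->
  weighted (fun z => g1 z - g2 z) = weighted g1 - weighted g2.
Proof.
move=> b1 b2; rewrite -RintegralB//; [|exact: weighted_integrable|exact: weighted_integrable].
by apply: eq_Rintegral => z _; rewrite mulrBr.
Qed.

Lemma bounded_measurableB g1 g2 : bounded_measurable g1 -> bounded_measurable g2 ->
  bounded_measurable (fun z => g1 z - g2 z).
Proof.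
move=> [m1 [C1 H1]] [m2 [C2 H2]]; split; first exact: measurable_funB.
by exists (C1 + C2) => z; rewrite (le_trans (ler_normB _ _))// lerD.
Qed.

Definition conv k (x : 'rV[R]_n) : R := weighted (fun z => k (x - z)).

Lemma bounded_measurable_reflect m k x : smooth_upto m k ->
  bounded_measurable (fun z => k (x - z)).
Proof.
move=> Sk; have [C _ HC] := smooth_upto_bounded _ _ Sk; split; last by exists C.
apply: continuous_measurable_rv.
have [L L0 HL] := smooth_upto_lipschitz _ _ Sk; apply: (lipschitz_continuous _ L) => u v.
by rewrite (le_trans (HL _ _))// opprD opprK addrACA subrr add0r addrC distrC.
Qed.

Lemma conv_lipschitz m k : smooth_upto m k ->
  exists2 L, 0 <= L & forall x y, `|conv k x - conv k y| <= L * `|x - y|.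
Proof.
move=> Sk; have [L L0 HL] := smooth_upto_lipschitz _ _ Sk.
have bk x := bounded_measurable_reflect _ _ x Sk.
exists (V * L) => [|x y]; first exact: mulr_ge0.
rewrite /conv -weightedB// -mulrA; apply: weighted_le; first exact: bounded_measurableB.
by move=> z; rewrite (le_trans (HL _ _))// opprD opprK addrACA addNr addr0.
Qed.

(** By linearity the Taylor remainder of the convolution at x is the integral of f(z) times the
    remainder of [k] at x - z, so the uniform bound passes through with the factor [V]. Partial
    derivatives are thus convolutions with the derivatives of [k], without differentiation under the
    integral sign. *)
Lemma Ck_conv m k : smooth_upto m k -> Ck m (conv k).
Proof.
elim: m k => [|m IH] k Sk.
  by have [L _ HL] := conv_lipschitz _ _ Sk; exact: lipschitz_continuous HL.
have [dk [Sdk [C C0 kT]]] := smooth_upto_taylor _ _ Sk.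
have bk x := bounded_measurable_reflect _ _ x Sk.
have bdk i x := bounded_measurable_reflect _ _ x (Sdk i).
have T x : differentiable (conv k) x /\
    forall i, derive (conv k) x (delta_mx 0 i) = conv (dk i) x.
  apply: (taylor_differentiable _ _ _ _ (V * C)); first exact: mulr_ge0.
  move=> h; rewrite /conv -weightedB// -weighted_sum// -weightedB; last 2 first.
  - exact: bounded_measurableB.
  - exact: bounded_measurable_sum.
  rewrite -mulrA; apply: weighted_le.
    by apply: bounded_measurableB; [exact: bounded_measurableB|exact: bounded_measurable_sum].
  by move=> z; rewrite (addrAC x h); exact: kT.
split => [x|i]; first by have [] := T x.
rewrite (_ : (fun x => _) = conv (dk i)); first exact: IH.
by apply/funext => x; have [_ ->] := T x.
Qed.

Lemma conv_support k d : (forall y, k y != 0 -> `|y| <= d) ->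
  forall x, conv k x != 0 -> `|x| <= r + d.
Proof.
move=> kd x; apply: contraR; rewrite -ltNge => xrd; apply/eqP.
rewrite /conv /weighted (@eq_Rintegral _ _ _ _ _ (fun=> 0)); first by rewrite Rintegral_cst// mul0r.
move=> z _; have [->|/fr zr] := eqVneq (f z) 0; first by rewrite mul0r.
have [->|/kd xz] := eqVneq (k (x - z)) 0; first by rewrite mulr0.
move: xrd; rewrite ltNge => /negP[]; rewrite -(subrK z x) addrC.
by rewrite (le_trans (ler_normD _ _))// lerD.
Qed.

Lemma Cinf0_conv k d : (forall m, smooth_upto m k) ->
  (forall y, k y != 0 -> `|y| <= d) -> Cinf0 (conv k).
Proof.
move=> Sk kd; split; first by move=> m; exact: Ck_conv.
apply: bounded_closed_compact; last exact: closed_closure.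
have clball : closed [set x : 'rV[R]_n | `|x| <= r + d].
  have := @closed_comp _ _ (fun x : 'rV[R]_n => `|x|) [set t : R | t <= r + d].
  apply; last exact: closed_le.
  by move=> x _; exact: norm_continuous.
exists (r + d); split; first exact: num_real.
move=> c rdc x xcl; apply: le_trans (ltW rdc).
have : closure [set x : 'rV[R]_n | `|x| <= r + d] x.
  by move: xcl; apply: closure_subset => y /=; exact: conv_support.
by rewrite -(closure_id _).1.
Qed.

End convolution.

(** Positive exactly on the open cube of half-side [d]. The arguments have the form c + a x_i of
    [smooth_upto_flat]. *)
Definition bump {R : realType} {n : nat} (d : R) (x : 'rV[R]_n) : R :=
  \prod_(i < n) (flat 0 (d + 1 * x 0 i) * flat 0 (d + (-1) * x 0 i)).

Section bump.
Context {R : realType} {n : nat} (d : R).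
Hypothesis d0 : 0 < d.
Implicit Types x : 'rV[R]_n.

Lemma bump_smooth m : smooth_upto m (@bump R n d).
Proof.
apply: smooth_upto_prod => i; apply: smooth_uptoM; exact: smooth_upto_flat.
Qed.

Lemma bump_ge0 x : 0 <= bump d x.
Proof. by apply: prodr_ge0 => i _; rewrite mulr_ge0// flat_ge0. Qed.

Lemma bumpN x : bump d (- x) = bump d x.
Proof.
apply: eq_bigr => i _; rewrite mxE mulrC; congr (flat 0 _ * flat 0 _); ring.
Qed.

Lemma norm_le_coord x (r : R) : 0 <= r -> (forall i, `|x 0 i| <= r) -> `|x| <= r.
Proof.
move=> r0 xr; rewrite (_ : `|x| = mx_norm x)// mx_normrE.
by apply/bigmax_leP; split => // -[i j] _ /=; rewrite (ord1 i).
Qed.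

Lemma bump_support x : bump d x != 0 -> `|x| <= d.
Proof.
move=> bx; apply: norm_le_coord => [|i]; first exact: ltW.
move: bx; rewrite /bump (bigD1 i)//= !mulf_eq0 !negb_or => /andP[/andP[h1 h2] _].
have {}h1 : 0 < d + 1 * x 0 i.
  by rewrite ltNge; apply: contra h1 => /flat_npos ->.
have {}h2 : 0 < d + (-1) * x 0 i.
  by rewrite ltNge; apply: contra h2 => /flat_npos ->.
by rewrite ler_norml; apply/andP; split; lra.
Qed.

Lemma bump_lower x : `|x| <= d / 2 -> (flat 0 (d / 2) * flat 0 (d / 2)) ^+ n <= bump d x.
Proof.
move=> xd; rewrite -[X in _ ^+ X]card_ord -prodr_const; apply: ler_prod => i _.
rewrite mulr_ge0 ?flat_ge0//=.
have : `|x 0 i| <= d / 2.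
  apply: le_trans xd; rewrite [leRHS](_ : `|x| = mx_norm x)// mx_normrE.
  exact: (le_bigmax _ _ (0, i)).
rewrite ler_norml => /andP[h1 h2].
by apply: ler_pM; rewrite ?flat_ge0//; apply: flat0_homo; lra.
Qed.

End bump.

Lemma measurable_smooth (R : realType) (n m : nat) (k : 'rV[R]_n -> R) :
  smooth_upto m k -> measurable_fun setT (k : RV R n -> R).
Proof.
move=> Sk; have [L _ HL] := smooth_upto_lipschitz _ _ Sk.
by apply: continuous_measurable_rv; exact: lipschitz_continuous HL.
Qed.

(** [bump] divided by its integral, which is finite since [bump] is bounded with bounded support,
    and positive by [bump_lower]. Evenness is recorded because it turns the convolution into an
    average of translates. *)
Lemma mollifier_exists (R : realType) (n : nat) (d : R) : 0 < d ->
  exists rho : 'rV[R]_n -> R,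
    [/\ forall m, smooth_upto m rho, forall x, 0 <= rho x,
        forall x, rho x != 0 -> `|x| <= d,
        forall x, rho (- x) = rho x &
        (\int[lam R n]_z (rho z)%:E = 1)%E].
Proof.
move=> d0; pose I := (\int[lam R n]_z (bump d z)%:E)%E.
have mb : measurable_fun setT (bump d : RV R n -> R) := measurable_smooth _ _ 0 _ (bump_smooth d 0).
have [C C0 bC] := smooth_upto_bounded _ _ (bump_smooth (n := n) d 0).
have mB r := measurable_box R n r.
have cst_box (c r : R) : 0 <= c -> 0 <= r ->
    (\int[lam R n]_z (c * \1_(box R n r) z)%:E = (c * (r *+ 2) ^+ n)%:E)%E.
  move=> c0 r0; under eq_integral do rewrite EFinM.
  rewrite ge0_integralZl//; last by apply/measurable_EFinP; exact: measurable_indic.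
  by rewrite integral_indic// setIT [X in (_ * X)%E](lam_box R n r r0) -EFinM.
have mIB c r : measurable_fun setT (fun z : RV R n => (c * \1_(box R n r) z)%:E).
  by apply/measurable_EFinP; apply: measurable_funM => //; exact: measurable_indic.
have Ioo : (I < +oo)%E.
  apply: (@le_lt_trans _ _ (\int[lam R n]_z (C * \1_(box R n d) z)%:E)%E); last first.
    by rewrite cst_box ?ltry// ltW.
  apply: ge0_le_integral => //.
  - by move=> z _; rewrite lee_fin bump_ge0.
  - exact/measurable_EFinP.
  move=> z _; rewrite lee_fin indicE.
  have [_|zB] := boolP (z \in box R n d); first by rewrite mulr1 (le_trans (ler_norm _)).
  rewrite mulr0 le_eqVlt; apply/orP; left; apply: contraNT zB => /(bump_support d d0 _) zd.
  by rewrite inE; exact: mem_box.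
pose c := (flat 0 (d / 2) * flat 0 (d / 2)) ^+ n.
have d2 : 0 < d / 2 by rewrite divr_gt0.
have c0 : 0 < c by rewrite exprn_gt0// mulr_gt0// flat0_gt0.
have I0 : (0 < I)%E.
  apply: (@lt_le_trans _ _ (\int[lam R n]_z (c * \1_(box R n (d / 2)) z)%:E)%E).
    by rewrite cst_box ?ltW// lte_fin mulr_gt0// exprn_gt0// mulrn_wgt0.
  apply: ge0_le_integral => //.
  - by move=> z _; rewrite lee_fin mulr_ge0// ltW.
  - exact/measurable_EFinP.
  move=> z _; rewrite lee_fin indicE.
  have [zB|zB] := boolP (z \in box R n (d / 2)); last by rewrite mulr0 bump_ge0.
  rewrite mulr1; apply: bump_lower; apply: norm_le_coord; first exact: ltW.
  by move=> i; move: zB; rewrite inE => /(_ i); rewrite in_itv /= -ler_norml.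
have If : I \is a fin_num by rewrite ge0_fin_numE// ltW.
have fI0 : 0 < fine I by rewrite fine_gt0// I0.
exists (fun x => (fine I)^-1 * bump d x); split.
- by move=> m; apply: smooth_uptoM; [exact: smooth_upto_cst|exact: bump_smooth].
- by move=> x; rewrite mulr_ge0 ?bump_ge0// invr_ge0 ltW.
- by move=> x; rewrite mulf_eq0 negb_or => /andP[_ /(bump_support d d0 _)].
- by move=> x; rewrite bumpN.
under eq_integral do rewrite EFinM.
rewrite ge0_integralZl//; last 3 first.
- exact/measurable_EFinP.
- by move=> z _; rewrite lee_fin bump_ge0.
- by rewrite lee_fin invr_ge0 ltW.
by rewrite -/I -(fineK If) -EFinM mulVf// gt_eqF.
Qed.

(** * Mollification by an even probability density *)

Lemma Rintegral_lam_shift (R : realType) (n : nat) (c : 'rV[R]_n) (F : RV R n -> R) :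
  measurable_fun setT F ->
  \int[lam R n]_z F ((z : 'rV[R]_n) + c) = \int[lam R n]_z F z.
Proof.
move=> mF; have mFE : measurable_fun setT (EFin \o F) by exact/measurable_EFinP.
rewrite /Rintegral [in LHS]integralE [in RHS]integralE.
have pos := integral_lam_shift R n c _ (measurable_funepos mFE) (funepos_ge0 _).
have neg := integral_lam_shift R n c _ (measurable_funeneg mFE) (funeneg_ge0 _).
rewrite -pos -neg; congr (fine (_ - _)%E); apply: eq_integral => z _;
  by rewrite ?funeposE ?funenegE.
Qed.

Lemma measurable_addr_rv (R : realType) (n : nat) :
  measurable_fun setT (fun z : RV R n * RV R n =>
    (z.1 : 'rV[R]_n) + (z.2 : 'rV[R]_n) : RV R n).
Proof.
apply: measurable_rvP => i; rewrite (_ : (fun x => _) = (fun z : RV R n * RV R n =>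
    (z.1 : 'rV[R]_n) 0 i + (z.2 : 'rV[R]_n) 0 i)); last first.
  by apply/funext => z; rewrite !mxE.
apply: measurable_funD.
  exact: measurableT_comp (measurable_coord R n i) measurable_fst.
exact: measurableT_comp (measurable_coord R n i) measurable_snd.
Qed.

Section mollification.
Context {R : realType} {n : nat}.
Variables (f : 'rV[R]_n -> R) (M r : R) (rho : 'rV[R]_n -> R) (d : R).
Hypotheses (mf : measurable_fun setT (f : RV R n -> R)) (r0 : 0 <= r)
  (fM : forall x, `|f x| <= M) (fr : forall x, f x != 0 -> `|x| <= r).
Hypotheses (d0 : 0 <= d) (Srho : forall m, smooth_upto m rho)
  (rho0 : forall x, 0 <= rho x) (rhod : forall x, rho x != 0 -> `|x| <= d)
  (rhoN : forall x, rho (- x) = rho x) (rho1 : (\int[lam R n]_z (rho z)%:E = 1)%E).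

Let mrho : measurable_fun setT (rho : RV R n -> R) := measurable_smooth _ _ _ _ (Srho 0).

Let K : R := s2val (cid2 (smooth_upto_bounded _ _ (Srho 0))).

Let rhoK x : `|rho x| <= K.
Proof. exact: (s2valP' (cid2 (smooth_upto_bounded _ _ (Srho 0)))). Qed.

Let weightedI g (bg : bounded_measurable g) := weighted_integrable rho K d mrho d0 rhoK rhod g bg.

Let bm_cst (c : R) : bounded_measurable (fun _ : 'rV[R]_n => c).
Proof. by split; [exact: measurable_cst|exists `|c|]. Qed.

Let bm_shift x : bounded_measurable (fun z => f (x + z)).
Proof.
split; last by exists M.
have := measurableT_comp mf (measurable_shift_rv R n x); congr measurable_fun.
by apply/funext => z /=; rewrite addrC.
Qed.

(** The mollifier is now the weight, whereas [f] was the weight in the proof of smoothness. Its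
    total mass 1 lets constants pass through. *)
Lemma weighted_affine (c0 c1 : R) g : bounded_measurable g ->
  weighted rho (fun z => c0 + c1 * g z) = c0 + c1 * weighted rho g.
Proof.
move=> bg; have i1 := weightedI _ (bm_cst 1); have ig := weightedI _ bg.
have W1 : weighted rho (fun=> 1) = 1.
  by rewrite /weighted /Rintegral; under eq_integral do rewrite mulr1; rewrite rho1.
rewrite -[c0 in RHS]mulr1 -[in RHS]W1 -!RintegralZl// -RintegralD//.
- by apply: eq_Rintegral => z _; ring.
- exact: (integrableZl measurableT c0 i1).
- exact: (integrableZl measurableT c1 ig).
Qed.

Lemma weighted_homo g1 g2 : bounded_measurable g1 -> bounded_measurable g2 ->
  (forall z, rho z != 0 -> g1 z <= g2 z) -> weighted rho g1 <= weighted rho g2.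
Proof.
move=> b1 b2 g12; apply: le_Rintegral => //; [exact: weightedI|exact: weightedI|].
move=> z _; have [->|/g12 gz] := eqVneq (rho z) 0; first by rewrite !mul0r.
by rewrite ler_wpM2l.
Qed.

(** The tangent of |t|^p at the mean [a] of [g] lies below |g|^p; on integration against [rho] its
    linear term drops out. *)
Lemma weighted_jensen (p : R) g : 1 < p -> bounded_measurable g ->
  bounded_measurable (fun z => `|g z| `^ p) ->
  `|weighted rho g| `^ p <= weighted rho (fun z => `|g z| `^ p).
Proof.
move=> p1 bg bgp; set a := weighted rho g.
have -> : `|a| `^ p = weighted rho (fun z => (`|a| `^ p - p * Jp p a * a) + (p * Jp p a) * g z).
  by rewrite weighted_affine// -/a; ring.
apply: weighted_homo => //.
  split; first by apply: measurable_funD => //; apply: measurable_funM => //; case: bg.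
  have [_ [C HC]] := bg; exists (`|(`|a| `^ p - p * Jp p a * a : R)| + `|p * Jp p a| * C) => z.
  by rewrite (le_trans (ler_normD _ _))// lerD// normrM ler_wpM2l.
by move=> z _; have := powR_tangent p p1 a (g z); apply: le_trans; lra.
Qed.

(** Translating the variable by x moves the shift onto [f] and leaves rho(- z), which is rho(z). *)
Lemma convE x : conv f rho x = weighted rho (fun z => f (x + z)).
Proof.
rewrite /conv /weighted -(Rintegral_lam_shift R n x); last first.
  apply: measurable_funM => //.
  by have [] := bounded_measurable_reflect _ _ x (Srho 0).
apply: eq_Rintegral => z _; rewrite mulrC; congr (_ * _); last by rewrite addrC.
by rewrite opprD addrCA subrr addr0 rhoN.
Qed.

Lemma conv_close x (e : R) : (forall z, `|z| <= d -> `|f (x + z) - f x| <= e) ->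
  `|conv f rho x - f x| <= e.
Proof.
move=> fe; have bx := bm_shift x.
have <- : weighted rho (fun z => - f x + 1 * f (x + z)) = conv f rho x - f x.
  by rewrite weighted_affine// convE; ring.
have bd : bounded_measurable (fun z => - f x + 1 * f (x + z)).
  have [m1 _] := bx; split; first by apply: measurable_funD => //; apply: measurable_funM.
  exists (M + M) => z; rewrite mul1r addrC (le_trans (ler_normB _ _))//.
  by rewrite lerD.
have cstE c : weighted rho (fun=> c) = c.
  transitivity (weighted rho (fun z => c + 0 * 0)).
    by congr weighted; apply/funext => z; rewrite mul0r addr0.
  by rewrite (weighted_affine c 0 (fun=> 0) (bm_cst 0)) mul0r addr0.
rewrite ler_norml -{1}(cstE (- e)) -{2}(cstE e); apply/andP; split;
  apply: weighted_homo => // z /rhod /fe; rewrite mul1r addrC ler_norml => /andP[]//.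
Qed.

(** Jensen bounds the energy of the mollified function by the average over z of the energies of the
    translates f(. + z), and these all equal that of [f]. *)
Lemma gagliardo_conv (s p : R) : 1 < p ->
  (gagliardo_p s p (conv f rho) <= gagliardo_p s p f)%E.
Proof.
move=> p1; have p0 : 0 <= p by rewrite ltW// (lt_trans _ p1).
have [L L0 HL] := conv_lipschitz f M r mf r0 fM fr _ _ (Srho 0).
have mc := continuous_measurable_rv _ _ _ (lipschitz_continuous _ _ HL).
pose w := kernel_weight (n := n) s p.
have w0 : forall z, 0 <= w z by exact: kernel_weight_ge0.
have mw : measurable_fun setT w := measurable_kernel_weight s p.
(* The product measure in the pair (x, y), packed as a sigma-finite measure so that Tonelli can
   exchange that pair with z. *)
have [nu nuE] := sigma_finite_pushforward_prod R _ _ _ _ _ _ (lam R n) (lam R n)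
  _ _ (@measurable_id _ (RV R n * RV R n)%type setT) (@measurable_id _ (RV R n * RV R n)%type setT) (fun=> erefl).
have gagE (g : 'rV[R]_n -> R) : measurable_fun setT (g : RV R n -> R) ->
    gagliardo_p s p g = (\int[nu]_t (`|increment g t| `^ p * w t)%:E)%E.
  move=> mg; rewrite nuE; last 2 first.
  - by apply/measurable_EFinP; exact: measurable_gagliardo.
  - by move=> t; rewrite lee_fin mulr_ge0// powR_ge0.
  apply: iint2_nonneg_iter; first exact: (measurable_gagliardo R n p _ g mg).
  by move=> x y; rewrite divr_ge0 ?powR_ge0.
pose F (t : (RV R n * RV R n) * RV R n) : R :=
  rho t.2 * `|f ((t.1.1 : 'rV[R]_n) + t.2) - f ((t.1.2 : 'rV[R]_n) + t.2)| `^ p * w t.1.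
have mF : measurable_fun setT (fun t => (F t)%:E).
  apply/measurable_EFinP; apply: measurable_funM; last exact: measurableT_comp mw measurable_fst.
  apply: measurable_funM; first exact: measurableT_comp mrho measurable_snd.
  apply: measurable_powR_norm; apply: measurable_funB.
    have := measurableT_comp mf (measurableT_comp (measurable_addr_rv R n)
      (measurable_fun_pair (measurableT_comp (@measurable_fst _ _ (RV R n) (RV R n))
         (@measurable_fst _ _ (RV R n * RV R n)%type (RV R n))) (@measurable_snd _ _ (RV R n * RV R n)%type (RV R n)))).
    exact.
  have := measurableT_comp mf (measurableT_comp (measurable_addr_rv R n)
      (measurable_fun_pair (measurableT_comp (@measurable_snd _ _ (RV R n) (RV R n))
         (@measurable_fst _ _ (RV R n * RV R n)%type (RV R n))) (@measurable_snd _ _ (RV R n * RV R n)%type (RV R n)))).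
  exact.
have F0 t : (0 <= (F t)%:E)%E by rewrite lee_fin !mulr_ge0// powR_ge0.
rewrite (gagE _ mc).
apply: (@le_trans _ _ (\int[nu]_t \int[lam R n]_z (F (t, z))%:E)%E).
  apply: ge0_le_integral => //.
  - by move=> t _; rewrite lee_fin mulr_ge0// powR_ge0.
  - by apply/measurable_EFinP; exact: measurable_gagliardo.
  - exact: (measurable_fun_fubini_tonelli_F (m2 := lam R n) _ mF F0).
  move=> [x y] _.
  pose g z := f (x + z) - f (y + z).
  have bg : bounded_measurable g by apply: bounded_measurableB; exact: bm_shift.
  have bgp : bounded_measurable (fun z => `|g z| `^ p).
    have [mg [C HC]] := bg; split; first exact: measurable_powR_norm.
    exists (`|C| `^ p) => z; rewrite ger0_norm ?powR_ge0//.
    by apply: (ge0_ler_powR p0); rewrite ?nnegrE// (le_trans (HC z))// ler_norm.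
  have igp := weightedI _ bgp.
  have incE : increment (conv f rho) (x, y) = weighted rho g.
    rewrite /increment /= !convE.
    by rewrite -(weightedB rho K d mrho d0 rhoK rhod).
  apply: (@le_trans _ _ ((weighted rho (fun z => `|g z| `^ p))%:E * (w (x, y))%:E)%E).
    by rewrite -EFinM lee_fin ler_wpM2r// incE; exact: weighted_jensen.
  rewrite /weighted /Rintegral fineK; last exact: (integrable_fin_num measurableT igp).
  rewrite -ge0_integralZr//.
  - by case/integrableP : igp.
  - by move=> z _; rewrite lee_fin mulr_ge0// powR_ge0.
  - by rewrite lee_fin.
rewrite (fubini_tonelli (m1 := nu) (m2 := lam R n) _ mF F0).
(* Translation invariance, as the case of a similarity of ratio 1 with trivial reflection. *)
have fz z : gagliardo_p s p (fun x : 'rV[R]_n => f (x + z)) = gagliardo_p s p f.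
  have := gagliardo_similarity R n s p 1 0 0 z f ltr01 mf.
  rewrite powR1 mul1e => <-; congr gagliardo_p; apply/funext => x.
  by rewrite scale1r /householder scaler0 !subr0.
have mfz (z : 'rV[R]_n) : measurable_fun setT (fun x : RV R n => f ((x : 'rV[R]_n) + z)).
  exact: (measurableT_comp mf (measurable_shift_rv R n z)).
have g0 : (0 <= gagliardo_p s p f)%E.
  by rewrite gagE//; apply: integral_ge0 => t _; rewrite lee_fin mulr_ge0// powR_ge0.
under eq_integral => z _.
  rewrite (_ : (\int[nu]_t _)%E = ((rho z)%:E * gagliardo_p s p f)%E); first over.
  rewrite -(fz z) (gagE _ (mfz z)) -ge0_integralZl//.
  - by apply: eq_integral => t _; rewrite -EFinM mulrA.
  - by apply/measurable_EFinP; exact: (measurable_gagliardo R n p _ _ (mfz z)).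
  - by move=> t _; rewrite lee_fin mulr_ge0// powR_ge0.
  - by rewrite lee_fin.
rewrite ge0_integralZr//; first by rewrite rho1 mul1e.
- exact/measurable_EFinP.
- by move=> z _; rewrite lee_fin.
Qed.

End mollification.

(** * The inequality for the best constant, on the whole space *)

Lemma holder_semiZ_le (R : realType) (n : nat) (al a : R) (phi : 'rV[R]_n -> R) : 0 < a ->
  (holder_semi al (fun x => a * phi x)%R <= a%:E * holder_semi al phi)%E.
Proof.
move=> a0; apply: ge_ereal_sup => _ [x [y [xy ->]]].
rewrite -mulrBr normrM (gtr0_norm a0) -mulrA EFinM lee_wpmul2l// ?lee_fin ?(ltW a0)//.
by apply: ereal_sup_ubound; exists x, y.
Qed.

Lemma holder_semiZ (R : realType) (n : nat) (al a : R) (phi : 'rV[R]_n -> R) : 0 < a ->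
  holder_semi al (fun x => a * phi x) = (a%:E * holder_semi al phi)%E.
Proof.
move=> a0; apply/eqP; rewrite eq_le holder_semiZ_le//=.
have := holder_semiZ_le _ _ al a^-1 (fun x => a * phi x) _.
rewrite invr_gt0 => /(_ a0).
rewrite (_ : (fun x => _) = phi); last first.
  by apply/funext => x; rewrite mulrA mulVf ?mul1r// gt_eqF.
move=> h; apply: (@le_trans _ _ (a%:E * (a^-1%:E * holder_semi al (fun x => a * phi x)%R))%E).
  by rewrite lee_wpmul2l// lee_fin ltW.
by rewrite muleA -EFinM divff ?mul1e// gt_eqF.
Qed.

Lemma ler_add_small (R : realType) (a b c : R) : 0 <= c ->
  (forall e, 0 < e -> e < 1 -> a <= b + e * c) -> a <= b.
Proof.
move=> c0 h; rewrite leNgt; apply/negP => ba.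
pose e := Num.min (1 / 2) ((a - b) / (2 * (c + 1))).
have c1 : 0 < 2 * (c + 1) by lra.
have e0 : 0 < e by rewrite lt_min; apply/andP; split; [lra|rewrite divr_gt0// subr_gt0].
have e1 : e < 1 by rewrite gt_min; apply/orP; left; lra.
have := h e e0 e1; rewrite leNgt => /negP; apply.
have : e * (2 * (c + 1)) <= a - b by rewrite -ler_pdivlMr// ge_min lexx orbT.
by nra.
Qed.

Section density.
Context {R : realType} {n : nat} (s p : R).
Hypotheses (s0 : 0 < s) (s1 : s < 1) (p1 : 1 < p) (nsp : n%:R < s * p).
Implicit Types phi u : 'rV[R]_n -> R.

Let p0 : 0 < p. Proof. exact: lt_trans p1. Qed.

Local Notation alpha := (alpha_sp n s p).

Let alpha0 : 0 <= alpha.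
Proof. by rewrite subr_ge0 ler_pdivrMr// ltW. Qed.

Let alpha1 : alpha <= 1.
Proof. by rewrite (le_trans _ (ltW s1))// gerBl divr_ge0// ltW. Qed.

Lemma gagliardoZ (a : R) phi : measurable_fun setT (phi : RV R n -> R) ->
  gagliardo_p s p (fun x => a * phi x) = ((`|a| `^ p)%:E * gagliardo_p s p phi)%E.
Proof.
move=> mphi; rewrite (gagliardo_energy _ _ _ mphi) gagliardo_energy; last first.
  exact: measurable_funM.
rewrite -(energyZ _ _ _ (measurable_kernel_weight s p) (kernel_weight_ge0 s p)); last first.
  exact: measurable_diff.
by congr energy; apply/funext => z; rewrite /increment mulrBr.
Qed.

Lemma gagliardo_ge0 phi : measurable_fun setT (phi : RV R n -> R) ->
  (0 <= gagliardo_p s p phi)%E.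
Proof.
by move=> mphi; rewrite gagliardo_energy//; apply: energy_ge0; exact: kernel_weight_ge0.
Qed.

(** Closeness at two points and a one-sided bound on the energy are what the inequality consumes.
    The first clause speaks of all multiples because [G] is afterwards divided by its Hölder
    seminorm. *)
Lemma Cinf0_approx phi (x0 y0 : 'rV[R]_n) (e : R) : Wsp s p phi -> 0 < e ->
  exists G : 'rV[R]_n -> R,
    [/\ forall a : R, Cinf0 (fun x => a * G x), continuous G,
        (holder_semi alpha G < +oo)%E,
        (gagliardo_p s p G <= gagliardo_p s p phi + e%:E)%E &
        `|G x0 - phi x0| <= e /\ `|G y0 - phi y0| <= e].
Proof.
move=> Wphi e0; have [cphi _] := Wphi; have mphi := Wsp_measurable _ _ _ Wphi.
have [psi [L [r [B [psiB psiL [r0 psir] psiM gpsi]]]]] :=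
  cutoff_exists R n s p (`|phi x0| + `|phi y0|) (`|x0| + `|y0|) e s0 s1 p1 nsp
    (addr_ge0 (normr_ge0 _) (normr_ge0 _)) (addr_ge0 (normr_ge0 _) (normr_ge0 _)) e0.
have mpsi : measurable_fun setT (psi : RV R n -> R).
  by apply: continuous_measurable_rv; exact: lipschitz_continuous psiL.
pose f := clamp phi psi.
have psi0 x : 0 <= psi x by have /andP[] := psiB x.
have mf : measurable_fun setT (f : RV R n -> R) by exact: measurable_clamp.
have fB x : `|f x| <= B.
  by rewrite (le_trans (clamp_le _ _ _ (psi0 x)))//; have /andP[] := psiB x.
have fr x : f x != 0 -> `|x| <= r.
  move=> fx; apply: psir; apply: contra_neq fx => psix.
  by apply/eqP; rewrite -normr_eq0 eq_le normr_ge0 andbT -psix; exact: clamp_le.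
have fx0 : f x0 = phi x0.
  by apply: clamp_id; rewrite (le_trans _ (psiM _ _))// lerDl.
have fy0 : f y0 = phi y0.
  by apply: clamp_id; rewrite (le_trans _ (psiM _ _))// lerDr.
have near_phi x : exists2 d, 0 < d & forall z, `|z| <= d -> `|phi (x + z) - phi x| <= e.
  have := cphi x; move=> /(@cvgrPdist_lt R R^o _ (nbhs x) _ phi) /(_ e e0) /nbhs_ballP[d /= d0 dP].
  exists (d / 2) => [|z zd]; first exact: divr_gt0.
  rewrite distrC ltW//; apply: dP; rewrite mx_norm_ball /ball_ /= opprD addNKr normrN.
  by rewrite (le_lt_trans zd)// ltr_pdivrMr// ltr_pMr// ltr1n.
have [d1 d10 d1P] := near_phi x0; have [d2 d20 d2P] := near_phi y0.
(* Within this radius [phi] varies by at most [e] around [x0] and [y0], and [psi] by at most [e]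
   everywhere; hence the clamp varies by at most [e] around the two points. *)
pose d := Num.min (Num.min d1 d2) (e / (`|L| + 1)).
have L1 : 0 < `|L| + 1 by rewrite ltr_wpDl.
have d0 : 0 < d by rewrite !lt_min d10 d20 divr_gt0.
have dd1 : d <= d1 by rewrite !ge_min lexx.
have dd2 : d <= d2 by rewrite !ge_min lexx orbT.
have psid x z : `|z| <= d -> `|psi (x + z) - psi x| <= e.
  move=> zd; rewrite (le_trans (psiL _ _))// addrC addKr.
  apply: (@le_trans _ _ ((`|L| + 1) * `|z|)).
    by rewrite ler_wpM2r// (le_trans (ler_norm _))// lerDl.
  by rewrite mulrC -ler_pdivlMr// (le_trans zd)// ge_min lexx orbT.
have fd x d' : d <= d' -> (forall z, `|z| <= d' -> `|phi (x + z) - phi x| <= e) ->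
    forall z, `|z| <= d -> `|f (x + z) - f x| <= e.
  move=> dd' phid z zd; rewrite (le_trans (clamp_dist _ _ _ _))// ge_max.
  by rewrite psid// phid// (le_trans zd).
have [rho [Srho rho0 rhod rhoN rho1]] := mollifier_exists R n d d0.
have [LG LG0 HLG] := conv_lipschitz f B r mf r0 fB fr 0 _ (Srho 0).
have [K K0 HK] := smooth_upto_bounded _ _ (Srho 0).
exists (conv f rho); split.
- move=> a; rewrite (_ : (fun x => _) = conv f (fun x => a * rho x)).
    apply: (Cinf0_conv f B r mf r0 fB fr _ d) => [m|y].
      by apply: smooth_uptoM; [exact: smooth_upto_cst|exact: Srho].
    by rewrite mulf_eq0 negb_or => /andP[_ /rhod].
  apply/funext => x; rewrite /conv /weighted -RintegralZl//; last first.
    apply: (weighted_integrable f B r mf r0 fB fr).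
    exact: (bounded_measurable_reflect _ _ _ (Srho 0)).
  by apply: eq_Rintegral => z _; rewrite mulrCA.
- exact: lipschitz_continuous HLG.
- apply: (holder_lipschitz_lty _ _ _ _ _ _ alpha0 alpha1 HLG) => x.
  apply: (weighted_le f B r mf r0 fB fr _ K) => [|z]; last exact: HK.
  exact: (bounded_measurable_reflect _ _ _ (Srho 0)).
- have := gagliardo_conv f B r rho d mf r0 fB fr (ltW d0) Srho rho0 rhod rhoN rho1 s p p1.
  move=> /le_trans; apply; apply: (le_trans (gagliardo_clamp s p _ _ p1 mphi mpsi)).
  exact: leeD.
- have cl := conv_close f B rho d mf fB (ltW d0) Srho rho0 rhod rhoN rho1.
  split; [rewrite -fx0|rewrite -fy0]; apply: cl; [exact: (fd _ d1)|exact: (fd _ d2)].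
Qed.

Lemma msp_ge0 : (0 <= msp n s p)%E.
Proof.
apply: le_ereal_inf_tmp => _ [phi [Cphi _] <-]; apply: gagliardo_ge0.
by apply: continuous_measurable_rv; have [/(_ 0%N)] := Cphi.
Qed.

(** Divided by its Hölder seminorm, [G] is admissible in the infimum, and the quotient at the given
    pair is at most that seminorm. If the seminorm is 0, so is the left-hand side. *)
Lemma msp_le_Cinf0 G (x0 y0 : 'rV[R]_n) : x0 != y0 ->
  (forall a : R, Cinf0 (fun x => a * G x)) -> continuous G ->
  (holder_semi alpha G < +oo)%E ->
  (msp n s p * ((`|G x0 - G y0| / enorm (x0 - y0) `^ alpha) `^ p)%:E <= gagliardo_p s p G)%E.
Proof.
move=> xy CG cG hG; have mG := continuous_measurable_rv _ _ _ cG.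
set Q := `|G x0 - G y0| / _.
have Q0 : 0 <= Q by rewrite divr_ge0// powR_ge0.
have QG : (Q%:E <= holder_semi alpha G)%E by apply: ereal_sup_ubound; exists x0, y0.
have hf : holder_semi alpha G \is a fin_num.
  by rewrite ge0_fin_numE// (le_trans _ QG)// lee_fin.
pose h := fine (holder_semi alpha G).
have Qh : Q <= h by rewrite -lee_fin /h fineK.
have [h0|h0] := leP h 0.
  have -> : Q = 0 by apply/eqP; rewrite eq_le Q0 andbT (le_trans Qh).
  by rewrite powR0 ?gt_eqF// mule0; exact: gagliardo_ge0.
have mle : (msp n s p <= gagliardo_p s p (fun x => h^-1 * G x)%R)%E.
  apply: ereal_inf_lbound; exists (fun x => h^-1 * G x) => //; split; first exact: CG.
  rewrite holder_semiZ ?invr_gt0// -[X in (_ * X)%E](fineK hf) -/h -EFinM.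
  by rewrite mulVf// gt_eqF.
rewrite gagliardoZ// in mle.
apply: (@le_trans _ _ (msp n s p * (h `^ p)%:E)%E).
  by rewrite lee_wpmul2l ?msp_ge0// lee_fin ge0_ler_powR ?nnegrE// ltW.
apply: (@le_trans _ _ ((`|h^-1| `^ p)%:E * gagliardo_p s p G * (h `^ p)%:E)%E).
  by rewrite lee_wpmul2r// lee_fin powR_ge0.
rewrite muleAC -EFinM -powRM//; last exact: ltW.
by rewrite gtr0_norm ?invr_gt0// mulVf ?gt_eqF// powR1 mul1e.
Qed.

(** An approximant loses at most a factor (1 - e)^p on the left and gains at most [e] on the right;
    both effects disappear as [e] tends to 0. *)
Lemma msp_le_gagliardo phi (x0 y0 : 'rV[R]_n) : x0 != y0 -> Wsp s p phi ->
  (msp n s p * ((`|phi x0 - phi y0| / enorm (x0 - y0) `^ alpha) `^ p)%:E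
   <= gagliardo_p s p phi)%E.
Proof.
move=> xy Wphi; have mphi := Wsp_measurable _ _ _ Wphi.
have g0 := gagliardo_ge0 _ mphi.
have goo : (gagliardo_p s p phi < +oo)%E by case: Wphi => _ [].
have gf : gagliardo_p s p phi \is a fin_num by rewrite ge0_fin_numE.
set E := enorm (x0 - y0) `^ alpha.
have E0 : 0 < E by rewrite powR_gt0// enorm_gt0// subr_eq0.
set D := `|phi x0 - phi y0|.
have [D0|D0] := eqVneq D 0; first by rewrite D0 mul0r powR0 ?gt_eqF// mule0.
have {}D0 : 0 < D by rewrite lt_def D0 normr_ge0.
pose Q := (D / E) `^ p.
have Q0 : 0 < Q by rewrite powR_gt0// divr_gt0.
have key e : 0 < e -> e < 1 ->
    (msp n s p * ((1 - e) `^ p * Q)%:E <= gagliardo_p s p phi + e%:E)%E.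
  (* Two errors of size [d] change the difference of the values by at most e D, so at least (1 - e)
     D is left of it. *)
  move=> e0 e1; pose d := Num.min e (e * D / 2).
  have d0 : 0 < d by rewrite lt_min e0 divr_gt0// mulr_gt0.
  have de : d <= e by rewrite ge_min lexx.
  have dD : 2 * d <= e * D.
    by rewrite mulrC -ler_pdivlMr// ge_min lexx orbT.
  have [G [CG cG hG gG [Gx Gy]]] := Cinf0_approx phi x0 y0 d Wphi d0.
  have := msp_le_Cinf0 G x0 y0 xy CG cG hG; rewrite -/E => mG.
  apply: (@le_trans _ _ (gagliardo_p s p phi + d%:E)%E); last by rewrite leeD2l// lee_fin.
  apply: le_trans gG; apply: le_trans mG.
  rewrite lee_wpmul2l ?msp_ge0// lee_fin /Q -powRM; last 2 first.
  - by rewrite subr_ge0 ltW.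
  - by rewrite divr_ge0// ltW.
  have ee : 0 <= 1 - e by rewrite subr_ge0 ltW.
  apply: (ge0_ler_powR (ltW p0)).
  - by rewrite nnegrE mulr_ge0// divr_ge0// ltW.
  - by rewrite nnegrE divr_ge0// ltW.
  rewrite mulrA ler_wpM2r ?invr_ge0 ?(ltW E0)//.
  have : D <= `|G x0 - G y0| + (d + d).
    rewrite /D (_ : phi x0 - phi y0 = (G x0 - G y0) + (- (G x0 - phi x0) + (G y0 - phi y0))); last by ring.
    rewrite (le_trans (ler_normD _ _))// lerD2l (le_trans (ler_normD _ _))// normrN.
    exact: lerD.
  by move: dD; lra.
(* An infinite constant would contradict [key] at e = 1/2, since [Q] is positive and the energy of
   [phi] finite. *)
have msp_fin : msp n s p \is a fin_num.
  rewrite ge0_fin_numE ?msp_ge0//; rewrite ltNge leye_eq; apply/negP => /eqP mE.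
  have h1 : 0 < 2^-1 :> R by rewrite invr_gt0.
  have h2 : 2^-1 < 1 :> R by rewrite invf_lt1// ltr1n.
  have := key _ h1 h2.
  rewrite mE gt0_mulye; last by rewrite lte_fin mulr_gt0// powR_gt0// subr_gt0.
  by rewrite -(fineK gf) -EFinD leNgt ltry.
pose m := fine (msp n s p).
have m0 : 0 <= m by rewrite fine_ge0// msp_ge0.
rewrite -/Q -(fineK gf) -(fineK msp_fin) -/m -EFinM lee_fin.
(* By Bernoulli (1 - e)^p >= 1 - p e, so the total error is at most e (1 + p m Q). *)
have c0 : 0 <= 1 + p * (m * Q) by rewrite addr_ge0// !mulr_ge0// ltW.
apply: (ler_add_small _ _ _ _ c0) => e e0 e1.
have := key e e0 e1; rewrite -(fineK gf) -(fineK msp_fin) -/m -EFinM -EFinD lee_fin mulrCA => h1.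
have e1' : 0 < 1 - e by rewrite subr_gt0.
have b : 1 + p * (1 - e - 1) < `|1 - e| `^ p.
  by apply: powR_bernoulli => //; rewrite lt_eqF// gtrBl.
rewrite (gtr0_norm e1') in b.
have mQ0 : 0 <= m * Q by rewrite mulr_ge0// ltW.
have h2 : (1 + p * (1 - e - 1)) * (m * Q) <= (1 - e) `^ p * (m * Q).
  by rewrite ler_wpM2r// ltW.
have := le_trans h2 h1; clear; lra.
Qed.

End density.

(** * Extremals *)

Lemma lipschitz_continuous_rv (R : realType) (n : nat) (T : 'rV[R]_n -> 'rV[R]_n) (L : R) :
  (forall x y, `|T x - T y| <= L * `|x - y|) -> continuous T.
Proof.
move=> LT x; apply/(@cvgrPdist_lt R _ _ (nbhs x) _ T) => e e0; apply/nbhs_ballP.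
have L1 : 0 < `|L| + 1 by rewrite ltr_wpDl.
exists (e / (`|L| + 1)) => /=; first exact: divr_gt0.
move=> y; rewrite mx_norm_ball /ball_ /= => xy.
apply: le_lt_trans (LT x y) _; apply: (@le_lt_trans _ _ ((`|L| + 1) * `|x - y|)).
  by rewrite ler_wpM2r// (le_trans (ler_norm _))// lerDl.
by rewrite mulrC -ltr_pdivlMr.
Qed.

(** The scaling identity behind [minimal_bound]: (U / D)^p comes from rescaling the values and (e1 /
    e0)^(a p) from the similarity. The lengths cancel because the energy scales with the exponent s
    p - n, which is p times the Hölder exponent. *)
Lemma quotient_similarity {R : realType} (a p U D e0 e1 : R) :
  0 <= U -> 0 < D -> 0 < e0 -> 0 < e1 ->
  (U / D) `^ p * (e1 / e0) `^ (a * p) * (D / e1 `^ a) `^ p = (U / e0 `^ a) `^ p.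
Proof.
move=> U0 D0 e00 e10; have r0 : 0 < e1 / e0 by rewrite divr_gt0.
have U1 : 0 <= U / D by rewrite divr_ge0// ltW.
have D1 : 0 <= D / e1 `^ a by rewrite divr_ge0 ?powR_ge0// ltW.
rewrite powRrM -powRM ?powR_ge0// -powRM ?(mulr_ge0 U1) ?powR_ge0//; congr (_ `^ _).
have -> : e1 `^ a = (e1 / e0) `^ a * e0 `^ a.
  by rewrite -powRM ?(ltW r0) ?(ltW e00)// divfK// gt_eqF.
have n0 : e0 `^ a != 0 by rewrite gt_eqF// powR_gt0.
have n1 : (e1 / e0) `^ a != 0 by rewrite gt_eqF// powR_gt0.
have nD : D != 0 by rewrite gt_eqF.
by field; apply/and3P.
Qed.

Lemma lee_pmul_fin {R : realType} (g g' : \bar R) (k q q' : R) :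
  0 <= q -> k * q = q' -> (g <= k%:E * g')%E -> (g * q%:E <= g' * q'%:E)%E.
Proof.
move=> q0 <- gg'; rewrite EFinM muleA (muleC g'); apply: lee_wpmul2r => //.
Qed.

Section extremal.
Context {R : realType} {n : nat} (s p : R).
Hypotheses (s0 : 0 < s) (s1 : s < 1) (p1 : 1 < p) (nsp : n%:R < s * p).
Implicit Types phi u : 'rV[R]_n -> R.

Let p0 : 0 < p. Proof. exact: lt_trans p1. Qed.

Local Notation alpha := (alpha_sp n s p).

Let alphap : alpha * p = s * p - n%:R.
Proof. by rewrite /alpha_sp mulrBl divfK// gt_eqF. Qed.

(** A cone of slope 1 and height |x0 - y0| with apex over [x0], vanishing at [y0]. It excludes
    constant solutions of the equation when the coefficient is nonzero. *)
Lemma Wsp_separates (x0 y0 : 'rV[R]_n) : x0 != y0 ->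
  exists2 phi, Wsp s p phi & phi x0 != phi y0.
Proof.
move=> xy; pose e := `|x0 - y0|.
have e0 : 0 < e by rewrite normr_gt0 subr_eq0.
pose phi (x : 'rV[R]_n) := Num.max 0 (e - `|x - x0|).
have Lphi x y : `|phi x - phi y| <= 1 * `|x - y|.
  rewrite mul1r (le_trans (max_dist _ _ _ _))// subrr normr0 ge_max normr_ge0 /=.
  rewrite (_ : e - `|x - x0| - (e - `|y - x0|) = `|y - x0| - `|x - x0|); last by ring.
  rewrite (le_trans (ler_dist_dist _ _))// opprB addrA subrK.
  by rewrite distrC.
have phie x : `|phi x| <= e.
  by rewrite ger0_norm ?le_max ?lexx// ge_max (ltW e0) gerBl/=.
exists phi; last first.
  have phix : phi x0 = e by rewrite /phi subrr normr0 subr0; apply/max_idPr; exact: ltW.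
  have phiy : phi y0 = 0 by rewrite /phi distrC -/e subrr maxxx.
  by rewrite phix phiy gt_eqF.
have cphi : continuous phi by exact: lipschitz_continuous Lphi.
split => //; split.
  apply: (holder_lipschitz_lty _ _ _ _ _ _ _ _ Lphi phie).
    by rewrite subr_ge0 ler_pdivrMr// ltW.
  by rewrite (le_trans _ (ltW s1))// gerBl divr_ge0// ltW.
apply: (gagliardo_lipschitz_lty s p s0 s1 p1 phi e 1 (e + `|x0|)) => //.
- exact: continuous_measurable_rv.
- exact: ltW.
- by rewrite addr_ge0// ltW.
move=> x; apply: contraR; rewrite -ltNge => ex; apply/eqP/max_idPl.
rewrite subr_le0 -(lerD2r `|x0|) (le_trans (ltW ex))//.
by rewrite -{1}(subrK x0 x) ler_normD.
Qed.

(** A constant [u] would make the left-hand side vanish on a function separating the two points. For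
    nonconstant [u], testing with [u] gives c (u(x0) - u(y0)) = [u]^p > 0. *)
Lemma nonconstant_weak (x0 y0 : 'rV[R]_n) u (c : R) : x0 != y0 -> Wsp s p u -> c != 0 ->
  (forall phi, Wsp s p phi -> weak_lhs s p u phi = (c * (phi x0 - phi y0))%:E) ->
  u x0 != u y0.
Proof.
move=> xy Wu c0 uweak.
have ncu : nonconstant u.
  apply: contrapT => cu; have [phi Wphi phixy] := Wsp_separates x0 y0 xy.
  have ucst x y : u x - u y = 0.
    apply/eqP; rewrite subr_eq0; apply: contraT => uxy; exfalso; apply: cu.
    by exists x, y.
  have := uweak _ Wphi; rewrite weak_lhs_pairing//; [|by case: Wu|by case: Wphi].
  rewrite /pairing integral0_eq.
    move=> [] /esym/eqP; rewrite mulf_eq0 subr_eq0 (negbTE c0) /=.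
    by rewrite (negbTE phixy).
  by move=> z _; rewrite /increment ucst /Jp !mulr0 !mul0r.
have := energy_gt0 s p u Wu ncu; have := uweak _ Wu.
rewrite weak_lhs_pairing; [|exact: p1|by case: Wu|by case: Wu].
rewrite pairing_diag; last exact: p1.
move=> ->; rewrite lte_fin.
by move=> h; apply: contraTneq h => ->; rewrite subrr mulr0 ltxx.
Qed.

(* The competitor is [phi] composed with a similarity sending [(x0, y0)] to
   [(x1, y1)], corrected affinely to agree with [u] at [x0] and [y0]. *)
Lemma minimal_bound (x0 y0 x1 y1 : 'rV[R]_n) u phi : x0 != y0 -> x1 != y1 ->
  Wsp s p u -> minimal_between s p x0 y0 u -> Wsp s p phi ->
  (gagliardo_p s p u * ((`|phi x1 - phi y1| / enorm (x1 - y1) `^ alpha) `^ p)%:E <=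
   gagliardo_p s p phi * ((`|u x0 - u y0| / enorm (x0 - y0) `^ alpha) `^ p)%:E)%E.
Proof.
move=> xy0 xy1 Wu umin Wphi.
have mphi := Wsp_measurable _ _ _ Wphi; have g0 := gagliardo_ge0 s p phi mphi.
have [D0|D0] := eqVneq (phi x1) (phi y1).
  rewrite D0 subrr normr0 mul0r powR0 ?gt_eqF// mule0 mule_ge0//.
  by rewrite lee_fin powR_ge0.
have e0 : 0 < enorm (x0 - y0) by rewrite enorm_gt0// subr_eq0.
have e1 : 0 < enorm (x1 - y1) by rewrite enorm_gt0// subr_eq0.
pose r := enorm (x1 - y1) / enorm (x0 - y0).
have r0 : 0 < r by rewrite divr_gt0.
(* The reflection for this [v] carries x0 - y0 to (x1 - y1) / r, which has the same length. *)
pose v := (x0 - y0) - r^-1 *: (x1 - y1).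
pose T x := r *: householder v (x - y0) + y1.
have Tx : T x0 = x1.
  rewrite /T /v householder_swap; last first.
    rewrite enormZ gtr0_norm ?invr_gt0// /r invfM invrK mulrC mulrA divff ?mul1r//.
    by rewrite gt_eqF.
  by rewrite scalerA divff ?gt_eqF// scale1r subrK.
have Ty : T y0 = y1.
  have -> : T y0 = r *: householder v 0 + y1 by rewrite /T subrr.
  have h0 : householder v 0 = 0 by apply: (addrI (householder v 0)); rewrite -householderD !addr0.
  by rewrite h0 scaler0 add0r.
have TD x y : enorm (T x - T y) = r * enorm (x - y).
  rewrite /T opprD addrACA subrr addr0 -scalerBr -householderN -householderD.
  by rewrite enormZ enorm_householder gtr0_norm// opprB addrA subrK.
have cT : continuous T.
  apply: (lipschitz_continuous_rv _ _ _ (r * n%:R)) => x y.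
  rewrite (le_trans (norm_le_enorm _))// TD -mulrA ler_wpM2l ?(ltW r0)//.
  exact: enorm_le_norm.
pose phiT x := phi (T x).
have gT : gagliardo_p s p phiT = ((r `^ (s * p - n%:R))%:E * gagliardo_p s p phi)%E.
  exact: (gagliardo_similarity R n s p r v y0 y1 phi r0 mphi).
have WT : Wsp s p phiT.
  have [cphi [hphi gphi]] := Wphi; split.
    by move=> x; apply: continuous_comp; [exact: cT|exact: cphi].
  split; last by rewrite gT lte_mul_pinfty// lee_fin powR_ge0.
  move/holder_semi_ltyP : hphi => [M HM]; apply/holder_semi_ltyP; exists (M * r `^ alpha) => x y xy.
  have Txy : T x != T y.
    have : 0 < enorm (T x - T y) by rewrite TD mulr_gt0// enorm_gt0// subr_eq0.
    by apply: contraTneq => ->; rewrite subrr -(scale0r (0 : 'rV[R]_n)) enormZ normr0 mul0r ltxx.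
  have := HM _ _ Txy; rewrite TD powRM ?enorm_ge0 ?(ltW r0)// mulrA; exact: id.
pose A := (u x0 - u y0) / (phi x1 - phi y1).
pose chi x := (u x0 - A * phi x1) + A * phiT x.
have Wchi : Wsp s p chi by apply: Wsp_lin => //; exact: Wsp_cst.
have D1 : phi x1 - phi y1 != 0 by rewrite subr_eq0.
have chix : chi x0 = u x0 by rewrite /chi /phiT Tx subrK.
have chiy : chi y0 = u y0.
  transitivity (u x0 - A * (phi x1 - phi y1)); first by rewrite /chi /phiT Ty; ring.
  by rewrite /A divfK// opprB addrC subrK.
have := umin _ Wchi chix chiy.
have -> : gagliardo_p s p chi = ((`|A| `^ p)%:E * gagliardo_p s p phiT)%E.
  have mT := Wsp_measurable _ _ _ WT.
  rewrite -(gagliardoZ s p A phiT mT) (Wsp_gagliardo_energy _ _ _ Wchi) gagliardo_energy.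
    by congr energy; apply/funext => z; rewrite /increment /chi; ring.
  exact: measurable_funM.
rewrite gT muleA -EFinM => umin'.
apply: (lee_pmul_fin _ _ _ _ _ _ _ umin'); first exact: powR_ge0.
rewrite -alphap /A normf_div; apply: quotient_similarity => //.
by rewrite normr_gt0.
Qed.

End extremal.

(** * Minimality for a pair of points and extremality *)

Lemma ler_powRV {R : realType} {p t k : R} : 0 < p -> 0 <= t -> t `^ p <= k ->
  t <= k `^ p^-1.
Proof.
move=> p0 t0 tk; rewrite -(powRr1 t0) -(divff (lt0r_neq0 p0)) powRrM.
by rewrite ge0_ler_powR ?nnegrE ?invr_ge0 ?(ltW p0)// ?powR_ge0// (le_trans _ tk)// powR_ge0.
Qed.

Section minimizers_are_extremal.
Context {R : realType} {n : nat} (s p : R).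
Hypotheses (s0 : 0 < s) (s1 : s < 1) (p1 : 1 < p) (nsp : n%:R < s * p).
Variables (x0 y0 : 'rV[R]_n) (u : 'rV[R]_n -> R).
Hypotheses (xy : x0 != y0) (Wu : Wsp s p u).

Let p0 : 0 < p. Proof. exact: lt_trans p1. Qed.

Local Notation alpha := (alpha_sp n s p).
Local Notation q phi x y := (`|phi x - phi y| / enorm (x - y) `^ alpha).

Lemma holder_semi_max :
  (forall x y, x != y -> q u x y <= q u x0 y0) ->
  holder_semi alpha u = (q u x0 y0)%:E.
Proof.
move=> uq; apply/eqP; rewrite eq_le; apply/andP; split.
  by apply: ge_ereal_sup => _ [x [y [nxy ->]]]; rewrite lee_fin; exact: uq.
by apply: ereal_sup_ubound; exists x0, y0.
Qed.

(** The quotient at the pair depends only on the two prescribed values, so it is the same for all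
    competitors. *)
Lemma extremal_minimal : extremal s p u -> holder_semi alpha u = (q u x0 y0)%:E ->
  minimal_between s p x0 y0 u.
Proof.
move=> [_ [_ gu]] hu phi Wphi phix phiy; rewrite gu hu /= -phix -phiy.
exact: msp_le_gagliardo.
Qed.

Lemma minimal_extremal : minimal_between s p x0 y0 u -> u x0 != u y0 ->
  extremal s p u /\ holder_semi alpha u = (q u x0 y0)%:E.
Proof.
move=> umin uxy.
have nu : nonconstant u by exists x0, y0.
have q0 : 0 < q u x0 y0.
  apply: divr_gt0; first by rewrite normr_gt0 subr_eq0.
  by apply: powR_gt0; apply: enorm_gt0; rewrite subr_eq0.
have qp0 : 0 < (q u x0 y0) `^ p by rewrite powR_gt0.
have qge0 (phi : 'rV[R]_n -> R) (x y : 'rV[R]_n) : 0 <= q phi x y by rewrite divr_ge0// powR_ge0.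
have [g g0 gu] : exists2 g, 0 < g & gagliardo_p s p u = g%:E.
  have := energy_gt0 s p u Wu nu; rewrite -(Wsp_gagliardo_energy s p u Wu).
  have [_ [_]] := Wu; case: (gagliardo_p s p u) => [g _|//|//].
  by rewrite lte_fin => g0; exists g.
have qle (phi : 'rV[R]_n -> R) h (x y : 'rV[R]_n) :
    Wsp s p phi -> gagliardo_p s p phi = h%:E -> x != y ->
    (q phi x y) `^ p <= h / g * (q u x0 y0) `^ p.
  move=> Wphi gphi nxy.
  have := minimal_bound s p p1 x0 y0 x y u phi xy nxy Wu umin Wphi.
  rewrite gu gphi -!EFinM lee_fin mulrC -ler_pdivlMr// => /le_trans; apply.
  by rewrite mulrAC.
have hu : holder_semi alpha u = (q u x0 y0)%:E.
  apply: holder_semi_max => x y nxy; rewrite leNgt; apply/negP => lt_q.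
  have := qle u g x y Wu gu nxy; rewrite divff ?gt_eqF// mul1r leNgt.
  by rewrite gt0_ltr_powR ?nnegrE ?qge0.
split; last exact: hu.
split; first exact: Wu.
split; first exact: nu.
rewrite hu /=; apply/eqP; rewrite eq_le; apply/andP; split; last first.
  exact: msp_le_gagliardo.
(* For a test function of seminorm 1 and energy [h], the supremum of [qle] over all pairs yields 1
   <= (h / g) Q^p, with Q the quotient of [u] at the given pair; this is g / Q^p <= h. *)
suff gm : ((g / (q u x0 y0) `^ p)%:E <= msp n s p)%E.
  rewrite gu; apply: (@le_trans _ _ ((g / (q u x0 y0) `^ p)%:E * ((q u x0 y0) `^ p)%:E)%E).
    by rewrite -EFinM divfK// gt_eqF.
  by apply: lee_wpmul2r => //; rewrite lee_fin ltW.
apply: le_ereal_inf_tmp => _ [phi [Cphi hphi] <-].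
have [gphi|] := ltP (gagliardo_p s p phi) +oo%E; last first.
  by rewrite leye_eq => /eqP ->; exact: leey.
have Wphi : Wsp s p phi.
  split; first exact: (Cphi.1 0%N).
  by split; [rewrite hphi ltry|].
have gphi0 := gagliardo_ge0 s p phi (Wsp_measurable s p phi Wphi).
have [h h0 gphiE] : exists2 h, 0 <= h & gagliardo_p s p phi = h%:E.
  by move: gphi gphi0; case: (gagliardo_p s p phi) => [h|//|//] _; rewrite lee_fin => h0; exists h.
have k0 : 0 <= h / g * (q u x0 y0) `^ p by rewrite mulr_ge0 ?divr_ge0 ?(ltW g0) ?(ltW qp0).
rewrite gphiE lee_fin ler_pdivrMr//.
(* The p-th root is taken before passing to the supremum, since the seminorm is a supremum of
   quotients and not of their powers. *)
have qk (x y : 'rV[R]_n) : x != y -> q phi x y <= (h / g * (q u x0 y0) `^ p) `^ p^-1.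
  by move=> nxy; apply: (ler_powRV p0); [exact: qge0|exact: qle].
have : (holder_semi alpha phi <= ((h / g * (q u x0 y0) `^ p) `^ p^-1)%:E)%E.
  by apply: ge_ereal_sup => _ [x [y [nxy ->]]]; rewrite lee_fin; exact: qk.
rewrite hphi lee_fin => k1.
have : 1 `^ p <= ((h / g * (q u x0 y0) `^ p) `^ p^-1) `^ p.
  by rewrite ge0_ler_powR ?nnegrE ?powR_ge0 ?(ltW p0).
rewrite powR1 -powRrM mulVf ?gt_eqF// powRr1// mulrAC.
by rewrite ler_pdivlMr// mul1r.
Qed.

End minimizers_are_extremal.

Theorem theorem7p4 (R : realType) (N : nat) (s p : R) (x0 y0 : 'rV[R]_N)
  (hN : (1 <= N)%N) (hs0 : 0 < s) (hs1 : s < 1) (hp : 1 < p)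
  (hsp : N%:R < s * p) (hxy : x0 != y0) (u : 'rV[R]_N -> R) :
  let alpha := alpha_sp N s p in
  let P1 := extremal s p u /\
            holder_semi alpha u =
              ((`|u x0 - u y0| / (enorm (x0 - y0)) `^ alpha)%:E) in
  let P2 := Wsp s p u /\
            exists c : R, c != 0 /\
              forall phi : 'rV[R]_N -> R, Wsp s p phi ->
                weak_lhs s p u phi = ((c * (phi x0 - phi y0))%:E) in
  let P3 := Wsp s p u /\ nonconstant u /\
            (forall phi : 'rV[R]_N -> R, Wsp s p phi ->
               phi x0 = u x0 -> phi y0 = u y0 ->
               (gagliardo_p s p u <= gagliardo_p s p phi)%E) /\
            (forall phi : 'rV[R]_N -> R, Wsp s p phi ->
               phi x0 = u x0 -> phi y0 = u y0 ->
               gagliardo_p s p phi = gagliardo_p s p u -> phi = u) in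
  (P1 <-> P2) /\ (P2 <-> P3).
Proof.
move=> alpha P1 P2 P3; split; split.
- move=> [eu hu]; have [Wu [nu _]] := eu.
  split; first exact: Wu.
  apply: (minimal_weak s p hp) => //.
  exact: (extremal_minimal s p hs0 hs1 hp hsp x0 y0 u hxy eu hu).
- move=> [Wu [c [c0 uweak]]].
  apply: (minimal_extremal s p hs0 hs1 hp hsp x0 y0 u hxy Wu).
    by have [] := weak_minimal s p hp x0 y0 u c Wu uweak.
  exact: (nonconstant_weak s p hs0 hs1 hp hsp x0 y0 u c hxy Wu c0 uweak).
- move=> [Wu [c [c0 uweak]]].
  have [umin uuniq] := weak_minimal s p hp x0 y0 u c Wu uweak.
  split; first exact: Wu.
  split; last by split; [exact: umin|exact: uuniq].
  exists x0, y0.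
  exact: (nonconstant_weak s p hs0 hs1 hp hsp x0 y0 u c hxy Wu c0 uweak).
move=> [Wu [nu [umin _]]]; split; first exact: Wu.
exact: (minimal_weak s p hp x0 y0 u Wu nu umin).
Qed.
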